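(* Let $s\in(0,1)$, $a=1-2s$, $T>0$, and let $F$ be a smooth even double-well potential such that $F(1)=F(-1)=0<F(u)$ for all $-1<u<1$, $F'(1)=F'(-1)=0$, and $F$ is nondecreasing in $(-1,0)$ and nonincreasing in $(0,1)$. Assume $U(x,y)$ is the $s$-harmonic extension of an even periodic solution $u(x)$ of $$(-\partial_{xx})^su(x)+F'(u(x))=0,\qquad u(x+T)=u(x)\quad\text{in }\mathbb{R}.$$ Let $C_T$ be the constant value (independent of $x\in\mathbb{R}$) of $$\frac{1}{2}\int_0^\infty\left[U_x^2(x,y)-U_y^2(x,y)\right]y^a\,dy-F(U(x,0)),$$ and set $\hat C:=\sup_{x\in\mathbb{R}}\{-F(u(x))-C_T\}$. Then $\hat C>0$, and for every $y\ge0$ and all $x\in\mathbb{R}$ $$\frac{1}{2}\int_0^y\left[U_x^2(x,\tau)-U_y^2(x,\tau)\right]\tau^a\,d\tau-F(U(x,0))-C_T\le\hat C .$$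
   Context: $(-\partial_{xx})^s$ is the usual fractional Laplacian on $\mathbb{R}$, the Fourier multiplier with symbol $|\xi|^{2s}$. The $s$-harmonic extension of $u$ is the function on the half-plane given by $U(x,y)=\int_{\mathbb{R}}p_s(x-z,y)u(z)\,dz$ for $y>0$ and $U(x,0)=u(x)$, where $p_s(x,y)=C_{1,s}\frac{y^{2s}}{(x^2+y^2)^{(1+2s)/2}}$ is the $s$-Poisson kernel and $C_{1,s}$ is the constant such that $\int_{\mathbb{R}}p_s(x,y)\,dx=1$. It solves $\mathrm{div}(y^a\nabla U)=0$ in $\{(x,y):x\in\mathbb{R},\,y>0\}$ with $U(x,0)=u(x)$. That the quantity defining $C_T$ does not depend on $x$ is the Hamiltonian identity, stated for every periodic solution $u$ of the equation.
   Formalization: Ĉ>0 is claimed only for nonconstant u (for u≡1 one has C_T=0 and Ĉ=0); the factor 1/2 in the Hamiltonian is replaced by κ/2 for any κ>0 making it independent of x, since with symbol |ξ|^{2s} the value κ=1 fits only s=1/2. *)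

(* Defs.v *)
From HB Require Import structures.
From mathcomp Require Import all_boot all_order all_algebra.
From mathcomp Require Import all_classical all_reals all_analysis.
Set Implicit Arguments.
Unset Strict Implicit.
Unset Printing Implicit Defensive.
Import Order.TTheory GRing.Theory Num.Theory.
Import numFieldNormedType.Exports.
Local Open Scope classical_set_scope.
Local Open Scope ring_scope.

Definition smooth (R : realType) (F : R -> R) : Prop :=
  forall (n : nat) (x : R), derivable (derive1n n F) x 1.

Definition double_well (R : realType) (F : R -> R) : Prop :=
  [/\ smooth F,
      (forall x, F (- x) = F x),
      [/\ F 1 = 0, F (-1) = 0, (forall x, -1 < x < 1 -> 0 < F x),
          derive1 F 1 = 0 & derive1 F (-1) = 0],
      (forall x y, -1 < x -> x <= y -> y < 0 -> F x <= F y) &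
      (forall x y, 0 < x -> x <= y -> y < 1 -> F y <= F x)].

Definition frequency (R : realType) (T : R) (k : nat) : R := 2 * pi * k%:R / T.

Definition cos_coef (R : realType) (T : R) (u : R -> R) (k : nat) : R :=
  \int[lebesgue_measure]_(x in `[0, T]) (u x * cos (frequency T k * x)).

Definition sin_coef (R : realType) (T : R) (u : R -> R) (k : nat) : R :=
  \int[lebesgue_measure]_(x in `[0, T]) (u x * sin (frequency T k * x)).

(* f = (-d_xx)^s u for T-periodic continuous u and f.  The Fourier transform of
   a T-periodic function is carried by the frequencies 2 pi k / T, so the
   multiplier |xi|^(2s) acts on the Fourier coefficients; in real form, the
   frequencies +xi and -xi share the value xi^(2s) of the symbol. *)
Definition is_fracLap (R : realType) (s T : R) (u f : R -> R) : Prop :=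
  forall k : nat,
    cos_coef T f k = frequency T k `^ (2 * s) * cos_coef T u k /\
    sin_coef T f k = frequency T k `^ (2 * s) * sin_coef T u k.

Definition poisson_kernel (R : realType) (C s x y : R) : R :=
  C * (y `^ (2 * s) / (x ^+ 2 + y ^+ 2) `^ ((1 + 2 * s) / 2)).

Definition poisson_normalized (R : realType) (C s : R) : Prop :=
  forall y : R, 0 < y ->
    (\int[lebesgue_measure]_x (poisson_kernel C s x y)%:E = 1)%E.

Definition is_s_harmonic_extension (R : realType) (C s : R) (u : R -> R)
    (U : R -> R -> R) : Prop :=
  (forall x y, 0 < y ->
     U x y = \int[lebesgue_measure]_z (poisson_kernel C s (x - z) y * u z)) /\
  (forall x, U x 0 = u x).

(* The integral over D (a set of values of y > 0) of (U_x^2 - U_y^2) y^a. *)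
Definition weighted_energy (R : realType) (a : R) (U : R -> R -> R) (x : R)
    (D : set R) : R :=
  \int[lebesgue_measure]_(y in D)
    ((derive1 (fun x' => U x' y) x ^+ 2 - derive1 (fun y' => U x y') y ^+ 2) * y `^ a).

(* The first integral along a vertical half-line, with a normalization factor
   kappa in front of the energy.  The extension U of u satisfies
   (-d_xx)^s u = - kappa_s lim_(y -> 0+) y^a U_y with
   kappa_s = 2^(2s-1) Gamma(s) / Gamma(1-s), so that for
   (-d_xx)^s u + F'(u) = 0 it is the energy with kappa = kappa_s that is
   independent of x.  The usual formula with factor 1/2 is kappa = 1: either
   s = 1/2, where kappa_s = 1, or kappa_s is absorbed in the normalization. *)
Definition hamiltonian (R : realType) (kappa a : R) (F : R -> R)
    (U : R -> R -> R) (x : R) (D : set R) : R :=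
  kappa / 2 * weighted_energy a U x D - F (U x 0).

(* Main.v *)
Require Import Defs.
From HB Require Import structures.
From mathcomp Require Import all_boot all_order all_algebra.
From mathcomp Require Import all_classical all_reals all_analysis.
From mathcomp Require Import measurable_realfun.
From mathcomp Require Import ring lra.
Set Implicit Arguments.
Unset Strict Implicit.
Unset Printing Implicit Defensive.
Import Order.TTheory GRing.Theory Num.Theory.
Import numFieldNormedType.Exports.
Local Open Scope classical_set_scope.
Local Open Scope ring_scope.

(** Write a = 1 - 2s, X = U_x and Z = y^a U_y.  The quantity to be bounded is
    v(x, y) = kappa/2 int_0^y Q - F(u(x)) - C_T, where
    Q = y^a X^2 - y^(-a) Z^2 is the density of the energy.  By the Hamiltonian
    identity v(x, y) = - kappa/2 W(x, y), where W is the integral of Q over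
    [y, +oo), and the equation of U gives W_x = 2 X Z and W_y = - Q.  Three facts
    about v prove the theorem.

    Boundary values.  v tends to 0 uniformly as y -> +oo, since X and U_y are
    O(1/y), and v(x, y) <= - F(u(x)) - C_T + o(1) uniformly as y -> 0.  The
    latter needs some regularity of U up to the boundary, and this is the only
    place where the equation for u is used: Z is bounded, because up to a factor
    it is the extension, for the exponent 1 - s, of (-d_xx)^s u = - F'(u)
    (conjugate_extension).  Then Z_x = O(1/y) and U_xy = y^(-a) Z_x can be
    integrated down to y = 0 (X_near0).

    Maximum principle (no_interior_max, max_principle).  At an interior maximum
    of d y^2 - W with d > 0, the gradient equations and the equation of U
    contradict the signs of the second derivatives.  So v is at most the larger
    of Chat and 0.

    Sign of Chat.  As u is even, X vanishes on the axis x = 0, so there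
    - F(u(0)) - C_T = kappa/2 int_0^oo y^(-a) Z(0, y)^2 dy >= 0.  If Chat = 0,
    then U is constant on the axis, and an even u whose extension is constant on
    the axis is constant (constant_axis).

    The identification of Z compares Fourier coefficients.  Those of U and Z on
    the line of height y solve a first order system in y whose bounded solutions
    are determined by their value at y = 0 (ode_unique); for every frequency
    they are rescalings of one profile, and the profiles for s and 1 - s are
    conjugate (profile_conjugate).  The uniqueness of Fourier coefficients and
    the injectivity behind constant_axis are two cases of one moment argument
    (moment_le0).  All properties of U are read off the Poisson integral: the
    convolutions of u with (z^2 + y^2)^(-b) and z (z^2 + y^2)^(-b) are closed
    under differentiation in x and y. *)

(** * Calculus on the line *)

Ltac nneg := repeat first
  [ by [] | by apply: ltW | apply: sqr_ge0 | apply: powR_ge0 | apply: normr_ge0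
  | apply: addr_ge0 | apply: mulr_ge0 | rewrite invr_ge0 ].

Section calculus.
Variable R : realType.
Implicit Types (f g df : R -> R) (x y a b c : R).

Lemma der_add f g x a b : is_derive x 1 f a -> is_derive x 1 g b ->
  is_derive x 1 (fun t => f t + g t) (a + b).
Proof. by move=> ? ?; exact: is_deriveD. Qed.

Lemma der_opp f x a : is_derive x 1 f a -> is_derive x 1 (fun t => - f t) (- a).
Proof. by move=> ?; exact: is_deriveN. Qed.

Lemma der_sub f g x a b : is_derive x 1 f a -> is_derive x 1 g b ->
  is_derive x 1 (fun t => f t - g t) (a - b).
Proof. by move=> ? ?; exact: is_deriveB. Qed.

Lemma der_mul f g x a b : is_derive x 1 f a -> is_derive x 1 g b ->
  is_derive x 1 (fun t => f t * g t) (a * g x + f x * b).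
Proof.
move=> df dg; have := @is_deriveM _ _ f g x 1 a b df dg.
by move=> h; apply: is_derive_eq; rewrite /GRing.scale/= addrC mulrC.
Qed.

Lemma der_cst c x : is_derive x 1 (fun _ : R => c) 0.
Proof. exact: is_derive_cst. Qed.

Lemma der_id x : is_derive x 1 (fun t : R => t) 1.
Proof. exact: is_derive_id. Qed.

Lemma der_scal c f x a : is_derive x 1 f a ->
  is_derive x 1 (fun t => c * f t) (c * a).
Proof.
by move=> df; apply: is_derive_eq (der_mul (der_cst c x) df) _; rewrite mul0r add0r.
Qed.

Lemma der_comp f g x a b : is_derive x 1 f a -> is_derive (f x) 1 g b ->
  is_derive x 1 (fun t => g (f t)) (b * a).
Proof.
move=> df dg; have h := @is_derive1_comp _ g f x _ _ dg df.
by apply: is_derive_eq h _; rewrite mulrC.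
Qed.

Lemma der_powR p x : 0 < x -> is_derive x 1 (fun t => t `^ p) (p * x `^ (p - 1)).
Proof. by move=> x0; exact: is_derive1_powR. Qed.

Lemma der_eq f x a b : is_derive x 1 f a -> a = b -> is_derive x 1 f b.
Proof. by move=> df <-. Qed.

Lemma der_cont f x a : is_derive x 1 f a -> {for x, continuous f}.
Proof. by move=> df; apply: differentiable_continuous; exact/derivable1_diffP. Qed.

Lemma der_val f x a : is_derive x 1 f a -> derive1 f x = a.
Proof. by move=> df; rewrite derive1E derive_val. Qed.

Lemma near_der f g x a : {near x, f =1 g} -> is_derive x 1 f a ->
  is_derive x 1 g a.
Proof. by move=> fg df; exact: near_eq_is_derive fg df. Qed.

Lemma MVT_le f df x y : x <= y -> (forall z, x <= z <= y -> is_derive z 1 f (df z)) ->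
  exists2 c, x <= c <= y & f y - f x = df c * (y - x).
Proof.
move=> xy h.
have [] := @MVT_segment R f df x y xy.
- by move=> z; rewrite in_itv/= => /andP[/ltW ? /ltW ?]; apply: h; apply/andP.
- apply: derivable_within_continuous => z; rewrite in_itv/= => hz.
  by have := h _ hz => ?; exact: ex_derive.
- by move=> c; rewrite in_itv/=; exists c.
Qed.

Lemma derive_ge0_le f df c : (forall y, c < y -> is_derive y 1 f (df y)) ->
  (forall y, c < y -> 0 <= df y) -> forall x y, c < x -> x <= y -> f x <= f y.
Proof.
move=> h h0 x y cx xy; rewrite -subr_ge0.
have [z /andP[xz _]|z /andP[xz _] ->] := @MVT_le f df x y xy.
  by apply: h; exact: lt_le_trans xz.
by rewrite mulr_ge0 ?subr_ge0// h0//; exact: lt_le_trans xz.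
Qed.

Lemma derive_le0_ge f df c : (forall y, c < y -> is_derive y 1 f (df y)) ->
  (forall y, c < y -> df y <= 0) -> forall x y, c < x -> x <= y -> f y <= f x.
Proof.
move=> h h0 x y cx xy; rewrite -lerN2.
apply: (@derive_ge0_le (fun t => - f t) (fun t => - df t) c) => // z cz.
  by apply: der_opp; exact: h.
by rewrite oppr_ge0 h0.
Qed.

Lemma derive_bound_lip f df x y K : x <= y ->
  (forall z, x <= z <= y -> is_derive z 1 f (df z)) ->
  (forall z, x <= z <= y -> `|df z| <= K) -> `|f y - f x| <= K * (y - x).
Proof.
move=> xy h hK; have [z xzy ->] := MVT_le xy h.
by rewrite normrM (@ger0_norm _ (y - x)) ?subr_ge0// ler_wpM2r ?subr_ge0// hK.
Qed.

(** If the derivative at a maximum were increasing, it would be positive just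
    to the right of it. *)
Lemma max_second_derivative f df x d e : 0 < e ->
  (forall y, `|y - x| < e -> is_derive y 1 f (df y)) ->
  is_derive x 1 df d ->
  (forall y, `|y - x| < e -> f y <= f x) -> df x = 0 /\ d <= 0.
Proof.
move=> e0 h hd hm.
have exi y : y \in `]x - e, x + e[%R -> `|y - x| < e.
  by rewrite in_itv/= ltr_distl.
have xi : x \in `]x - e, x + e[%R by rewrite in_itv/=; apply/andP; split; lra.
have d0 : df x = 0.
  have h1 : is_derive x 1 f (df x) by apply: h; rewrite subrr normr0.
  have h2 : is_derive x 1 f 0.
    apply: (@derive1_at_max _ f (x - e) (x + e)) => //; first by lra.
      by move=> t /exi /h ?; exact: ex_derive.
    by move=> t /exi; exact: hm.
  by rewrite -(der_val h1) (der_val h2).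
split=> //; rewrite leNgt; apply/negP => dp.
have hq : (h^-1 *: (df (h + x) - df x)) @[h --> 0^'] --> d.
  have := @ex_derive _ _ _ _ _ _ _ hd; rewrite /derivable.
  have <- : 'D_1 df x = d by exact: derive_val.
  rewrite /derive => hh; have := hh.
  under eq_fun do rewrite [_%:A]mulr1.
  move=> h3; rewrite [X in lim X](_ : _ = h^-1 *: (df (h + x) - df x) @[h --> 0^']).
    exact: h3.
  by congr (fmap _ _); apply/funext => t /=; rewrite [_%:A]mulr1.
have [r /= r0 hr] : \forall t \near 0^', 0 < t^-1 *: (df (t + x) - df x).
  exact: (cvgr_gt _ hq).
pose t := Num.min r e / 2.
have m0 : 0 < Num.min r e by rewrite lt_min r0.
have t0 : 0 < t by rewrite divr_gt0.
have tr : t < r by rewrite /t; have : Num.min r e <= r; [by rewrite ge_min lexx | lra].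
have te : t < e.
  by rewrite /t; have : Num.min r e <= e; [by rewrite ge_min lexx orbT | lra].
clearbody t.
have [| | |z + hz] := @MVT R f df x (x + t); first by rewrite ltrDl.
- move=> z; rewrite in_itv/= => /andP[xz zt]; apply: h.
  by rewrite ger0_norm; lra.
- apply: derivable_within_continuous => z; rewrite in_itv/= => /andP[xz zt].
  have h1 : is_derive z 1 f (df z) by apply: h; rewrite ger0_norm; lra.
  exact: ex_derive.
rewrite in_itv/= => /andP[xz zt].
have : 0 < (z - x)^-1 *: (df (z - x + x) - df x).
  apply: hr; last by rewrite subr_eq0 gt_eqF.
  by rewrite /ball_/= sub0r normrN ger0_norm; lra.
rewrite subrK d0 subr0 pmulr_rgt0 ?invr_gt0 ?subr_gt0// => dz.
have : f (x + t) <= f x by apply: hm; rewrite ger0_norm; lra.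
by rewrite -subr_le0 hz leNgt mulr_gt0//; lra.
Qed.

End calculus.

(** * The system of a Fourier coefficient *)

Section ode.
Variable R : realType.
Implicit Types (P Q : R -> R) (a w M x y z t : R).

(** The energy P Q is nondecreasing, and y^a times half the derivative of P^2
    is P Q.  If the energy were positive somewhere, P^2 would grow at least like
    y^(1-a); so it is nonpositive, P^2 is nonincreasing, and it starts at 0. *)
Lemma ode_unique a w P Q M : -1 < a < 1 ->
  (forall y : R, 0 < y -> is_derive y 1 P (y `^ (- a) * Q y)) ->
  (forall y : R, 0 < y -> is_derive y 1 Q (w ^+ 2 * (y `^ a * P y))) ->
  (forall y : R, 1 <= y -> `|P y| <= M) ->
  P y @[y --> 0^'+] --> (0 : R) ->
  forall y, 0 < y -> P y = 0 /\ Q y = 0.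
Proof.
move=> /andP[a1 a2] dP dQ bP P0.
have dE (y : R) : 0 < y -> is_derive y 1 (fun t => P t * Q t)
    (y `^ (- a) * Q y ^+ 2 + w ^+ 2 * (y `^ a * P y ^+ 2)).
  by move=> y0; apply: der_eq (der_mul (dP _ y0) (dQ _ y0)) _; ring.
have dP2 (y : R) : 0 < y -> is_derive y 1 (fun t => P t * P t)
    (2 * (y `^ (- a) * (P y * Q y))).
  by move=> y0; apply: der_eq (der_mul (dP _ y0) (dP _ y0)) _; ring.
have Ele0 (y0 : R) : 0 < y0 -> P y0 * Q y0 <= 0.
  move=> y00; rewrite leNgt; apply/negP => E0.
  set e := P y0 * Q y0 in E0.
  have Ege (y : R) : y0 <= y -> e <= P y * Q y.
    move=> y0y; apply: (derive_ge0_le dE) => // z z0.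
    by nneg.
  clearbody e.
  pose c := 2 * e / (1 - a).
  have c0 : 0 < c by rewrite /c divr_gt0 ?subr_gt0// mulr_gt0.
  have dF (y : R) : y0 < y -> is_derive y 1 (fun t => P t * P t - c * t `^ (1 - a))
      (2 * (y `^ (- a) * (P y * Q y - e))).
    move=> y0y; have yp : 0 < y by exact: lt_trans y0y.
    apply: der_eq (der_sub (dP2 _ yp) (der_scal c (der_powR (1 - a) yp))) _.
    have -> : 1 - a - 1 = - a by ring.
    by rewrite /c; field; rewrite subr_eq0 gt_eqF.
  pose x := y0 + 1.
  have x1 : 1 <= x by rewrite /x; lra.
  have x0 : 0 < x by rewrite /x; lra.
  pose b := x `^ (1 - a) + (M ^+ 2 + 1) / c.
  have b0 : 0 <= b by rewrite addr_ge0 ?powR_ge0// divr_ge0 ?ltW//; have := sqr_ge0 M; lra.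
  have na : 1 - a != 0 by rewrite subr_eq0 gt_eqF.
  (* at this height the lower bound for P^2 exceeds M^2 *)
  pose y := b `^ (1 - a)^-1.
  have yb : y `^ (1 - a) = b by rewrite /y -powRrM mulVf// powRr1.
  have xy : x <= y.
    have -> : x = (x `^ (1 - a)) `^ (1 - a)^-1 by rewrite -powRrM mulfV// powRr1 ?ltW.
    apply: ge0_ler_powR; rewrite ?nnegrE ?powR_ge0//; first by rewrite invr_ge0 subr_ge0 ltW.
    by rewrite /b lerDl divr_ge0 ?ltW//; have := sqr_ge0 M; lra.
  have : P x * P x - c * x `^ (1 - a) <= P y * P y - c * y `^ (1 - a).
    apply: (derive_ge0_le dF) => //; last by rewrite /x; lra.
    by move=> z z0; rewrite mulr_ge0// mulr_ge0 ?powR_ge0// subr_ge0 Ege ?ltW.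
  have PM : P y * P y <= M ^+ 2.
    have := bP _ (le_trans x1 xy); rewrite -expr2 -real_normK ?num_real//.
    by move=> h; rewrite lerXn2r// nnegrE// (le_trans _ h).
  have cb : c * y `^ (1 - a) = c * x `^ (1 - a) + (M ^+ 2 + 1).
    by rewrite yb /b mulrDr mulrCA mulfV ?mulr1// gt_eqF.
  by have := sqr_ge0 (P x); rewrite expr2 cb; lra.
have Pz (y : R) : 0 < y -> P y = 0.
  move=> y0; have : P y * P y <= 0.
    have PP0 : (P t * P t) @[t --> 0^'+] --> (0 : R).
      by rewrite -[X in _ --> X](mulr0 0); exact: cvgM.
    apply: (cvgr_to_ge PP0).
    near=> t.
    apply: (derive_le0_ge dP2).
    - by move=> z z0; rewrite mulr_ge0_le0// mulr_ge0_le0 ?powR_ge0// Ele0.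
    - by near: t; exact: nbhs_right_gt.
    - by near: t; exact: nbhs_right_le.
  move=> h; apply/eqP; rewrite -[_ == _]orbb -mulf_eq0 eq_le h.
  by have := sqr_ge0 (P y); rewrite expr2.
move=> y y0; split; first exact: Pz.
have h0 : is_derive y 1 P 0.
  apply: near_der (der_cst 0 y); near=> t; apply/esym/Pz.
  by near: t; exact: lt_nbhsr.
have /eqP := der_val (dP _ y0); rewrite (der_val h0) eq_sym mulf_eq0 gt_eqF ?powR_gt0//=.
by move/eqP.
Unshelve. all: by end_near. Qed.

End ode.

(** * Integrals over the line *)

Notation integ D f := (lebesgue_measure.-integrable D (EFin \o f)).

Section integrals.
Variable R : realType.
Local Notation mu := (@lebesgue_measure R).
Implicit Types (f g h F G : R -> R) (D E : set R) (a b c x y z t p K L : R).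

Lemma integ_le D f g : measurable D -> measurable_fun D f ->
  (forall x, D x -> `|f x| <= g x) -> integ D g -> integ D f.
Proof.
move=> mD mf fg ig; apply: (@le_integrable _ _ _ mu D mD (EFin \o f) (EFin \o g)) => //; first exact/measurable_EFinP.
by move=> x Dx; rewrite /= lee_fin (le_trans (fg _ Dx))// ler_norm.
Qed.

Lemma integD D f g : measurable D -> integ D f -> integ D g ->
  integ D (fun x => f x + g x).
Proof.
move=> mD h1 h2; have := @integrableD _ _ _ mu D mD _ _ h1 h2.
by apply: eq_integrable.
Qed.

Lemma integB D f g : measurable D -> integ D f -> integ D g ->
  integ D (fun x => f x - g x).
Proof.
move=> mD h1 h2; have := @integrableB _ _ _ mu D mD _ _ h1 h2.
by apply: eq_integrable.
Qed.

Lemma integZ D c f : measurable D -> integ D f -> integ D (fun x => c * f x).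
Proof.
move=> mD h1; have := @integrableZl _ _ _ mu D mD c _ h1.
by apply: eq_integrable.
Qed.

Lemma integW D E f : measurable D -> measurable E -> E `<=` D ->
  integ D f -> integ E f.
Proof. by move=> mD mE ED; exact: integrableS. Qed.

Lemma integ_cont a b f : continuous f -> integ `[a, b] f.
Proof.
move=> cf; apply: continuous_compact_integrable; first exact: segment_compact.
exact: continuous_subspaceT.
Qed.

Lemma normInt D f g : measurable D -> measurable_fun D f -> integ D g ->
  (forall x, D x -> `|f x| <= g x) ->
  `|\int[mu]_(x in D) f x| <= \int[mu]_(x in D) g x.
Proof.
move=> mD mf ig fg; have i_f : integ D f by exact: integ_le fg ig.
apply: (le_trans (@le_normr_Rintegral _ _ _ mu D f mD i_f)); apply: (@le_Rintegral _ _ _ mu) => //.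
exact: integrable_norm.
Qed.

Lemma Eint_push (phi : R -> R) (k : R -> \bar R) : measurable_fun setT phi ->
  (forall A, measurable A -> mu (phi @^-1` A) = mu A) ->
  measurable_fun setT k -> (forall x, (0 <= k x)%E) ->
  (\int[mu]_x k (phi x) = \int[mu]_x k x)%E.
Proof.
move=> mphi pm mk k0.
have := @ge0_integral_pushforward _ _ (measurableTypeR R) (measurableTypeR R) R
  phi mphi mu setT k measurableT mk (fun y _ => k0 y).
rewrite preimage_setT => <-.
by apply: eq_measure_integral => A mA _; exact: pm.
Qed.

Lemma Rint_push (phi : R -> R) f : measurable_fun setT phi ->
  (forall A, measurable A -> mu (phi @^-1` A) = mu A) -> measurable_fun setT f ->
  \int[mu]_x f (phi x) = \int[mu]_x f x.
Proof.
move=> mphi pm mf; rewrite /Rintegral; congr fine.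
rewrite [LHS]integralE [RHS]integralE; congr (_ - _)%E.
- rewrite (_ : (fun x => _)^\+%E = (fun x => ((EFin \o f)^\+)%E (phi x))).
    apply: Eint_push => //.
    by apply: measurable_funepos; exact/measurable_EFinP.
  by apply/funext => x; rewrite !funeposE.
- rewrite (_ : (fun x => _)^\-%E = (fun x => ((EFin \o f)^\-)%E (phi x))).
    apply: Eint_push => //.
    by apply: measurable_funeneg; exact/measurable_EFinP.
  by apply/funext => x; rewrite !funenegE.
Qed.

Lemma lebesgue_reflect c (A : set R) : measurable A ->
  mu ((fun x => c - x) @^-1` A) = mu A.
Proof.
have mc : measurable_fun setT (fun x : measurableTypeR R => c - x : measurableTypeR R).
  apply: continuous_measurable_fun => x; apply: cvgB; [exact: cvg_cst|exact: cvg_id].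
move=> mA; apply/esym.
apply: (@lebesgue_measure_unique R (pushforward mu (fun x : measurableTypeR R => c - x : measurableTypeR R))) => //= _ [[a b]] _ <-.
rewrite /pushforward (_ : _ @^-1` _ = `[(c - b), (c - a)[%classic); last first.
  by apply/seteqP; split => x /=; rewrite !in_itv/= => /andP[? ?]; apply/andP; split; lra.
rewrite !lebesgue_measure_itv/= !lte_fin ltrD2l ltrN2.
by case: ifP => // _; rewrite -!EFinB; congr EFin; ring.
Qed.

Lemma Rint_reflect c f : measurable_fun setT f ->
  \int[mu]_x f (c - x) = \int[mu]_x f x.
Proof.
move=> mf; apply: (@Rint_push (fun x => c - x)) => //.
  by apply: continuous_measurable_fun => x; apply: cvgB; [exact: cvg_cst|exact: cvg_id].
exact: lebesgue_reflect.
Qed.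

Lemma integ_reflect c f : measurable_fun setT f -> integ setT f ->
  integ setT (fun x => f (c - x)).
Proof.
have mc : measurable_fun setT (fun x : R => c - x).
  by apply: continuous_measurable_fun => x; apply: cvgB; [exact: cvg_cst|exact: cvg_id].
move=> mf /integrableP[_ foo]; apply/integrableP; split.
  by apply/measurable_EFinP; apply: measurableT_comp mf mc.
rewrite (@Eint_push (fun x => c - x) (fun x => `|(f x)%:E|)%E) //.
  exact: lebesgue_reflect.
by apply: measurableT_comp => //; exact/measurable_EFinP.
Qed.

End integrals.

(** * Improper integrals *)

Section improper.
Variable R : realType.
Local Notation mu := (@lebesgue_measure R).
Implicit Types (f g h F G : R -> R) (D E : set R) (a b c x y z t p K L : R).

Lemma measurable_pos D f c : measurable D -> D `<=` `]c, +oo[ ->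
  (forall x, c < x -> {for x, continuous f}) -> measurable_fun D f.
Proof.
move=> mD D0 cf; apply: (@measurable_funS _ _ _ _ (`]c, +oo[ : set R)) => //.
apply: open_continuous_measurable_fun; first exact: interval_open.
by move=> x; rewrite inE/= in_itv/= andbT => /cf.
Qed.

Lemma ge0_FTC_y f F c y L : c < y ->
  (forall x, c < x -> {for x, continuous f}) ->
  (forall x, c < x -> is_derive x 1 F (f x)) ->
  (forall x, y <= x -> 0 <= f x) ->
  F x @[x --> +oo] --> L ->
  integ `[y, +oo[ f /\ \int[mu]_(x in `[y, +oo[) f x = L - F y.
Proof.
move=> y0 cf dF f0 FL.
have h : (\int[mu]_(x in `[y, +oo[) (f x)%:E = L%:E - (F y)%:E)%E.
  apply: (@ge0_continuous_FTC2y _ f F) => //.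
  - apply/continuous_within_itvcyP; split.
      by move=> x; rewrite in_itv/= andbT => yx; apply: cf; exact: lt_trans yx.
    by apply: cvg_at_right_filter; apply: cf.
  - by move=> x yx; have := dF x (lt_trans y0 yx) => ?; exact: ex_derive.
  - by apply: cvg_at_right_filter; exact: (der_cont (dF _ y0)).
  - move=> x; rewrite in_itv/= andbT => yx.
    by apply: der_val; apply: dF; exact: lt_trans yx.
have mf : measurable_fun `[y, +oo[ f.
  apply: (@measurable_pos _ _ c) => // x /=; rewrite !in_itv/= !andbT; exact: lt_le_trans.
split; last by rewrite /Rintegral h.
apply/integrableP; split; first exact/measurable_EFinP.
rewrite (_ : (\int[mu]_(x in _) _ = \int[mu]_(x in `[y, +oo[) (f x)%:E)%E).
  by rewrite h -EFinB ltry.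
apply: eq_integral => x; rewrite inE/= in_itv/= andbT => yx.
by rewrite /= ger0_norm// f0.
Qed.

(** The fundamental theorem for an integrand of either sign: f + g and g are nonnegative. *)
Lemma FTC_y_dom f F g G c y L K : c < y ->
  (forall x, c < x -> {for x, continuous f}) ->
  (forall x, c < x -> is_derive x 1 F (f x)) ->
  (forall x, c < x -> {for x, continuous g}) ->
  (forall x, c < x -> is_derive x 1 G (g x)) ->
  (forall x, y <= x -> `|f x| <= g x) ->
  F x @[x --> +oo] --> L -> G x @[x --> +oo] --> K ->
  integ `[y, +oo[ f /\ \int[mu]_(x in `[y, +oo[) f x = L - F y.
Proof.
move=> y0 cf dF cg dG fg FL GK.
have g0 x : y <= x -> 0 <= g x by move=> yx; apply: le_trans (fg _ yx).
have [ig Ig] := ge0_FTC_y y0 cg dG g0 GK.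
have [||||ih Ih] := @ge0_FTC_y (fun x => f x + g x) (fun x => F x + G x) c y (L + K) y0.
- by move=> x x0; apply: cvgD; [exact: cf|exact: cg].
- by move=> x x0; apply: der_add; [exact: dF|exact: dG].
- by move=> x /fg; rewrite ler_norml => /andP[+ _]; lra.
- exact: cvgD.
have i_f : integ `[y, +oo[ f.
  apply: integ_le ig => //.
  by apply: (@measurable_pos _ _ c) => // x /=; rewrite !in_itv/= !andbT; exact: lt_le_trans.
  by move=> x /=; rewrite in_itv/= andbT; exact: fg.
split=> //.
have e := @RintegralD _ _ _ mu `[y, +oo[ f g (measurable_itv _) i_f ig.
by rewrite Ih Ig in e; lra.
Qed.

Lemma derivable_LR F f a b : a < b ->
  (forall x, a <= x <= b -> is_derive x 1 F (f x)) ->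
  derivable_oo_LRcontinuous F a b /\ {in `]a, b[, derive1 F =1 f}.
Proof.
move=> ab dF; have aa : a <= a <= b by rewrite lexx ltW.
have bb : a <= b <= b by rewrite lexx ltW.
have cF x : a <= x <= b -> {for x, continuous F} by move=> /dF; exact: der_cont.
split; last first.
  move=> x; rewrite in_itv/= => /andP[ax xb].
  by apply: der_val; apply: dF; rewrite !ltW.
split.
- move=> x; rewrite in_itv/= => /andP[ax xb].
  have h : is_derive x 1 F (f x) by apply: dF; rewrite !ltW.
  exact: ex_derive.
- by apply: cvg_at_right_filter; exact: cF.
- by apply: cvg_at_left_filter; exact: cF.
Qed.

(** The integrand may be unbounded at 0, so ]0, b] is exhausted by the segments
    [b / (n + 2), b]. *)
Lemma ge0_FTC_0 f F b L : 0 < b ->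
  (forall x, 0 < x -> {for x, continuous f}) ->
  (forall x, 0 < x -> is_derive x 1 F (f x)) ->
  (forall x, 0 < x -> 0 <= f x) ->
  F x @[x --> 0^'+] --> L ->
  integ `]0, b] f /\ \int[mu]_(x in `]0, b]) f x = F b - L.
Proof.
move=> b0 cf dF f0 FL.
pose e n : R := b / n.+2%:R.
have e0 n : 0 < e n by rewrite divr_gt0.
have eb n : e n < b by rewrite ltr_pdivrMr// ltr_pMr// ltr1n.
have ecvg : e n @[n --> \oo] --> (0 : R).
  rewrite -(mulr0 b); apply: cvgMr.
  have := @cvg_harmonic R; rewrite -(cvg_shiftS (@harmonic R)); exact.
pose D n : set R := `[e n, b]%classic.
have U : \bigcup_n D n = `]0, b]%classic.
  apply/seteqP; split=> [x [n _]|x] /=; rewrite /D/= !in_itv/=.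
    by move=> /andP[ex ->]; rewrite (lt_le_trans (e0 n)).
  move=> /andP[x0 xb]; have : \forall n \near \oo, e n < x.
    exact: (cvgr_lt _ ecvg).
  by move=> [n _ /(_ n (leqnn _)) enx]; exists n => //=; rewrite in_itv/= xb ltW.
have mfU : measurable_fun `]0, b] f.
  by apply: (@measurable_pos _ _ 0) => // x /=; rewrite !in_itv/= andbT => /andP[].
have In n : (\int[mu]_(x in D n) (f x)%:E = (F b - F (e n))%:E)%E.
  rewrite EFinB; apply: continuous_FTC2 => //.
  - apply: continuous_in_subspaceT => x; rewrite inE/= in_itv/= => /andP[ex _].
    by apply: cf; exact: lt_le_trans ex.
  - apply: (derivable_LR (eb n) _).1 => x /andP[ex _].
    by apply: dF; exact: lt_le_trans ex.
  - apply: (derivable_LR (eb n) _).2 => x /andP[ex _].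
    by apply: dF; exact: lt_le_trans ex.
(* the integrals over D n have two limits, hence equal ones *)
have lim1 : (\int[mu]_(x in D n) (f x)%:E)%E @[n --> \oo] -->
    (\int[mu]_(x in `]0%R, b]) (f x)%:E)%E.
  rewrite -U; apply: ge0_nondecreasing_set_cvg_integral.
  - apply/nondecreasing_seqP => n; apply/subsetPset => x; rewrite /D/= !in_itv/=.
    move=> /andP[h ->]; rewrite andbT (le_trans _ h)//.
    by rewrite /e ler_pM2l// lef_pV2 ?posrE// ler_nat.
  - by move=> n; exact: measurable_itv.
  - move=> n; apply/measurable_EFinP; apply: measurable_funS mfU => //.
    by rewrite -U; exact: bigcup_sup.
  - move=> n x; rewrite /D/= in_itv/= => /andP[ex _]; rewrite lee_fin f0//.
    exact: lt_le_trans ex.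
have lim2 : (\int[mu]_(x in D n) (f x)%:E)%E @[n --> \oo] --> (F b - L)%:E.
  under eq_fun do rewrite In.
  apply: cvg_EFin; first exact: nearW.
  apply: cvgB; first exact: cvg_cst.
  move/cvg_at_rightP : FL; apply; split=> // n; exact: e0.
have h : (\int[mu]_(x in `]0%R, b]) (f x)%:E = (F b - L)%:E)%E.
  by apply: cvg_unique lim1 lim2; exact: ereal_hausdorff.
split; last by rewrite /Rintegral h.
apply/integrableP; split; first exact/measurable_EFinP.
rewrite (_ : (\int[mu]_(x in _) _ = \int[mu]_(x in `]0%R, b]) (f x)%:E)%E).
  by rewrite h ltry.
apply: eq_integral => x; rewrite inE/= in_itv/= => /andP[x0 _].
by rewrite /= ger0_norm// f0.
Qed.

End improper.

(** * Integrals of powers, and vanishing integrals *)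

Section powers.
Variable R : realType.
Local Notation mu := (@lebesgue_measure R).
Implicit Types (f g h F G : R -> R) (D E : set R) (a b c x y z p q K L : R).

Lemma powR_cont p x : 0 < x -> {for x, continuous (fun t : R => t `^ p)}.
Proof. by move=> x0; exact: (der_cont (der_powR p x0)). Qed.

Lemma powR_cvgy q : 0 < q -> x `^ (- q) @[x --> +oo] --> (0 : R).
Proof.
move=> q0; apply/cvgrPdist_le => /= e e0.
pose b := e `^ (- q^-1).
near=> x; have x0 : 0 < x by [].
have bx : b <= x by near: x; apply: nbhs_pinfty_ge; exact: num_real.
rewrite sub0r normrN ger0_norm ?powR_ge0// powRN.
have -> : e = (b `^ q)^-1.
  by rewrite /b -powRrM mulNr mulVf ?gt_eqF// powR_inv1 ?ltW// invrK.
rewrite lef_pV2 ?posrE ?powR_gt0//.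
by apply: ge0_ler_powR; rewrite ?nnegrE ?powR_ge0// ltW.
Unshelve. all: by end_near. Qed.

Lemma der_powR_prim p x : p + 1 != 0 -> 0 < x ->
  is_derive x 1 (fun t => (p + 1)^-1 * t `^ (p + 1)) (x `^ p).
Proof.
move=> p1 x0; apply: der_eq (der_scal (p + 1)^-1 (der_powR (p + 1) x0)) _.
by rewrite mulrA mulVf// mul1r addrK.
Qed.

Lemma int_pow_y p y : 0 < y -> p < -1 ->
  integ `[y, +oo[ (fun t => t `^ p) /\
  \int[mu]_(t in `[y, +oo[) (t `^ p) = - (p + 1)^-1 * y `^ (p + 1).
Proof.
move=> y0 p1; have p0 : p + 1 != 0 by rewrite lt_eqF//; lra.
have [||||ip ->] := @ge0_FTC_y R (fun t => t `^ p)
  (fun t => (p + 1)^-1 * t `^ (p + 1)) 0 y ((p + 1)^-1 * 0) y0.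
- by move=> x; exact: powR_cont.
- by move=> x x0; exact: der_powR_prim.
- by move=> x _; exact: powR_ge0.
- by apply: cvgMr; have := @powR_cvgy (- (p + 1)); rewrite opprK; apply; lra.
- by split=> //; rewrite mulr0 sub0r mulNr.
Qed.

Lemma int_pow_0 p b : 0 < b -> -1 < p ->
  integ `]0, b] (fun t => t `^ p) /\
  \int[mu]_(t in `]0, b]) (t `^ p) = (p + 1)^-1 * b `^ (p + 1).
Proof.
move=> b0 p1; have p0 : p + 1 != 0 by rewrite gt_eqF//; lra.
have [||||ip ->] := @ge0_FTC_0 R (fun t => t `^ p)
  (fun t => (p + 1)^-1 * t `^ (p + 1)) b ((p + 1)^-1 * 0) b0.
- by move=> x; exact: powR_cont.
- by move=> x x0; exact: der_powR_prim.
- by move=> x _; exact: powR_ge0.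
- apply: cvgMr; have p10 : 0 < p + 1 by lra.
  exact: (powR_cvg0 p10).
- by split=> //; rewrite mulr0 subr0.
Qed.

(** Otherwise f stays above f x / 2 on an interval around x. *)
Lemma Int_eq0 D f x : measurable D -> nbhs x D -> integ D f ->
  (forall y, D y -> 0 <= f y) -> {for x, continuous f} ->
  \int[mu]_(y in D) f y = 0 -> f x = 0.
Proof.
move=> mD nD i_f f0 cf I0; apply/eqP/negPn/negP => fx0.
have Dx : D x by exact: nbhs_singleton.
have fx : 0 < f x by rewrite lt_neqAle eq_sym fx0 f0.
have hlt : f x / 2 < f x by lra.
have h1 : \forall y \near x, f x / 2 < f y by exact: (cvgr_gt _ cf _ hlt).
have [d /= d0 hd] : \forall y \near x, D y /\ f x / 2 < f y by near=> y; split; near: y.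
pose E : set R := `](x - d), (x + d)[%classic.
have ED y : E y -> D y /\ f x / 2 < f y.
  by rewrite /E/= in_itv/= => h; apply: hd; rewrite /ball_/= distrC ltr_distl.
have EsD : E `<=` D by move=> y /ED[].
have mE : measurable E by exact: measurable_itv.
have mf : measurable_fun D (fun y => (f y)%:E).
  by case/integrableP : i_f.
have h2 : ((f x / 2 * (2 * d))%:E <= \int[mu]_(y in D) (f y)%:E)%E.
  apply: (@le_trans _ _ (\int[mu]_(y in E) (f y)%:E)%E); last first.
    by apply: ge0_subset_integral => // y /f0; rewrite lee_fin.
  apply: (@le_trans _ _ (\int[mu]_(y in E) (f x / 2)%:E)%E).
    rewrite integral_cst//.
    have muE : mu E = (2 * d)%:E.
      have := @lebesgue_measure_itv R `](x - d), (x + d)[; rewrite /= lte_fin ifT; last by lra.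
      by rewrite -EFinB => h; apply: etrans h _; congr EFin; ring.
    by rewrite -[leRHS]/((f x / 2)%:E * mu E)%E muE -EFinM.
  apply: ge0_le_integral => //.
  - by move=> y _; rewrite lee_fin; lra.
  - by apply: measurable_funS mf.
  - by move=> y /ED[_ /ltW]; rewrite lee_fin.
have : (\int[mu]_(y in D) (f y)%:E = 0)%E.
  have := @integrable_fin_num _ _ _ mu D mD _ i_f; move/fineK => /= <-.
  by move: I0; rewrite /Rintegral => ->.
move=> e; move: h2; rewrite e lee_fin leNgt => /negP; apply.
by rewrite !mulr_gt0 ?invr_gt0.
Unshelve. all: by end_near. Qed.

End powers.

(** * Concentration of moments *)

Section moments.
Variable R : realType.
Local Notation mu := (@lebesgue_measure R).
Implicit Types (f g h w t : R -> R) (D E : set R) (a b c x y z p q K L : R).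

Lemma integ_mul_bounded D f g : measurable D -> measurable_fun D f ->
  measurable_fun D g -> integ D f -> (forall x, D x -> `|g x| <= 1) ->
  integ D (fun x => f x * g x).
Proof.
move=> mD mf mg i_f g1; apply: (@integ_le _ D _ (fun x => `|f x|)) => //.
- exact: measurable_funM.
- by move=> x Dx; rewrite normrM ler_piMr// g1.
- exact: (@integrable_norm _ _ _ mu).
Qed.

(** If h were positive at x0, the weights p^n with p = 1 - (t - t(x0))^2 / 4 in
    [0, 1], which are polynomials in t, would concentrate the integral of h w
    where t is close to t(x0), and there h is positive. *)
Lemma moment_le0 D h w t x0 : measurable D -> nbhs x0 D ->
  measurable_fun D t -> measurable_fun D h -> measurable_fun D w ->
  (forall x, D x -> `|t x| <= 1) ->
  integ D w -> integ D (fun x => h x * w x) ->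
  (forall x, D x -> 0 <= w x) -> 0 < w x0 ->
  {for x0, continuous t} -> {for x0, continuous w} ->
  (0 < h x0 -> exists2 r, 0 < r &
     forall x, D x -> `|t x - t x0| < r -> h x0 / 2 <= h x) ->
  (forall n : nat, \int[mu]_(x in D) (h x * w x * t x ^+ n) = 0) ->
  h x0 <= 0.
Proof.
move=> mD nD mt mh mw t1 iw ig w0 wx0 ct cw sep mom.
have Dx0 : D x0 by exact: nbhs_singleton.
rewrite leNgt; apply/negP => hx0; have [r0 r00 hr0] := sep hx0.
pose r := Num.min r0 1.
have rp : 0 < r by rewrite lt_min r00/=.
have r1 : r <= 1 by rewrite ge_min lexx orbT.
have hr x : D x -> `|t x - t x0| < r -> h x0 / 2 <= h x.
  by move=> Dx h1; apply: hr0 => //; rewrite (lt_le_trans h1)// ge_min lexx.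
clearbody r.
pose g x := h x * w x.
have mg : measurable_fun D g by exact: measurable_funM.
pose p x := 1 - (t x - t x0) ^+ 2 / 4.
have mp : measurable_fun D p.
  apply: measurable_funB => //; apply: measurable_funM => //.
  by apply: measurable_funX; exact: measurable_funB.
have p01 x : D x -> 0 <= p x <= 1.
  move=> Dx; rewrite /p; have := t1 _ Dx; have := t1 _ Dx0.
  rewrite !ler_norml => /andP[? ?] /andP[? ?].
  have := sqr_ge0 (t x - t x0).
  have : (t x - t x0) ^+ 2 <= 4 by nra.
  by lra.
have mpn n : measurable_fun D (fun x => p x ^+ n) by exact: measurable_funX.
have mtn n : measurable_fun D (fun x => t x ^+ n) by exact: measurable_funX.
have itp m n : integ D (fun x => g x * (t x ^+ m * p x ^+ n)).
  apply: integ_mul_bounded => //; first exact: measurable_funM.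
  move=> x Dx; rewrite normrM !normrX mulr_ile1 ?exprn_ge0 ?exprn_ile1//.
    exact: t1.
  by have /andP[p0 p1] := p01 _ Dx; rewrite ger0_norm.
have mom2 n : forall m, \int[mu]_(x in D) (g x * (t x ^+ m * p x ^+ n)) = 0.
  elim: n => [|n IH] m.
    by under eq_Rintegral do rewrite expr0 mulr1; exact: mom.
  set t0 := t x0; pose c0 := 1 - t0 ^+ 2 / 4; pose c1 := t0 / 2.
  transitivity (\int[mu]_(x in D)
      (c0 * (g x * (t x ^+ m * p x ^+ n)) + c1 * (g x * (t x ^+ m.+1 * p x ^+ n))
       - 1 / 4 * (g x * (t x ^+ m.+2 * p x ^+ n)))).
    apply: eq_Rintegral => x _; rewrite [p x ^+ n.+1]exprS !exprS.
    move: (p x ^+ n) (t x ^+ m) (g x) => P T G.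
    by rewrite /p -/t0 /c0 /c1; field.
  rewrite (@RintegralB _ _ _ mu)//; last 2 first.
  - by apply: integD => //; apply: integZ.
  - exact: integZ.
  rewrite (@RintegralD _ _ _ mu)//; [|exact: integZ..].
  by rewrite !(@RintegralZl _ _ _ mu)// !IH !mulr0 subr0 addr0.
pose bump x := Num.max 0 (1 - `|t x - t x0| / (r / 2)).
have b0 x : 0 <= bump x by rewrite /bump le_max lexx.
have b1 x : bump x <= 1.
  by rewrite /bump ge_max ler01/= gerBl divr_ge0//; lra.
have mb : measurable_fun D bump.
  apply: measurable_maxr => //; apply: measurable_funB => //.
  apply: measurable_funM => //; apply: measurableT_comp => //.
  exact: measurable_funB.
have iwb : integ D (fun x => w x * bump x).
  by apply: integ_mul_bounded => // x _; rewrite ger0_norm.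
pose c := \int[mu]_(x in D) (w x * bump x).
have c0 : 0 < c.
  rewrite lt_neqAle; apply/andP; split; last first.
    by apply: Rintegral_ge0 => x Dx; rewrite mulr_ge0// w0.
  apply/eqP => /esym cE.
  have wb0 : w x0 * bump x0 = 0.
    apply: (@Int_eq0 _ D (fun x => w x * bump x)) => //.
      by move=> x Dx; rewrite mulr_ge0// w0.
    apply: cvgM => //.
    apply: (@continuous_max _ _ (cst 0) (fun x => 1 - `|t x - t x0| / (r / 2))).
      exact: cvg_cst.
    apply: cvgB; first exact: cvg_cst.
    apply: cvgM; last exact: cvg_cst.
    by apply: cvg_norm; apply: cvgB => //; exact: cvg_cst.
  move: wb0; rewrite /bump subrr normr0 mul0r subr0 max_r ?ler01// mulr1.
  by move=> wx; rewrite wx ltxx in wx0.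
(* p >= q on the support of the bump, and p / q <= s < 1 where t is at distance
   at least r from t x0 *)
pose q := 1 - r ^+ 2 / 16.
have r2 : r ^+ 2 <= 1 by rewrite expr_le1// ltW.
have r2p : 0 < r ^+ 2 by rewrite exprn_gt0.
have q0 : 0 < q by rewrite /q; lra.
pose s := (1 - r ^+ 2 / 4) / q.
have s0 : 0 <= s by rewrite divr_ge0 ?ltW//; lra.
have s1 : s < 1 by rewrite ltr_pdivrMr// mul1r /q; lra.
pose G := \int[mu]_(x in D) `|g x|.
have ing : integ D (fun x => `|g x|) by exact: (@integrable_norm _ _ _ mu).
have main n : h x0 / 2 * c <= s ^+ n * G.
  have : \int[mu]_(x in D) (h x0 / 2 * (w x * bump x) - s ^+ n * `|g x|) <=
         \int[mu]_(x in D) (q ^- n * (g x * (t x ^+ 0 * p x ^+ n))).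
    apply: (@le_Rintegral _ _ _ mu) => //.
    - by apply: integB => //; apply: integZ.
    - exact: integZ.
    move=> x Dx; rewrite expr0 mul1r.
    have /andP[p0 p1] := p01 _ Dx.
    have -> : q ^- n * (g x * p x ^+ n) = g x * (p x / q) ^+ n.
      by rewrite expr_div_n; ring.
    have sG : 0 <= s ^+ n * `|g x| by rewrite mulr_ge0// exprn_ge0.
    have pqn : 0 <= (p x / q) ^+ n by rewrite exprn_ge0// divr_ge0// ltW.
    have [tr|tr] := ltP `|t x - t x0| r.
      have hx := hr _ Dx tr.
      have wx := w0 _ Dx.
      have gx : h x0 / 2 * w x <= g x by rewrite /g ler_wpM2r.
      have gx0 : 0 <= g x by apply: le_trans gx; rewrite mulr_ge0//; lra.
      have [tr2|tr2] := ltP `|t x - t x0| (r / 2).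
        have pq : 1 <= (p x / q) ^+ n.
          rewrite exprn_ege1// ler_pdivlMr// mul1r /q /p.
          have : `|t x - t x0| ^+ 2 <= (r / 2) ^+ 2.
            by rewrite lerXn2r// ?nnegrE ?normr_ge0//; lra.
          by rewrite real_normK ?num_real//; lra.
        have : g x <= g x * (p x / q) ^+ n by rewrite ler_peMr.
        have : h x0 / 2 * (w x * bump x) <= h x0 / 2 * w x.
          by rewrite ler_wpM2l ?ler_piMr//; lra.
        lra.
      have -> : bump x = 0.
        by rewrite /bump; apply: max_l; rewrite subr_le0 ler_pdivlMr ?mul1r//; lra.
      have : 0 <= g x * (p x / q) ^+ n by exact: mulr_ge0.
      by rewrite mulr0 mulr0; lra.
    have -> : bump x = 0.
      rewrite /bump; apply: max_l; rewrite subr_le0 ler_pdivlMr ?mul1r//; lra.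
    rewrite !mulr0 sub0r.
    have ps : (p x / q) ^+ n <= s ^+ n.
      rewrite lerXn2r// ?nnegrE// ?divr_ge0// ?(ltW q0)//.
      rewrite /s ler_pM2r ?invr_gt0// /p.
      have : r ^+ 2 <= `|t x - t x0| ^+ 2 by rewrite lerXn2r// nnegrE// ltW.
      by rewrite real_normK ?num_real//; lra.
    rewrite lerNl.
    apply: le_trans (ler_norm _) _; rewrite normrN normrM mulrC.
    by rewrite ler_wpM2r// ger0_norm.
  rewrite (@RintegralZl _ _ _ mu)// mom2 mulr0.
  rewrite (@RintegralB _ _ _ mu)//; [|exact: integZ..].
  by rewrite !(@RintegralZl _ _ _ mu)// -/c -/G subr_le0.
have : h x0 / 2 * c <= 0 * G.
  have lim : (s ^+ n * G) @[n --> \oo] --> 0 * G.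
    by apply: cvgMl; apply: cvg_expr; rewrite ger0_norm.
  by apply: (cvgr_to_ge lim); apply: nearW => n; exact: main.
by rewrite mul0r leNgt mulr_gt0//; lra.
Qed.

End moments.

(** * Periodic functions and uniqueness of Fourier coefficients *)

Section periodic.
Variable R : realType.
Local Notation mu := (@lebesgue_measure R).
Implicit Types (f g h w t : R -> R) (D E : set R) (a b c x y z p q K L T : R).

(** The point y does not depend on h, so that several periodic functions can be
    reduced to one period together. *)
Lemma periodic_reduce T x : 0 < T -> exists2 y, 0 <= y < T &
  forall h, (forall z, h (z + T) = h z) -> h x = h y.
Proof.
move=> T0; pose n := Num.floor (x / T).
have hn (h : R -> R) : (forall z, h (z + T) = h z) ->
    forall (k : nat) z, h (z + T *+ k) = h z.
  by move=> hT k z; exact: (@periodicn _ _ h T hT).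
have hz (h : R -> R) : (forall z, h (z + T) = h z) ->
    forall (k : int) z, h (z + T *~ k) = h z.
  move=> hT [k|k] z; first exact: hn.
  by rewrite -[LHS](hn _ hT k.+1) NegzE mulrNz -pmulrn subrK.
exists (x - T *~ n).
  have /andP[h1 h2] : n%:~R <= x / T < (n + 1)%:~R by exact: floor_itv.
  rewrite ler_pdivlMr// in h1; rewrite ltr_pdivrMr// in h2.
  rewrite subr_ge0 -mulrzl h1/= ltrBlDr.
  by move: h2; rewrite intrD mulrDl mul1r addrC.
by move=> h hT; rewrite -mulrNz hz.
Qed.

Lemma periodic_bounded T h : 0 < T -> continuous h ->
  (forall z, h (z + T) = h z) -> exists2 M, 0 < M & forall x, `|h x| <= M.
Proof.
move=> T0 ch hT.
have [|c _ hc] := @EVT_max R (fun x => `|h x|) 0 T (ltW T0).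
  by apply: continuous_subspaceT => x; apply: cvg_norm; exact: ch.
exists (`|h c| + 1) => [|x]; first by rewrite ltr_wpDl.
have [y /andP[y0 yT] /(_ h hT) ->] := periodic_reduce x T0.
by rewrite (le_trans (hc y _)) ?lerDl// in_itv/= y0 ltW.
Qed.

Lemma continuous_exp f n x : {for x, continuous f} ->
  {for x, continuous (fun y => f y ^+ n)}.
Proof.
by move=> cf; apply: (@continuous_comp _ _ _ f (fun z => z ^+ n)) => //; exact: exprn_continuous.
Qed.

Lemma continuous_cosM c : continuous (fun x : R => cos (c * x)).
Proof.
move=> x; apply: (@continuous_comp _ _ _ (fun x => c * x) cos).
  by apply: cvgMr; exact: cvg_id.
exact: continuous_cos.
Qed.

(** On a period the cosine takes each value only at two points, symmetric about
    the middle of the period. *)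
Lemma cos_half c b x : 0 < c -> 0 <= x <= 2 * c -> 0 <= b <= 2 * c ->
  cos (pi / c * x) = cos (pi / c * b) -> x = b \/ x = 2 * c - b.
Proof.
move=> c0; have pc : pi / c * (2 * c) = 2 * pi :> R by field; rewrite gt_eqF.
have pos : 0 < pi / c :> R by rewrite divr_gt0// pi_gt0.
have fold z : c <= z -> cos (pi / c * z) = cos (pi / c * (2 * c - z)).
  by move=> _; rewrite mulrBr pc mulr_natl cosB cos2pi sin2pi mul1r mul0r addr0.
have inj z1 z2 : 0 <= z1 <= c -> 0 <= z2 <= c ->
    cos (pi / c * z1) = cos (pi / c * z2) -> z1 = z2.
  move=> /andP[? ?] /andP[? ?] /cos_inj h; apply: (mulfI (lt0r_neq0 pos)).
  have pin (z : R) : 0 <= z -> z <= c -> pi / c * z \in `[0, pi].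
    move=> z0 zc; rewrite in_itv/= mulr_ge0//=; last exact: ltW.
    by rewrite -[leRHS](divfK (lt0r_neq0 c0)) ler_pM2l.
  by apply: h; apply: pin.
move=> /andP[x0 x1] /andP[b0 b1].
have [xc|xc] := leP x c; have [bc|bc] := leP b c.
- by move=> h; left; apply: inj; rewrite ?x0 ?b0.
- rewrite (fold b); last exact: ltW.
  by move=> h; right; apply: inj => //; [rewrite x0|]; apply/andP; split; lra.
- rewrite (fold x); last exact: ltW.
  move=> h; right; have : 2 * c - x = b by apply: inj => //; apply/andP; split; lra.
  by lra.
- rewrite (fold x); last exact: ltW.
  rewrite (fold b); last exact: ltW.
  move=> h; left; have : 2 * c - x = 2 * c - b by apply: inj => //; apply/andP; split; lra.
  by lra.
Qed.

(** A product of cosines is a sum of cosines, so all moments of h with respect to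
    t = cos (2 pi x / T) vanish.  By evenness and periodicity h has the same value
    at the two points of the period where t takes a given value. *)
Lemma fourier_even_zero T h : 0 < T -> continuous h ->
  (forall x, h (- x) = h x) -> (forall x, h (x + T) = h x) ->
  (forall k : nat, \int[mu]_(x in `[0, T]) (h x * cos (frequency T k * x)) = 0) ->
  forall x, h x = 0.
Proof.
move=> T0 ch he hT h0.
pose t x := cos (frequency T 1 * x).
have ct : continuous t by exact: continuous_cosM.
have w1E : frequency T 1 = pi / (T / 2) by rewrite /frequency; field; rewrite gt_eqF.
have mom n : forall k, \int[mu]_(x in `[0, T]) (h x * t x ^+ n * cos (frequency T k * x)) = 0.
  elim: n => [|n IH] k.
    by under eq_Rintegral do rewrite expr0 mulr1; exact: h0.
  have cint j : integ `[0, T] (fun x => h x * t x ^+ n * cos (frequency T j * x)).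
    apply: integ_cont => x; apply: cvgM; last exact: continuous_cosM.
    by apply: cvgM; [exact: ch|exact: continuous_exp (ct _)].
  case: k => [|k].
    rewrite -[RHS](IH 1%N); apply: eq_Rintegral => x _.
    by rewrite /frequency mulr0 !mul0r cos0 mulr1 exprSr mulrA.
  transitivity (\int[mu]_(x in `[0, T]) (2^-1 * (h x * t x ^+ n * cos (frequency T k.+2 * x))
      + 2^-1 * (h x * t x ^+ n * cos (frequency T k * x)))).
    apply: eq_Rintegral => x _.
    have -> : frequency T k.+2 * x = frequency T k.+1 * x + frequency T 1 * x.
      by rewrite /frequency -(natr1 k.+1) !mulrDr !mulrDl.
    have -> : frequency T k * x = frequency T k.+1 * x - frequency T 1 * x.
      by rewrite /frequency -(natr1 k) !mulrDr !mulrDl addrK.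
    by rewrite cosD cosB exprSr -/(t x); field.
  rewrite (@RintegralD _ _ _ mu)//; [|exact: integZ..].
  by rewrite !(@RintegralZl _ _ _ mu)// !IH !mulr0 addr0.
have key (g : R -> R) x0 : continuous g -> (forall x, g (T - x) = g x) ->
    (forall n : nat, \int[mu]_(x in `[0, T]) (g x * t x ^+ n) = 0) ->
    0 < x0 < T -> g x0 <= 0.
  move=> cg gs g0 /andP[x00 x0T].
  have x0D : `[0, T]%classic x0 by rewrite /= in_itv/= !ltW.
  have mc f : continuous f -> measurable_fun `[0, T] f.
    by move=> cf; apply: measurable_funTS; exact: continuous_measurable_fun.
  apply: (@moment_le0 R `[0, T]%classic g (cst 1) t x0) => //.
  - exists (Num.min x0 (T - x0)); first by rewrite /= lt_min x00 subr_gt0.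
    move=> z /=; rewrite in_itv/= lt_min ltr_distlC => /andP[/andP[h1 _]].
    by rewrite ltr_distlC => /andP[_ h2]; apply/andP; split; lra.
  - exact: mc.
  - exact: mc.
  - by move=> x _; exact: cos_max.
  - by apply: integ_cont; exact: cst_continuous.
  - apply: integ_cont => x; apply: cvgM; [exact: cg|exact: cvg_cst].
  - exact: ct.
  - exact: cst_continuous.
  - move=> gx0.
    pose K := `[0, T]%classic `&` [set x | g x <= g x0 / 2].
    have [KE|K0] := pselect (exists x, K x); last first.
      exists 1 => // x Dx _; rewrite leNgt; apply/negP => gx; apply: K0.
      by exists x; split=> //=; exact: ltW.
    have [| | |c cK hc] := @compact_EVT_min R R (fun x => `|t x - t x0|) K.
    + by case: KE => x Kx; exists x.
    + apply: compact_closedI; first exact: segment_compact.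
      by apply: (@closed_comp _ _ g [set y | y <= g x0 / 2]) => [x _|]; [exact: cg|exact: closed_le].
    + apply: continuous_subspaceT => x; apply: cvg_norm; apply: cvgB; [exact: ct|exact: cvg_cst].
    move: cK; rewrite inE => -[cD cg0].
    exists `|t c - t x0|.
      rewrite normr_gt0 subr_eq0; apply/eqP; rewrite /t w1E => tc.
      have T2 : 2 * (T / 2) = T by field.
      have [||||] := @cos_half (T / 2) x0 c _ _ _ tc.
      * by rewrite divr_gt0.
      * by rewrite T2; move: cD; rewrite /= in_itv.
      * by rewrite T2; move: x0D; rewrite /= in_itv.
      * by move=> ce; move: cg0; rewrite /= ce; lra.
      * by rewrite T2 => ce; move: cg0; rewrite /= ce gs; lra.
    move=> x Dx tx; rewrite leNgt; apply/negP => gx.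
    by move: tx; rewrite ltNge hc// inE; split=> //=; exact: ltW.
  - by move=> n; under eq_Rintegral do rewrite mulr1; exact: g0.
have hs x : h (T - x) = h x by rewrite addrC hT he.
have hn n : \int[mu]_(x in `[0, T]) (h x * t x ^+ n) = 0.
  rewrite -[RHS](mom n 0%N); apply: eq_Rintegral => x _.
  by rewrite /frequency mulr0 !mul0r cos0 mulr1.
have hoo x : 0 < x < T -> h x = 0.
  move=> xT; apply/eqP; rewrite eq_le key//=.
  rewrite -oppr_le0; apply: (key (fun x => - h x)) => //.
  - by move=> y; apply: cvgN; exact: ch.
  - by move=> y; rewrite hs.
  - move=> n; under eq_Rintegral do rewrite mulNr -mulN1r.
    rewrite (@RintegralZl _ _ _ mu)// ?hn ?mulr0//.
    by apply: integ_cont => y; apply: cvgM; [exact: ch|exact: continuous_exp (ct _)].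
move=> x; have [y /andP[y0 yT] /(_ h hT) ->] := periodic_reduce x T0.
have [y0'|] := ltP 0 y; first by rewrite hoo ?y0'.
move=> yle; have -> : y = 0 by lra.
have l1 : h z @[z --> 0^'+] --> h 0 by apply: cvg_at_right_filter; exact: ch.
have l2 : h z @[z --> 0^'+] --> (0 : R).
  apply: cvg_trans (@cvg_cst _ _ _ (at_right 0) _); apply: near_eq_cvg.
  near=> z; rewrite hoo//; apply/andP; split.
    by near: z; exact: nbhs_right_gt.
  by near: z; exact: nbhs_right_lt.
exact: cvg_unique l1 l2.
Unshelve. all: by end_near. Qed.

End periodic.

(** * Powers of the distance *)

Section under_integral.
Variable R : realType.
Local Notation mu := (@lebesgue_measure R).
Implicit Types (D : set R) (w : R -> R) (k dk : R -> R -> R) (c e x z : R).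

(** The domination is required only within e of c: for derivatives in y, this
    keeps the height away from 0, where the kernels are singular. *)
Lemma Int_derive D k dk w c e : measurable D -> 0 < e ->
  (forall x z, `|x - c| < e -> D z -> is_derive x 1 (k ^~ z) (dk x z)) ->
  (forall x, `|x - c| < e -> integ D (k x)) ->
  integ D w ->
  (forall x z, `|x - c| < e -> D z -> `|dk x z| <= w z) ->
  is_derive c 1 (fun x => \int[mu]_(z in D) k x z) (\int[mu]_(z in D) dk c z).
Proof.
move=> mD e0 dkP ik iw kw.
have ce : `]c - e, c + e[%classic c by rewrite /= in_itv/=; apply/andP; split; lra.
have inI x : `]c - e, c + e[%classic x -> `|x - c| < e.
  by rewrite /= in_itv/= ltr_distl.
have h1 x : `]c - e, c + e[%classic x -> integ D (k x) by move/inI; exact: ik.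
have h2 x z : `]c - e, c + e[%classic x -> D z -> derivable (k ^~ z) x 1.
  by move=> /inI xe Dz; have := dkP x z xe Dz => ?; exact: ex_derive.
have h3 : integ D (fun z => `|w z|) by exact: (@integrable_norm _ _ _ mu).
have h4 x z : `]c - e, c + e[%classic x -> D z -> `|partial1of2 k x z| <= `|w z|.
  move=> /inI xe Dz; rewrite /partial1of2 (der_val (dkP x z xe Dz)).
  by rewrite (le_trans (kw _ _ xe Dz))// ler_norm.
apply: DeriveDef.
  exact: (@derivable_under_integral R _ _ mu k D mD c _ _ ce h1 h2 _ (fun z => normr_ge0 (w z)) h3 h4).
rewrite -derive1E (@differentiation_under_integral R _ _ mu k D mD c _ _ ce h1 h2 _ (fun z => normr_ge0 (w z)) h3 h4).
apply: eq_Rintegral => z; rewrite inE => Dz; rewrite /partial1of2.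
by apply: der_val; apply: dkP => //; rewrite subrr normr0.
Qed.

End under_integral.

Definition radial (R : realType) (b r y : R) : R := (r ^+ 2 + y ^+ 2) `^ (- b).

(** The Poisson integral and all its derivatives are combinations of rconv0 and
    rconv1 with coefficients depending on y. *)
Definition rconv0 (R : realType) (b : R) (g : R -> R) (x y : R) : R :=
  \int[lebesgue_measure]_z (radial b (x - z) y * g z).

Definition rconv1 (R : realType) (b : R) (g : R -> R) (x y : R) : R :=
  \int[lebesgue_measure]_z ((x - z) * radial b (x - z) y * g z).

Section kernel.
Variable R : realType.
Local Notation mu := (@lebesgue_measure R).
Implicit Types (g : R -> R) (b c r x y z M : R).

Lemma sqD_gt0 r y : 0 < y -> 0 < r ^+ 2 + y ^+ 2.
Proof. by move=> y0; rewrite ltr_wpDl ?sqr_ge0// exprn_gt0. Qed.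

Lemma radial_gt0 b r y : 0 < y -> 0 < radial b r y.
Proof. by move=> y0; rewrite powR_gt0// sqD_gt0. Qed.

Lemma radial_ge0 b r y : 0 <= radial b r y.
Proof. exact: powR_ge0. Qed.

Lemma radialN b r y : radial b (- r) y = radial b r y.
Proof. by rewrite /radial sqrrN. Qed.

Lemma radialS b r y : 0 < y -> (r ^+ 2 + y ^+ 2) * radial (b + 1) r y = radial b r y.
Proof.
move=> y0; have p := sqD_gt0 r y0; rewrite /radial opprD powRD; last first.
  by apply/implyP => _; rewrite gt_eqF.
by rewrite powR_inv1 ?ltW// mulrCA mulfV ?mulr1// gt_eqF.
Qed.

Lemma der_sqr x : is_derive x 1 (fun t : R => t ^+ 2) (2 * x).
Proof.
rewrite (_ : (fun t => _) = (fun t : R => t * t)); last exact/funext.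
by apply: der_eq (der_mul (der_id x) (der_id x)) _; ring.
Qed.

Lemma der_radial_r b r y : 0 < y ->
  is_derive r 1 (fun r => radial b r y) (- (2 * b) * (r * radial (b + 1) r y)).
Proof.
move=> y0; apply: der_eq (der_comp (der_add (der_sqr r) (der_cst (y ^+ 2) r))
  (der_powR (- b) (sqD_gt0 r y0))) _.
by rewrite /radial addr0 opprD; ring.
Qed.

Lemma der_radial_y b r y : 0 < y ->
  is_derive y 1 (fun y => radial b r y) (- (2 * b) * (y * radial (b + 1) r y)).
Proof.
move=> y0; apply: der_eq (der_comp (der_add (der_cst (r ^+ 2) y) (der_sqr y))
  (der_powR (- b) (sqD_gt0 r y0))) _.
by rewrite /radial add0r opprD; ring.
Qed.

(** Eliminating r^2 = (r^2 + y^2) - y^2 avoids kernels with r^2 in front. *)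
Lemma der_rradial_r b r y : 0 < y -> is_derive r 1 (fun r => r * radial b r y)
  ((1 - 2 * b) * radial b r y + 2 * b * y ^+ 2 * radial (b + 1) r y).
Proof.
move=> y0; apply: der_eq (der_mul (der_id r) (der_radial_r b r y0)) _.
by rewrite -(radialS b r y0); ring.
Qed.

Lemma der_subz (h : R -> R) z x a : is_derive (x - z) 1 h a ->
  is_derive x 1 (fun t => h (t - z)) a.
Proof.
move=> dh; apply: der_eq (der_comp (der_sub (der_id x) (der_cst z x)) dh) _.
by ring.
Qed.

Lemma abs_radial b r y : 0 < y -> `|r| * radial b r y <= radial (b - 2^-1) r y.
Proof.
move=> y0; have p := sqD_gt0 r y0.
rewrite /radial (_ : - (b - 2^-1) = - b + 2^-1); last by ring.
rewrite powRD; last by apply/implyP => _; rewrite gt_eqF.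
rewrite mulrC ler_wpM2l ?powR_ge0// powR12_sqrt ?(ltW p)//.
by rewrite -sqrtr_sqr ler_wsqrtr// lerDl sqr_ge0.
Qed.

Lemma powRN_compare b x y c : 0 <= b -> 0 < x -> 0 < y -> 0 < c -> x <= c * y ->
  y `^ (- b) <= c `^ b * x `^ (- b).
Proof.
move=> b0 x0 y0 c0 h; rewrite !powRN ler_pdivlMr ?powR_gt0// ler_pdivrMl ?powR_gt0//.
rewrite mulrC -powRM ?(ltW y0) ?(ltW c0)//.
by apply: ge0_ler_powR; rewrite // ?nnegrE ?mulr_ge0 ?(ltW x0) ?(ltW y0) ?(ltW c0).
Qed.

(** Provides a majorant that does not depend on the point (x, y) near which a
    convolution is differentiated. *)
Lemma radial_compare b y : 0 <= b -> 0 < y -> exists2 K, 0 < K &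
  forall x x' y' z, `|x' - x| <= 1 -> y / 2 <= y' ->
    radial b (x' - z) y' <= K * radial b (x - z) 1.
Proof.
move=> b0 y0; pose e := 4 / y ^+ 2; pose c := 2 + 3 * e.
have e0 : 0 < e by rewrite divr_gt0// exprn_gt0.
have c0 : 0 < c by rewrite addr_gt0// mulr_gt0.
exists (c `^ b) => [|x x' y' z xx yy]; first exact: powR_gt0.
have y'0 : 0 < y' by lra.
have h : ((x - z) ^+ 2 + 1 ^+ 2) <= c * ((x' - z) ^+ 2 + y' ^+ 2).
  have h1 : 1 <= e * y' ^+ 2.
    rewrite /e mulrAC ler_pdivlMr ?exprn_gt0// mul1r.
    have : (y / 2) ^+ 2 <= y' ^+ 2 by rewrite lerXn2r ?nnegrE//; lra.
    by rewrite expr_div_n; lra.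
  move: xx; rewrite ler_norml => /andP[? ?].
  have d1 : (x' - x) ^+ 2 <= 1 by nra.
  have d3 := sqr_ge0 ((x' - z) + (x' - x)).
  have d2 : 0 <= e * (x' - z) ^+ 2 by rewrite mulr_ge0 ?sqr_ge0// ltW.
  have y2 := sqr_ge0 y'.
  by rewrite /c; nra.
have p1 := sqD_gt0 (x - z) (@ltr01 R).
have p2 := sqD_gt0 (x' - z) y'0.
exact: powRN_compare.
Qed.

Lemma radial_cont b y : 0 < y -> continuous (fun r => radial b r y).
Proof. by move=> y0 r; exact: (der_cont (der_radial_r b r y0)). Qed.

Lemma cont_subr x (h : R -> R) : continuous h -> continuous (fun z => h (x - z)).
Proof.
move=> ch z; apply: (@continuous_comp _ _ _ (fun z => x - z) h); last exact: ch.
by apply: cvgB; [exact: cvg_cst|exact: cvg_id].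
Qed.

Lemma integ_radial1 b : 2^-1 < b -> integ setT (fun r => radial b r 1).
Proof.
move=> b1; have c := @radial_cont b 1 ltr01.
have mrad : measurable_fun setT (fun r => radial b r 1) by exact: continuous_measurable_fun.
apply/integrableP; split; first exact/measurable_EFinP.
rewrite (_ : (\int[mu]_(r in _) _ = \int[mu]_r (radial b r 1)%:E)%E); last first.
  by apply: eq_integral => r _; rewrite /= ger0_norm// radial_ge0.
rewrite ge0_symfun_integralT//; last 2 first.
- by move=> r; exact: radial_ge0.
- by move=> r /=; rewrite radialN.
have i1 : integ `[0, +oo[ (fun r => radial b r 1).
  have [||||ig _] := @ge0_FTC_y R (fun r => (1 + r) `^ (- (2 * b)))
    (fun r => (- (2 * b) + 1)^-1 * (1 + r) `^ (- (2 * b) + 1)) (-1) 0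
    ((- (2 * b) + 1)^-1 * 0) (ltrN10 R).
  - move=> x x1; apply: (@continuous_comp _ _ _ (fun r => 1 + r) (fun r => r `^ (- (2 * b)))).
      by apply: cvgD; [exact: cvg_cst|exact: cvg_id].
    by apply: powR_cont; lra.
  - move=> x x1; have x0 : 0 < 1 + x by lra.
    have p1 : - (2 * b) + 1 != 0 by rewrite lt_eqF//; lra.
    apply: der_eq (der_comp (der_add (der_cst 1 x) (der_id x)) (der_powR_prim p1 x0)) _.
    by rewrite add0r mulr1.
  - by move=> x _; exact: powR_ge0.
  - apply: cvgMr.
    have h : r `^ (- (2 * b) + 1) @[r --> +oo] --> (0 : R).
      rewrite (_ : - (2 * b) + 1 = - (2 * b - 1)); last by ring.
      by apply: powR_cvgy; lra.
    apply: (@cvg_comp _ _ _ (fun r => 1 + r) (fun r => r `^ (- (2 * b) + 1))).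
      exact: cvg_addrl.
    exact: h.
  apply: (@integ_le _ _ _ (fun r => 2 `^ b * (1 + r) `^ (- (2 * b)))) => //.
  - exact: measurable_funTS.
  - move=> r /=; rewrite in_itv/= andbT => r0; rewrite ger0_norm ?radial_ge0//.
    have r1 : 0 < 1 + r by lra.
    have -> : (1 + r) `^ (- (2 * b)) = ((1 + r) ^+ 2) `^ (- b).
      by rewrite -powR_mulrn ?ltW// -powRrM; congr (_ `^ _); ring.
    rewrite /radial; apply: powRN_compare; rewrite ?sqD_gt0 ?exprn_gt0//; first lra.
    by have := sqr_ge0 (r - 1); lra.
  - exact: integZ.
rewrite -set_itvcy; apply: lte_mul_pinfty => //.
by have := @integrable_lty _ _ _ mu `[0, +oo[%classic (measurable_itv _) _ i1.
Qed.

End kernel.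

(** * Convolution with powers of the distance *)

Section convolution.
Variable R : realType.
Local Notation mu := (@lebesgue_measure R).
Implicit Types (g : R -> R) (b c r x y z M : R).

Definition radial_mass b : R := \int[mu]_r radial b r 1.

Lemma radial_mass_gt0 b : 2^-1 < b -> 0 < radial_mass b.
Proof.
move=> b1; rewrite lt_neqAle; apply/andP; split; last first.
  by apply: Rintegral_ge0 => x _; exact: radial_ge0.
apply/eqP => /esym e.
have := @Int_eq0 R setT (fun r => radial b r 1) 0 measurableT filterT (integ_radial1 b1)
  (fun r _ => radial_ge0 _ _ _) (@radial_cont R b 1 ltr01 0) e.
by move=> /(_ _) /eqP; rewrite gt_eqF// radial_gt0.
Qed.

(** The substitution z = y r. *)
Lemma int_radial b y : 2^-1 < b -> 0 < y ->
  \int[mu]_z radial b z y = radial_mass b * y `^ (1 - 2 * b).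
Proof.
move=> b1 y0; rewrite /radial_mass {1}/Rintegral.
have dF x : is_derive x 1 (fun r => y * r) y.
  by apply: der_eq (der_scal y (der_id x)) _; rewrite mulr1.
have F' : (fun r => y * r)^`()%classic = cst y.
  by apply/funext => x; exact: der_val (dF x).
rewrite (@increasing_ge0_integration_by_substitutionT R (fun r => y * r) (fun z => radial b z y)).
- have E r : ((fun z => radial b z y) \o (fun r => y * r)) r * y = y `^ (1 - 2 * b) * radial b r 1.
    have e1 : (y ^+ 2) `^ (- b) = y `^ (- (2 * b)).
      by rewrite -powR_mulrn ?(ltW y0)// -powRrM mulrN.
    have e2 : y `^ (1 - 2 * b) = y * y `^ (- (2 * b)).
      by rewrite powRD ?powRr1 ?(ltW y0)//; apply/implyP => _; rewrite gt_eqF.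
    have e3 : (y * r) ^+ 2 + y ^+ 2 = y ^+ 2 * (r ^+ 2 + 1 ^+ 2) by ring.
    rewrite /= /radial e3 powRM ?sqr_ge0//; last by rewrite addr_ge0// sqr_ge0.
    by rewrite e1 e2; ring.
  rewrite F'; transitivity (\int[mu]_r (y `^ (1 - 2 * b) * radial b r 1)).
    by congr fine; apply: eq_integral => r _; rewrite -E.
  by rewrite (@RintegralZl _ _ _ mu)// 1?mulrC//; exact: integ_radial1.
- by move=> u v uv; rewrite ltr_pM2l.
- by rewrite F'; exact: cst_continuous.
- by rewrite F'; exact: is_cvg_cst.
- by rewrite F'; exact: is_cvg_cst.
- by move=> x; have := dF x => ?; exact: ex_derive.
- exact: gt0_cvgMrNy cvg_id.
- exact: gt0_cvgMry cvg_id.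
- exact: radial_cont.
- by move=> x; exact: radial_ge0.
Qed.

Lemma meas_radial b x y : 0 < y -> measurable_fun setT (fun z => radial b (x - z) y).
Proof. by move=> y0; apply: continuous_measurable_fun; exact: (@cont_subr R x (fun r => radial b r y) (@radial_cont R b y y0)). Qed.

Lemma integ_radial b x y : 2^-1 < b -> 0 < y -> integ setT (fun z => radial b (x - z) y).
Proof.
move=> b1 y0; have b0 : 0 <= b by lra.
have [K K0 hK] := radial_compare b0 y0.
apply: (@integ_le _ _ _ (fun z => K * radial b (x - z) 1)) => //; first exact: meas_radial.
  move=> z _; rewrite ger0_norm ?radial_ge0//; apply: hK; first by rewrite subrr normr0.
  by lra.
apply: integZ => //.
apply: (@integ_reflect R x (fun z => radial b z 1)); last exact: integ_radial1.
by apply: continuous_measurable_fun; exact: radial_cont.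
Qed.

Lemma int_radial_sub b x y : 2^-1 < b -> 0 < y ->
  \int[mu]_z radial b (x - z) y = radial_mass b * y `^ (1 - 2 * b).
Proof.
move=> b1 y0; rewrite -(int_radial b1 y0).
apply: (@Rint_reflect R x (fun z => radial b z y)).
by apply: continuous_measurable_fun; exact: radial_cont.
Qed.


Variables (g : R -> R) (M : R).
Hypothesis (cg : continuous g) (gM : forall x, `|g x| <= M).

Let M0 : 0 <= M. Proof. by apply: le_trans (gM 0). Qed.

Lemma meas_sub (h : R -> R) x : continuous h -> measurable_fun setT (fun z => h (x - z) * g z).
Proof.
move=> ch; apply: measurable_funM; apply: continuous_measurable_fun => //.
exact: cont_subr.
Qed.

Lemma cont_rradial b y : 0 < y -> continuous (fun r => r * radial b r y).
Proof. by move=> y0 r; exact: (der_cont (der_rradial_r b r y0)). Qed.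

Lemma radialg_le b r y z : `|radial b r y * g z| <= M * radial b r y.
Proof. by rewrite normrM mulrC (ger0_norm (radial_ge0 _ _ _)) ler_wpM2r ?radial_ge0. Qed.

Lemma integ_rconv0 b x y : 2^-1 < b -> 0 < y ->
  integ setT (fun z => radial b (x - z) y * g z).
Proof.
move=> b1 y0; apply: (@integ_le _ _ _ (fun z => M * radial b (x - z) y)) => //.
- by apply: (@meas_sub (fun r => radial b r y)); exact: radial_cont.
- by move=> z _; exact: radialg_le.
- by apply: integZ => //; exact: integ_radial.
Qed.

Lemma rconv1_le b x y z : 0 < y ->
  `|(x - z) * radial b (x - z) y * g z| <= M * radial (b - 2^-1) (x - z) y.
Proof.
move=> y0; rewrite normrM mulrC ler_pM//.
by rewrite normrM (ger0_norm (radial_ge0 _ _ _)) abs_radial.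
Qed.

Lemma integ_rconv1 b x y : 1 < b -> 0 < y ->
  integ setT (fun z => (x - z) * radial b (x - z) y * g z).
Proof.
move=> b1 y0; apply: (@integ_le _ _ _ (fun z => M * radial (b - 2^-1) (x - z) y)) => //.
- by apply: (@meas_sub (fun r => r * radial b r y)); exact: cont_rradial.
- by move=> z _; exact: rconv1_le.
- by apply: integZ => //; apply: integ_radial => //; lra.
Qed.

Lemma rconv0_bound b x y : 2^-1 < b -> 0 < y ->
  `|rconv0 b g x y| <= M * radial_mass b * y `^ (1 - 2 * b).
Proof.
move=> b1 y0; rewrite -mulrA -(int_radial_sub x b1 y0).
rewrite -(@RintegralZl _ _ _ mu)//; last exact: integ_radial.
apply: normInt => //.
- by apply: (@meas_sub (fun r => radial b r y)); exact: radial_cont.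
- by apply: integZ => //; exact: integ_radial.
- by move=> z _; exact: radialg_le.
Qed.

Lemma rconv1_bound b x y : 1 < b -> 0 < y ->
  `|rconv1 b g x y| <= M * radial_mass (b - 2^-1) * y `^ (2 - 2 * b).
Proof.
move=> b1 y0; have b2 : 2^-1 < b - 2^-1 by lra.
have -> : 2 - 2 * b = 1 - 2 * (b - 2^-1) by field.
rewrite -mulrA -(int_radial_sub x b2 y0).
rewrite -(@RintegralZl _ _ _ mu)//; last exact: integ_radial.
apply: normInt => //.
- by apply: (@meas_sub (fun r => r * radial b r y)); exact: cont_rradial.
- by apply: integZ => //; exact: integ_radial.
- by move=> z _; exact: rconv1_le.
Qed.

Lemma der_gz (h : R -> R) z x a : is_derive x 1 h a ->
  is_derive x 1 (fun t => h t * g z) (a * g z).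
Proof. by move=> dh; apply: der_eq (der_mul dh (der_cst (g z) x)) _; rewrite mulr0 addr0. Qed.

Lemma der_rconv0_x b x y : 2^-1 < b -> 0 < y ->
  is_derive x 1 (rconv0 b g ^~ y) (- (2 * b) * rconv1 (b + 1) g x y).
Proof.
move=> b1 y0; have b0 : 0 <= b + 2^-1 by lra.
have b2 : 2^-1 < b + 2^-1 by lra.
have [K K0 hK] := radial_compare b0 y0.
rewrite /rconv1 -(@RintegralZl _ _ _ mu)//; last by apply: integ_rconv1 => //; lra.
apply: (@Int_derive R setT (fun x z => radial b (x - z) y * g z)
  (fun x z => - (2 * b) * ((x - z) * radial (b + 1) (x - z) y * g z))
  (fun z => 2 * b * (M * (K * radial (b + 2^-1) (x - z) 1))) x 1) => //.
- move=> t z _ _.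
  apply: der_eq (der_gz z (der_subz (der_radial_r b (t - z) y0))) _; ring.
- by move=> t _; exact: integ_rconv0.
- by do 3 apply: integZ => //; exact: integ_radial.
- move=> t z tx _; rewrite normrM normrN (@ger0_norm _ (2 * b)); last by lra.
  apply: ler_wpM2l; first by lra.
  apply: le_trans (rconv1_le (b + 1) t z y0) _; apply: ler_wpM2l => //.
  have -> : b + 1 - 2^-1 = b + 2^-1 by field.
  by apply: hK; [exact: ltW|lra].
Qed.

Lemma der_rconv1_x b x y : 1 < b -> 0 < y ->
  is_derive x 1 (rconv1 b g ^~ y)
    ((1 - 2 * b) * rconv0 b g x y + 2 * b * y ^+ 2 * rconv0 (b + 1) g x y).
Proof.
move=> b1 y0.
have [b0 b2 b3 b4] : [/\ 0 <= b, 0 <= b + 1, 2^-1 < b & 2^-1 < b + 1] by split; lra.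
have [K K0 hK] := radial_compare b0 y0.
have [L L0 hL] := radial_compare b2 y0.
rewrite /rconv0 -!(@RintegralZl _ _ _ mu)//; [|exact: integ_rconv0..].
rewrite -(@RintegralD _ _ _ mu)//; [|by apply: integZ => //; exact: integ_rconv0..].
apply: (@Int_derive R setT (fun x z => (x - z) * radial b (x - z) y * g z)
  (fun x z => (1 - 2 * b) * (radial b (x - z) y * g z) + 2 * b * y ^+ 2 * (radial (b + 1) (x - z) y * g z))
  (fun z => (2 * b) * (M * (K * radial b (x - z) 1)) + 2 * b * y ^+ 2 * (M * (L * radial (b + 1) (x - z) 1)))
  x 1) => //.
- move=> t z _ _.
  apply: der_eq (der_gz z (der_subz (der_rradial_r b (t - z) y0))) _; ring.
- by move=> t _; exact: integ_rconv1.
- by apply: integD => //; do 3 apply: integZ => //; exact: integ_radial.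
- move=> t z tx _; apply: le_trans (ler_normD _ _) _; apply: lerD.
    rewrite normrM; apply: ler_pM => //; first by rewrite ler0_norm; lra.
    rewrite normrM mulrC ler_pM// ger0_norm ?radial_ge0//.
    by apply: hK; [exact: ltW|lra].
  have by0 : 0 <= 2 * b * y ^+ 2 by rewrite mulr_ge0 ?sqr_ge0//; lra.
  rewrite normrM (ger0_norm by0) ler_wpM2l//.
  rewrite normrM mulrC ler_pM// ger0_norm ?radial_ge0//.
  by apply: hL; [exact: ltW|lra].
Qed.

Lemma der_rconv0_y b x y : 2^-1 < b -> 0 < y ->
  is_derive y 1 (rconv0 b g x) (- (2 * b) * y * rconv0 (b + 1) g x y).
Proof.
move=> b1 y0; have [b0 b2] : 0 <= b + 1 /\ 2^-1 < b + 1 by split; lra.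
have [K K0 hK] := radial_compare b0 y0.
rewrite {2}/rconv0 -(@RintegralZl _ _ _ mu)//; last exact: integ_rconv0.
have y2 : 0 < y / 2 by lra.
apply: (@Int_derive R setT (fun y z => radial b (x - z) y * g z)
  (fun y z => - (2 * b) * y * (radial (b + 1) (x - z) y * g z))
  (fun z => 2 * b * (2 * y) * (M * (K * radial (b + 1) (x - z) 1))) y (y / 2)) => //.
- move=> t z; rewrite ltr_distl => /andP[t0 _] _; have tp : 0 < t by lra.
  apply: der_eq (der_gz z (der_radial_y b (x - z) tp)) _; ring.
- by move=> t; rewrite ltr_distl => /andP[t0 _]; apply: integ_rconv0 => //; lra.
- by do 3 apply: integZ => //; exact: integ_radial.
- move=> t z; rewrite ltr_distl => /andP[t0 t1] _.
  rewrite normrM; apply: ler_pM => //.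
    rewrite normrM normrN (@ger0_norm _ (2 * b)); last by lra.
    by rewrite ler_wpM2l ?ger0_norm//; lra.
  rewrite normrM mulrC ler_pM// ger0_norm ?radial_ge0//.
  by apply: hK; [rewrite subrr normr0|lra].
Qed.

Lemma der_rconv1_y b x y : 1 < b -> 0 < y ->
  is_derive y 1 (rconv1 b g x) (- (2 * b) * y * rconv1 (b + 1) g x y).
Proof.
move=> b1 y0; have [b0 b2] : 0 <= b + 2^-1 /\ 2^-1 < b + 2^-1 by split; lra.
have [K K0 hK] := radial_compare b0 y0.
rewrite {2}/rconv1 -(@RintegralZl _ _ _ mu)//; last by apply: integ_rconv1 => //; lra.
have y2 : 0 < y / 2 by lra.
apply: (@Int_derive R setT (fun y z => (x - z) * radial b (x - z) y * g z)
  (fun y z => - (2 * b) * y * ((x - z) * radial (b + 1) (x - z) y * g z))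
  (fun z => 2 * b * (2 * y) * (M * (K * radial (b + 2^-1) (x - z) 1))) y (y / 2)) => //.
- move=> t z; rewrite ltr_distl => /andP[t0 _] _; have tp : 0 < t by lra.
  apply: der_eq (der_gz z (der_scal (x - z) (der_radial_y b (x - z) tp))) _; ring.
- by move=> t; rewrite ltr_distl => /andP[t0 _]; apply: integ_rconv1 => //; lra.
- by do 3 apply: integZ => //; exact: integ_radial.
- move=> t z; rewrite ltr_distl => /andP[t0 t1] _; have tp : 0 < t by lra.
  rewrite normrM; apply: ler_pM => //.
    rewrite normrM normrN (@ger0_norm _ (2 * b)); last by lra.
    by rewrite ler_wpM2l ?ger0_norm//; lra.
  apply: le_trans (rconv1_le (b + 1) x z tp) _; apply: ler_wpM2l => //.
  have -> : b + 1 - 2^-1 = b + 2^-1 by field.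
  by apply: hK; [rewrite subrr normr0|lra].
Qed.

End convolution.

(** * The extension and its conjugate *)

Section symmetries.
Variable R : realType.
Local Notation mu := (@lebesgue_measure R).
Implicit Types (k g : R -> R) (x y z T : R).

Lemma conv_sub k g x : continuous k -> continuous g ->
  \int[mu]_z (k (x - z) * g z) = \int[mu]_r (k r * g (x - r)).
Proof.
move=> ck cg; rewrite -(@Rint_reflect R x (fun r => k r * g (x - r))).
  by apply: eq_Rintegral => z _; congr (_ * g _); ring.
apply: continuous_measurable_fun => z; apply: cvgM; first exact: ck.
exact: cont_subr.
Qed.

Lemma conv_periodic k g T x : continuous k -> continuous g ->
  (forall z, g (z + T) = g z) ->
  \int[mu]_z (k (x + T - z) * g z) = \int[mu]_z (k (x - z) * g z).
Proof.
move=> ck cg gT; rewrite !conv_sub//; apply: eq_Rintegral => r _.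
by rewrite addrAC gT.
Qed.

Lemma conv_even k g x : continuous k -> continuous g ->
  (forall z, g (- z) = g z) -> (forall z, k (- z) = k z) ->
  \int[mu]_z (k (- x - z) * g z) = \int[mu]_z (k (x - z) * g z).
Proof.
move=> ck cg ge ke; rewrite (conv_sub _ ck cg) (conv_sub _ ck cg) -[RHS](@Rint_reflect R 0).
  apply: eq_Rintegral => r _.
  by rewrite sub0r ke opprK -(ge (x + r)) opprD.
apply: continuous_measurable_fun => z; apply: cvgM; first exact: ck.
exact: cont_subr.
Qed.

Lemma conv_odd0 k g : continuous k -> continuous g ->
  (forall z, g (- z) = g z) -> (forall z, k (- z) = - k z) ->
  integ setT (fun z => k (0 - z) * g z) ->
  \int[mu]_z (k (0 - z) * g z) = 0.
Proof.
move=> ck cg ge ko ik.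
have mf : measurable_fun setT (fun z => k (0 - z) * g z).
  apply: continuous_measurable_fun => z; apply: cvgM; last exact: cg.
  exact: cont_subr.
have e : \int[mu]_z (k (0 - (0 - z)) * g (0 - z)) = \int[mu]_z (-1 * (k (0 - z) * g z)).
  by apply: eq_Rintegral => z _; rewrite !sub0r opprK ge ko; ring.
have := Rint_reflect 0 mf; rewrite /= e (@RintegralZl _ _ _ mu)//.
by move: (\int[mu]_z _) => I h; lra.
Qed.

End symmetries.

(** U solves div(y^a grad U) = 0 on the upper half-plane; X = U_x, A = U_xx,
    and the conjugate unknown Z = y^a U_y has S = Z_x.  With Z instead of U_y the
    derivatives in y of U, X and Z are Z, S and - A up to powers of y. *)
Record weighted_harmonic (R : realType) (a : R) (U X Z S A : R -> R -> R) : Prop :=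
  WeightedHarmonic {
  wh_Ux : forall x y : R, 0 < y -> is_derive x 1 (U ^~ y) (X x y);
  wh_Uy : forall x y : R, 0 < y -> is_derive y 1 (U x) (y `^ (- a) * Z x y);
  wh_Xx : forall x y : R, 0 < y -> is_derive x 1 (X ^~ y) (A x y);
  wh_Xy : forall x y : R, 0 < y -> is_derive y 1 (X x) (y `^ (- a) * S x y);
  wh_Zx : forall x y : R, 0 < y -> is_derive x 1 (Z ^~ y) (S x y);
  wh_Zy : forall x y : R, 0 < y -> is_derive y 1 (Z x) (- (y `^ a * A x y));
  wh_Ax : forall y : R, 0 < y -> continuous (A ^~ y);
  wh_Ay : forall x y : R, 0 < y -> {for y, continuous (A x)};
  wh_Sy : forall x y : R, 0 < y -> {for y, continuous (S x)} }.

Record scale_bounds (R : realType) (a K : R) (U X Z S A : R -> R -> R) : Prop :=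
  ScaleBounds {
  sb_U : forall x y : R, 0 < y -> `|U x y| <= K;
  sb_X : forall x y : R, 0 < y -> `|X x y| <= K * y `^ (-1);
  sb_Z : forall x y : R, 0 < y -> `|Z x y| <= K * y `^ (a - 1);
  sb_S : forall x y : R, 0 < y -> `|S x y| <= K * y `^ (a - 2);
  sb_A : forall x y : R, 0 < y -> `|A x y| <= K * y `^ (-2) }.

Section extension.
Variable R : realType.
Variables (s : R) (g : R -> R) (M : R).
Hypothesis (hs : 0 < s < 1) (cg : continuous g) (gM : forall x, `|g x| <= M).
Local Notation mu := (@lebesgue_measure R).
Implicit Types (x y z T : R).

Let a := 1 - 2 * s.
Let b := s + 2^-1.
Let N := radial_mass b.

(** The Poisson integral of g, normalized by the mass of its kernel at height 1.
    The next four functions are its U_x, y^a U_y, y^a U_xy and U_xx. *)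
Definition Uext x y := (radial_mass (s + 2^-1))^-1 * y `^ (2 * s) * rconv0 (s + 2^-1) g x y.
Definition Xext x y :=
  - (2 * (s + 2^-1)) / radial_mass (s + 2^-1) * y `^ (2 * s) * rconv1 (s + 2^-1 + 1) g x y.
Definition Zext x y := (radial_mass (s + 2^-1))^-1 *
  (2 * s * rconv0 (s + 2^-1) g x y - 2 * (s + 2^-1) * (y ^+ 2 * rconv0 (s + 2^-1 + 1) g x y)).
Definition Sext x y := (radial_mass (s + 2^-1))^-1 *
  (4 * (s + 2^-1) * (s + 2^-1 + 1) * (y ^+ 2 * rconv1 (s + 2^-1 + 1 + 1) g x y)
   - 4 * s * (s + 2^-1) * rconv1 (s + 2^-1 + 1) g x y).
Definition Aext x y := - (2 * (s + 2^-1)) / radial_mass (s + 2^-1) * y `^ (2 * s) *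
  ((1 - 2 * (s + 2^-1 + 1)) * rconv0 (s + 2^-1 + 1) g x y
   + 2 * (s + 2^-1 + 1) * y ^+ 2 * rconv0 (s + 2^-1 + 1 + 1) g x y).

Let s0 : 0 < s. Proof. by case/andP: hs. Qed.
Let s1 : s < 1. Proof. by case/andP: hs. Qed.
Let b1 : 2^-1 < b. Proof. by move: s0 s1; rewrite /b => *; lra. Qed.
Let b2 : 2^-1 < b + 1. Proof. by move: s0 s1; rewrite /b => *; lra. Qed.
Let b3 : 2^-1 < b + 1 + 1. Proof. by move: s0 s1; rewrite /b => *; lra. Qed.
Let b4 : 1 < b + 1. Proof. by move: s0 s1; rewrite /b => *; lra. Qed.
Let b5 : 1 < b + 1 + 1. Proof. by move: s0 s1; rewrite /b => *; lra. Qed.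
Let N0 : 0 < N. Proof. exact: radial_mass_gt0. Qed.
Let Nn0 : N != 0. Proof. by rewrite gt_eqF. Qed.

Lemma powR_pred y : 0 < y -> y `^ (2 * s) = y * y `^ (2 * s - 1).
Proof. by move: s0 => s0' y0; rewrite mulr_powRB1 ?(ltW y0)//; lra. Qed.

(** Each field differentiates the two convolutions once; the equation of U is the
    one for Z_y, where y^a y^(2s) = y. *)
Lemma ext_weighted_harmonic : weighted_harmonic a Uext Xext Zext Sext Aext.
Proof.
have d0x bb x y (h : 2^-1 < bb) (y0 : 0 < y) := der_rconv0_x cg gM x h y0.
have d1x bb x y (h : 1 < bb) (y0 : 0 < y) := der_rconv1_x cg gM x h y0.
have d0y bb x y (h : 2^-1 < bb) (y0 : 0 < y) := der_rconv0_y cg gM x h y0.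
have d1y bb x y (h : 1 < bb) (y0 : 0 < y) := der_rconv1_y cg gM x h y0.
split.
- move=> x y y0; apply: der_eq (der_scal _ (d0x _ x y b1 y0)) _.
  by rewrite /Xext -/b -/N; field.
- move=> x y y0.
  apply: der_eq (der_mul (der_scal _ (der_powR _ y0)) (d0y _ x y b1 y0)) _.
  rewrite /Zext -/b -/N (_ : - a = 2 * s - 1); last by rewrite /a; ring.
  by rewrite (powR_pred y0); field.
- move=> x y y0; apply: der_eq (der_scal _ (d1x _ x y b4 y0)) _.
  by [].
- move=> x y y0.
  apply: der_eq (der_mul (der_scal _ (der_powR _ y0)) (d1y _ x y b4 y0)) _.
  rewrite /Sext -/b -/N (_ : - a = 2 * s - 1); last by rewrite /a; ring.
  by rewrite (powR_pred y0); field.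
- move=> x y y0.
  apply: der_eq (der_scal _ (der_sub (der_scal _ (d0x _ x y b1 y0))
    (der_scal _ (der_scal _ (d0x _ x y b2 y0))))) _.
  by rewrite /Sext -/b -/N; field.
- move=> x y y0.
  apply: der_eq (der_scal _ (der_sub (der_scal _ (d0y _ x y b1 y0))
    (der_scal _ (der_mul (der_sqr y) (d0y _ x y b2 y0))))) _.
  have ya : y `^ a * y `^ (2 * s) = y.
    rewrite -powRD; last by apply/implyP => _; rewrite gt_eqF.
    by rewrite /a subrK powRr1// ltW.
  rewrite /Aext -/b -/N.
  transitivity (- (y `^ a * y `^ (2 * s)) * (- (2 * b) / N *
     ((1 - 2 * (b + 1)) * rconv0 (b + 1) g x y + 2 * (b + 1) * y ^+ 2 * rconv0 (b + 1 + 1) g x y))).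
    by rewrite ya /b; field.
  by ring.
- move=> y y0 x.
  have := der_scal (- (2 * b) / N * y `^ (2 * s)) (der_add
    (der_scal (1 - 2 * (b + 1)) (d0x _ x y b2 y0))
    (der_scal (2 * (b + 1) * y ^+ 2) (d0x _ x y b3 y0))).
  exact: der_cont.
- move=> x y y0.
  have := der_mul (der_scal (- (2 * b) / N) (der_powR (2 * s) y0)) (der_add
    (der_scal (1 - 2 * (b + 1)) (d0y _ x y b2 y0))
    (der_mul (der_scal (2 * (b + 1)) (der_sqr y)) (d0y _ x y b3 y0))).
  exact: der_cont.
- move=> x y y0.
  have := der_scal (N^-1) (der_sub
    (der_scal (4 * b * (b + 1)) (der_mul (der_sqr y) (d1y _ x y b5 y0)))
    (der_scal (4 * s * b) (d1y _ x y b4 y0))).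
  exact: der_cont.
Qed.

End extension.

(** * Scale invariant bounds and symmetries *)

Section extension_bounds.
Variable R : realType.
Variables (s : R) (g : R -> R) (M : R).
Hypothesis (hs : 0 < s < 1) (cg : continuous g) (gM : forall x, `|g x| <= M).
Local Notation mu := (@lebesgue_measure R).
Implicit Types (x y z T : R).

Let a := 1 - 2 * s.
Let b := s + 2^-1.
Let N := radial_mass b.
Let s0 : 0 < s. Proof. by case/andP: hs. Qed.
Let s1 : s < 1. Proof. by case/andP: hs. Qed.
Let b0 : 0 < b. Proof. by move: s0 s1; rewrite /b => *; lra. Qed.
Let b1 : 2^-1 < b. Proof. by move: s0 s1; rewrite /b => *; lra. Qed.
Let b2 : 2^-1 < b + 1. Proof. by move: s0 s1; rewrite /b => *; lra. Qed.
Let b3 : 2^-1 < b + 1 + 1. Proof. by move: s0 s1; rewrite /b => *; lra. Qed.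
Let b4 : 1 < b + 1. Proof. by move: s0 s1; rewrite /b => *; lra. Qed.
Let b5 : 1 < b + 1 + 1. Proof. by move: s0 s1; rewrite /b => *; lra. Qed.
Let N0 : 0 < N. Proof. exact: radial_mass_gt0. Qed.
Let Nn0 : N != 0. Proof. by rewrite gt_eqF. Qed.
Let M0 : 0 <= M. Proof. by apply: le_trans (gM 0). Qed.

Lemma eqW x y : x = y -> x <= y. Proof. by move=> ->. Qed.

Lemma powRMD y p q : 0 < y -> y `^ p * y `^ q = y `^ (p + q).
Proof. by move=> y0; rewrite powRD//; apply/implyP => _; rewrite gt_eqF. Qed.

Let sq y : 0 < y -> y ^+ 2 = y `^ 2.
Proof. by move=> y0; rewrite -powR_mulrn// ltW. Qed.

Lemma Uext_bound x y : 0 < y -> `|Uext s g x y| <= M.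
Proof.
move=> y0; rewrite /Uext -/b -/N !normrM ger0_norm ?invr_ge0 ?(ltW N0)//.
rewrite ger0_norm ?powR_ge0//.
apply: le_trans (ler_wpM2l _ (rconv0_bound cg gM x b1 y0)) _.
  by rewrite mulr_ge0 ?powR_ge0// invr_ge0 ltW.
rewrite -/N; have e : y `^ (2 * s) * y `^ (1 - 2 * b) = 1.
  by rewrite powRMD// -[RHS](powRr0 y); congr (_ `^ _); rewrite /b; field.
apply: eqW.
transitivity (M * (y `^ (2 * s) * y `^ (1 - 2 * b))); last by rewrite e mulr1.
by field.
Qed.

(** The exponents are those by which the five functions change under the scaling
    (x, y) -> (r x, r y). *)
Lemma ext_scale_bounds : exists2 K, 0 < K &
  scale_bounds a K (Uext s g) (Xext s g) (Zext s g) (Sext s g) (Aext s g).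
Proof.
have MN bb : 0 <= M * radial_mass bb.
  by apply: mulr_ge0 => //; apply: Rintegral_ge0 => r _; exact: radial_ge0.
have j0 bb x y (h : 2^-1 < bb) (y0 : 0 < y) := rconv0_bound cg gM x h y0.
have j1 bb x y (h : 1 < bb) (y0 : 0 < y) := rconv1_bound cg gM x h y0.
pose K1 := 2 * b / N * (M * radial_mass (b + 1 - 2^-1)).
pose K2 := N^-1 * (2 * s * (M * radial_mass b) + 2 * b * (M * radial_mass (b + 1))).
pose K3 := N^-1 * (4 * b * (b + 1) * (M * radial_mass (b + 1 + 1 - 2^-1)) +
                   4 * s * b * (M * radial_mass (b + 1 - 2^-1))).
pose K4 := 2 * b / N * ((1 + 2 * b) * (M * radial_mass (b + 1)) +
                   2 * (b + 1) * (M * radial_mass (b + 1 + 1))).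
have bN : 0 <= 2 * b / N by rewrite divr_ge0 ?(ltW N0)// mulr_ge0// ltW.
have iN : 0 <= N^-1 by rewrite invr_ge0 ltW.
have K10 : 0 <= K1 by exact: mulr_ge0.
have K20 : 0 <= K2.
  by apply: mulr_ge0 => //; apply: addr_ge0; apply: mulr_ge0 => //; rewrite mulr_ge0// ltW.
have b10 : 0 < b + 1 by rewrite addr_gt0.
have K30 : 0 <= K3.
  apply: mulr_ge0 => //; apply: addr_ge0; apply: mulr_ge0 => //; rewrite mulr_ge0 ?(ltW b10) ?(ltW b0)//.
    by rewrite mulr_ge0// ltW.
  by rewrite mulr_ge0// ltW.
have K40 : 0 <= K4.
  apply: mulr_ge0 => //; apply: addr_ge0; apply: mulr_ge0 => //.
    by rewrite addr_ge0// mulr_ge0// ltW.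
  by rewrite mulr_ge0// ltW.
have gen (m p q r t : R) : 0 <= m -> 0 <= p -> 0 <= q -> 0 <= r -> 0 <= t ->
    [/\ 0 < 1 + m + p + q + r + t, m <= 1 + m + p + q + r + t, p <= 1 + m + p + q + r + t &
     [/\ q <= 1 + m + p + q + r + t, r <= 1 + m + p + q + r + t & t <= 1 + m + p + q + r + t]].
  by move=> *; split; [..|split]; lra.
have [Kp MK K1K [K2K K3K K4K]] := gen _ _ _ _ _ M0 K10 K20 K30 K40.
exists (1 + M + K1 + K2 + K3 + K4) => //.
have up L k y p : 0 <= L -> k <= L * y `^ p -> L <= 1 + M + K1 + K2 + K3 + K4 ->
    k <= (1 + M + K1 + K2 + K3 + K4) * y `^ p.
  by move=> L0 kL LK; apply: le_trans kL _; rewrite ler_wpM2r ?powR_ge0.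
split=> x y y0.
- by apply: le_trans (Uext_bound x y0) MK.
- apply: up K10 _ K1K.
  rewrite /Xext -/b -/N 2!normrM mulNr normrN (ger0_norm bN) (ger0_norm (powR_ge0 _ _)).
  apply: le_trans (ler_wpM2l _ (j1 _ x y b4 y0)) _.
    by rewrite mulr_ge0 ?powR_ge0.
  have e : y `^ (2 * s) * y `^ (2 - 2 * (b + 1)) = y `^ (-1).
    by rewrite powRMD//; congr (_ `^ _); rewrite /b; field.
  by rewrite -e /K1; apply: eqW; ring.
- apply: up K20 _ K2K.
  have e1 : y `^ (1 - 2 * b) = y `^ (a - 1) by congr (_ `^ _); rewrite /a /b; field.
  have e2 : y ^+ 2 * y `^ (1 - 2 * (b + 1)) = y `^ (a - 1).
    by rewrite sq// powRMD//; congr (_ `^ _); rewrite /a /b; field.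
  rewrite /Zext -/b -/N normrM (ger0_norm iN) /K2 -[leRHS]mulrA ler_wpM2l//.
  apply: le_trans (ler_normB _ _) _; rewrite [leRHS]mulrDl; apply: lerD.
    rewrite normrM ger0_norm ?mulr_ge0 ?(ltW s0)// -[leRHS]mulrA ler_wpM2l ?mulr_ge0 ?(ltW s0)//.
    by rewrite -e1; exact: j0.
  rewrite normrM ger0_norm ?mulr_ge0 ?(ltW b0)// -[leRHS]mulrA ler_wpM2l ?mulr_ge0 ?(ltW b0)//.
  rewrite normrM ger0_norm ?sqr_ge0// -e2 [leRHS]mulrCA ler_wpM2l ?sqr_ge0//.
  exact: j0.
- apply: up K30 _ K3K.
  have e1 : y `^ (2 - 2 * (b + 1)) = y `^ (a - 2) by congr (_ `^ _); rewrite /a /b; field.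
  have e2 : y ^+ 2 * y `^ (2 - 2 * (b + 1 + 1)) = y `^ (a - 2).
    by rewrite sq// powRMD//; congr (_ `^ _); rewrite /a /b; field.
  have c1 : 0 <= 4 * b * (b + 1) by rewrite !mulr_ge0 ?(ltW b0) ?(ltW b10).
  have c2 : 0 <= 4 * s * b by rewrite !mulr_ge0 ?(ltW b0) ?(ltW s0).
  rewrite /Sext -/b -/N normrM (ger0_norm iN) /K3 -[leRHS]mulrA ler_wpM2l//.
  apply: le_trans (ler_normB _ _) _; rewrite [leRHS]mulrDl; apply: lerD.
    rewrite normrM (ger0_norm c1) -[leRHS]mulrA ler_wpM2l//.
    rewrite normrM ger0_norm ?sqr_ge0// -e2 [leRHS]mulrCA ler_wpM2l ?sqr_ge0//.
    exact: j1.
  rewrite normrM (ger0_norm c2) -[leRHS]mulrA ler_wpM2l//.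
  by rewrite -e1; exact: j1.
- apply: up K40 _ K4K.
  have e1 : y `^ (2 * s) * y `^ (1 - 2 * (b + 1)) = y `^ (-2).
    by rewrite powRMD//; congr (_ `^ _); rewrite /b; field.
  have e2 : y `^ (2 * s) * (y ^+ 2 * y `^ (1 - 2 * (b + 1 + 1))) = y `^ (-2).
    by rewrite sq// !powRMD//; congr (_ `^ _); rewrite /b; field.
  have c1 : 0 <= 1 + 2 * b by rewrite addr_ge0 ?mulr_ge0 ?(ltW b0).
  have c2 : 0 <= 2 * (b + 1) by rewrite mulr_ge0 ?(ltW b10).
  rewrite /Aext -/b -/N normrM [X in X * _]normrM mulNr normrN (ger0_norm bN).
  rewrite (ger0_norm (powR_ge0 _ _)) /K4 -[leLHS]mulrA -[leRHS]mulrA ler_wpM2l//.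
  apply: (@le_trans _ _ (y `^ (2 * s) * ((1 + 2 * b) * (M * radial_mass (b + 1) * y `^ (1 - 2 * (b + 1)))
     + 2 * (b + 1) * (y ^+ 2 * (M * radial_mass (b + 1 + 1) * y `^ (1 - 2 * (b + 1 + 1))))))).
    rewrite ler_wpM2l ?powR_ge0//; apply: le_trans (ler_normD _ _) _; apply: lerD.
      have -> : 1 - 2 * (b + 1) = - (1 + 2 * b) by ring.
      rewrite normrM normrN (ger0_norm c1) ler_wpM2l//.
      rewrite (_ : - (1 + 2 * b) = 1 - 2 * (b + 1)); [exact: j0|ring].
    rewrite -mulrA normrM (ger0_norm c2) ler_wpM2l//.
    rewrite normrM ger0_norm ?sqr_ge0// ler_wpM2l ?sqr_ge0//.
    exact: j0.
  by rewrite [leRHS]mulrDl -{1}e1 -e2; apply: eqW; ring.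
Qed.

Lemma ext_symmetries T : (forall x, g (- x) = g x) -> (forall x, g (x + T) = g x) ->
  [/\ forall x y, 0 < y -> Uext s g (x + T) y = Uext s g x y,
      forall x y, 0 < y -> Zext s g (x + T) y = Zext s g x y,
      forall x y, 0 < y -> Uext s g (- x) y = Uext s g x y,
      forall x y, 0 < y -> Zext s g (- x) y = Zext s g x y &
      forall x y, 0 < y -> Xext s g (x + T) y = Xext s g x y /\ Xext s g 0 y = 0].
Proof.
move=> ge gT.
have p0 bb x y : 0 < y -> rconv0 bb g (x + T) y = rconv0 bb g x y.
  by move=> y0; apply: (@conv_periodic _ (fun r => radial bb r y)) => //; exact: radial_cont.
have e0 bb x y : 0 < y -> rconv0 bb g (- x) y = rconv0 bb g x y.
  move=> y0; apply: (@conv_even _ (fun r => radial bb r y)) => //; first exact: radial_cont.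
  by move=> z; rewrite radialN.
have p1 bb x y : 0 < y -> rconv1 bb g (x + T) y = rconv1 bb g x y.
  by move=> y0; apply: (@conv_periodic _ (fun r => r * radial bb r y)) => //; exact: cont_rradial.
have o1 bb y : 1 < bb -> 0 < y -> rconv1 bb g 0 y = 0.
  move=> b1' y0; apply: (@conv_odd0 _ (fun r => r * radial bb r y)) => //; first exact: cont_rradial.
    by move=> z; rewrite radialN mulNr.
  exact: (integ_rconv1 cg gM).
split=> x y y0; rewrite ?/Uext ?/Zext ?/Xext ?p0 ?e0 ?p1 ?o1 ?mulr0//.
Qed.

End extension_bounds.

(** * Boundary values of the extension *)

Section boundary.
Variable R : realType.
Variables (s : R) (g : R -> R) (M : R).
Hypothesis (hs : 0 < s < 1) (cg : continuous g) (gM : forall x, `|g x| <= M).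
Local Notation mu := (@lebesgue_measure R).
Implicit Types (x y z T : R).

Let b := s + 2^-1.
Let N := radial_mass b.
Let s0 : 0 < s. Proof. by case/andP: hs. Qed.
Let b0 : 0 <= b. Proof. by move: s0; rewrite /b => *; lra. Qed.
Let b1 : 2^-1 < b. Proof. by move: s0; rewrite /b => *; lra. Qed.
Let N0 : 0 < N. Proof. exact: radial_mass_gt0. Qed.
Let Nn0 : N != 0. Proof. by rewrite gt_eqF. Qed.

(** Close to x use the continuity of g; away from x the kernel at height y is at
    most a constant times the kernel at height 1, and the factor y^(2s) tends
    to 0. *)
Lemma Uext_cvg x : Uext s g x y @[y --> 0^'+] --> g x.
Proof.
apply/cvgrPdist_le => /= e e0.
have M0 : 0 <= M by apply: le_trans (gM 0).
have e2 : 0 < e / 2 by lra.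
have gx : g z @[z --> x] --> g x by exact: cg.
have /cvgrPdist_le /(_ _ e2) [d /= d0 hd] := gx.
(* (x - z)^2 + 1 <= c ((x - z)^2 + y^2) when |x - z| >= d *)
pose c := 1 + (d ^+ 2)^-1.
have d2 : 0 < d ^+ 2 by rewrite exprn_gt0.
have c0 : 0 < c by rewrite addr_gt0// invr_gt0.
have key y z : 0 < y -> y <= 1 ->
    `|radial b (x - z) y * (g x - g z)| <=
    e / 2 * radial b (x - z) y + 2 * M * c `^ b * radial b (x - z) 1.
  move=> y0 y1; rewrite normrM (ger0_norm (radial_ge0 _ _ _)).
  have [xz|xz] := ltP `|x - z| d.
    apply: (@le_trans _ _ (e / 2 * radial b (x - z) y)).
      by rewrite mulrC ler_wpM2r ?radial_ge0//; apply: hd.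
    by rewrite lerDl mulr_ge0 ?radial_ge0// mulr_ge0 ?powR_ge0// mulr_ge0.
  apply: (@le_trans _ _ (2 * M * (c `^ b * radial b (x - z) 1))); last first.
    by rewrite mulrA lerDr mulr_ge0 ?radial_ge0// ltW.
  rewrite mulrC ler_pM ?radial_ge0//.
    by rewrite (le_trans (ler_normB _ _))// mulr_natl mulr2n lerD.
  apply: powRN_compare => //; rewrite ?sqD_gt0//.
  have h : d ^+ 2 <= (x - z) ^+ 2.
    rewrite -(@real_normK _ (x - z)) ?num_real// lerXn2r ?nnegrE//; exact: ltW.
  have h1 : 1 <= (d ^+ 2)^-1 * (x - z) ^+ 2 by rewrite ler_pdivlMl// mulr1.
  have y2 := sqr_ge0 y; rewrite /c expr1n.
  have : 0 <= (d ^+ 2)^-1 * y ^+ 2 by rewrite mulr_ge0// invr_ge0 ltW.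
  by lra.
have main y : 0 < y -> y <= 1 ->
    `|g x - Uext s g x y| <= e / 2 + 2 * M * c `^ b * y `^ (2 * s).
  move=> y0 y1.
  have i1 := integ_radial x b1 y0.
  have i2 := integ_radial x b1 (@ltr01 R).
  have i3 := integ_rconv0 cg gM x b1 y0.
  have pN : N^-1 * y `^ (2 * s) * (N * y `^ (1 - 2 * b)) = 1.
    transitivity (y `^ (2 * s) * y `^ (1 - 2 * b)); first by field.
    by rewrite powRMD// -[RHS](powRr0 y); congr (_ `^ _); rewrite /b; field.
  have -> : g x - Uext s g x y =
      N^-1 * y `^ (2 * s) * \int[mu]_z (radial b (x - z) y * (g x - g z)).
    transitivity (N^-1 * y `^ (2 * s) * \int[mu]_z (g x * radial b (x - z) y - radial b (x - z) y * g z)).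
      rewrite (@RintegralB _ _ _ mu)//; last exact: integZ.
      rewrite (@RintegralZl _ _ _ mu)// (int_radial_sub x b1 y0) -/N mulrBr.
      by rewrite mulrCA pN mulr1.
    by congr (_ * _); apply: eq_Rintegral => z _; ring.
  have p0 : 0 <= N^-1 * y `^ (2 * s) by rewrite mulr_ge0 ?powR_ge0// invr_ge0 ltW.
  rewrite normrM (ger0_norm p0).
  apply: (@le_trans _ _ (N^-1 * y `^ (2 * s) * \int[mu]_z
     (e / 2 * radial b (x - z) y + 2 * M * c `^ b * radial b (x - z) 1))).
    apply: ler_wpM2l => //; apply: normInt => //.
    - apply: measurable_funM; first exact: meas_radial.
      apply: measurable_funB => //.
      exact: continuous_measurable_fun.
    - by apply: integD => //; exact: integZ.
    - by move=> z _; exact: key.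
  rewrite (@RintegralD _ _ _ mu)//; [|exact: integZ..].
  rewrite !(@RintegralZl _ _ _ mu)// !int_radial_sub// -/N powR1 mulr1 mulrDr.
  apply: lerD; last by apply: eqW; field.
  apply: eqW; transitivity (e / 2 * (N^-1 * y `^ (2 * s) * (N * y `^ (1 - 2 * b)))).
    by ring.
  by rewrite pN mulr1.
have c1 : 0 < 2 * M * c `^ b + 1.
  by rewrite ltr_wpDl// mulr_ge0 ?powR_ge0// mulr_ge0.
have lim : y `^ (2 * s) @[y --> 0^'+] --> (0 : R).
  have s20 : 0 < 2 * s by rewrite mulr_gt0.
  exact: powR_cvg0 s20.
have e4 : 0 < e / 2 / (2 * M * c `^ b + 1) by rewrite divr_gt0.
near=> y.
have y0 : 0 < y by near: y; exact: nbhs_right_gt.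
have y1 : y <= 1 by near: y; exact: nbhs_right_le.
apply: le_trans (main y y0 y1) _.
have : y `^ (2 * s) <= e / 2 / (2 * M * c `^ b + 1).
  by near: y; exact: (cvgr_le _ lim _ e4).
rewrite ler_pdivlMr// => h.
have : 0 <= y `^ (2 * s) by exact: powR_ge0.
by lra.
Unshelve. all: by end_near. Qed.

(** The normalization at the single height 1 determines C. *)
Lemma poisson_Uext C U : poisson_normalized C s -> is_s_harmonic_extension C s g U ->
  forall x y, 0 < y -> U x y = Uext s g x y.
Proof.
move=> hC [hU _] x y y0.
have bE : (1 + 2 * s) / 2 = b by rewrite /b; field.
have pk (z t : R) : poisson_kernel C s z t = C * t `^ (2 * s) * radial b z t.
  by rewrite /poisson_kernel bE /radial powRN; ring.
have CN : C * N = 1.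
  have := hC 1 ltr01.
  have -> : (\int[mu]_z (poisson_kernel C s z 1)%:E = \int[mu]_z (C * radial b z 1)%:E)%E.
    by apply: eq_integral => z _; rewrite pk powR1 mulr1.
  move=> h; have := @RintegralZl _ _ _ mu setT (fun r => radial b r 1) C measurableT (integ_radial1 b1).
  by rewrite -/(radial_mass b) -/N => <-; rewrite /Rintegral h.
rewrite (hU _ _ y0) /Uext -/b -/N.
have CE : C = N^-1 by rewrite -[LHS]mulr1 -(mulfV Nn0) mulrA CN mul1r.
rewrite /rconv0 -(@RintegralZl _ _ _ mu)//; last exact: (integ_rconv0 cg gM).
by apply: eq_Rintegral => z _; rewrite pk CE; ring.
Qed.

End boundary.

(** * Fourier coefficients on horizontal lines *)

Section coefficients.
Variable R : realType.
Local Notation mu := (@lebesgue_measure R).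
Variables (a K T w : R) (U X Z S A : R -> R -> R) (g : R -> R).
Hypothesis (hwh : weighted_harmonic a U X Z S A) (hsb : scale_bounds a K U X Z S A).
Hypothesis (a1 : a < 1) (T0 : 0 < T) (cT : cos (w * T) = 1) (sT : sin (w * T) = 0).
Hypothesis XT : forall x y : R, 0 < y -> X (x + T) y = X x y.
Implicit Types (x y z t p : R).

Definition coef (V : R -> R -> R) y := \int[mu]_(x in `[0, T]) (V x y * cos (w * x)).

Lemma powR_le_base p x y : p <= 0 -> 0 < x -> x <= y -> y `^ p <= x `^ p.
Proof.
move=> p0 x0 xy; have := @powRN_compare R (- p) x y 1; rewrite opprK powR1 mul1r mul1r; apply => //.
- by rewrite oppr_ge0.
- exact: lt_le_trans xy.
Qed.

Lemma cont_x (V : R -> R -> R) (dV : R -> R) y : (forall x, is_derive x 1 (V ^~ y) (dV x)) -> continuous (V ^~ y).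
Proof. by move=> dV1 x; exact: (der_cont (dV1 x)). Qed.

Let cU y : 0 < y -> continuous (U ^~ y).
Proof. by move=> y0; apply: (@cont_x _ (X ^~ y)) => x; exact: (wh_Ux hwh). Qed.
Let cZ y : 0 < y -> continuous (Z ^~ y).
Proof. by move=> y0; apply: (@cont_x _ (S ^~ y)) => x; exact: (wh_Zx hwh). Qed.
Let cX y : 0 < y -> continuous (X ^~ y).
Proof. by move=> y0; apply: (@cont_x _ (A ^~ y)) => x; exact: (wh_Xx hwh). Qed.

Lemma integ_cos (V : R -> R) : continuous V -> integ `[0, T] (fun x => V x * cos (w * x)).
Proof.
move=> cV; apply: integ_cont => x; apply: cvgM; first exact: cV.
exact: continuous_cosM.
Qed.

Lemma cos_le p x : `|p * cos (w * x)| <= `|p|.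
Proof. by rewrite normrM ler_piMr// cos_max. Qed.

Lemma der_cos x : is_derive x 1 (fun x => cos (w * x)) (- w * sin (w * x)).
Proof.
have h : is_derive (w * x) 1 (@cos R) (- sin (w * x)) by exact: is_derive_cos.
by apply: der_eq (der_comp (der_scal w (der_id x)) h) _; ring.
Qed.

Lemma der_sin x : is_derive x 1 (fun x => sin (w * x)) (w * cos (w * x)).
Proof.
have h : is_derive (w * x) 1 (@sin R) (cos (w * x)) by exact: is_derive_sin.
by apply: der_eq (der_comp (der_scal w (der_id x)) h) _; ring.
Qed.

Lemma sqD_pow y : 0 < y -> y `^ (- a) * (K * y `^ (a - 1)) = K * y `^ (-1).
Proof. by move=> y0; rewrite mulrCA powRMD//; congr (_ * _ `^ _); ring. Qed.

Let K0 : 0 <= K.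
Proof. by apply: le_trans (sb_U hsb 0 (@ltr01 R)). Qed.

Lemma coef_der y : 0 < y -> is_derive y 1 (coef U) (y `^ (- a) * coef Z y).
Proof.
move=> y0; have y2 : 0 < y / 2 by lra.
rewrite /coef -(@RintegralZl _ _ _ mu)//; last exact/integ_cos/cZ.
apply: (@Int_derive R `[0, T]%classic (fun y x => U x y * cos (w * x))
  (fun y x => y `^ (- a) * (Z x y * cos (w * x))) (cst (K * (y / 2) `^ (-1))) y (y / 2)) => //.
- move=> t x; rewrite ltr_distl => /andP[t0 _] _; have tp : 0 < t by lra.
  by apply: der_eq (der_mul (wh_Uy hwh x tp) (der_cst (cos (w * x)) t)) _; ring.
- by move=> t; rewrite ltr_distl => /andP[t0 _]; apply/integ_cos/cU; lra.
- by apply: integ_cont; exact: cst_continuous.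
- move=> t x; rewrite ltr_distl => /andP[t0 _] _; have tp : 0 < t by lra.
  rewrite mulrA; apply: le_trans (cos_le _ _) _; rewrite normrM (ger0_norm (powR_ge0 _ _)).
  apply: le_trans (ler_wpM2l (powR_ge0 _ _) (sb_Z hsb x tp)) _.
  rewrite sqD_pow//; apply: ler_wpM2l => //.
  by apply: powR_le_base; lra.
Qed.

(** Integrating by parts twice over a period: the boundary terms cancel since w T
    is a multiple of 2 pi. *)
Lemma int_Uxx_cos y : 0 < y ->
  \int[mu]_(x in `[0, T]) (A x y * cos (w * x)) = - (w ^+ 2) * coef U y.
Proof.
move=> y0.
have csin : continuous (fun x : R => sin (w * x)) by move=> x; exact: (der_cont (der_sin x)).
have ccos : continuous (fun x : R => cos (w * x)) by exact: continuous_cosM.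
have per (V : R -> R -> R) : (forall x y : R, 0 < y -> V (x + T) y = V x y) -> V T y = V 0 y.
  by move=> h; rewrite -[T]add0r h.
have [d1 e1] := derivable_LR T0 (fun x _ => der_cos x).
have [d2 e2] := derivable_LR T0 (fun x _ => wh_Xx hwh x y0).
have [d3 e3] := derivable_LR T0 (fun x _ => der_sin x).
have [d4 e4] := derivable_LR T0 (fun x _ => wh_Ux hwh x y0).
have c1 : continuous (fun x : R => - w * sin (w * x)).
  by move=> x; apply: cvgMr; exact: csin.
have c3 : continuous (fun x : R => w * cos (w * x)).
  by move=> x; apply: cvgMr; exact: ccos.
have h1 := @Rintegration_by_parts R _ _ _ _ 0 T T0 (continuous_subspaceT c1) d1 e1
  (continuous_subspaceT (wh_Ax hwh y0)) d2 e2.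
have h2 := @Rintegration_by_parts R _ _ _ _ 0 T T0 (continuous_subspaceT c3) d3 e3
  (continuous_subspaceT (cX y0)) d4 e4.
rewrite (_ : \int[mu]_(x in `[0, T]) (A x y * cos (w * x)) =
  \int[mu]_(x in `[0, T]) (cos (w * x) * A x y)); last first.
  by apply: eq_Rintegral => x _; rewrite mulrC.
rewrite h1 cT mulr0 cos0 (per _ XT) subrr sub0r.
have -> : \int[mu]_(x in `[0, T]) (- w * sin (w * x) * X x y) =
    - w * \int[mu]_(x in `[0, T]) (sin (w * x) * X x y).
  rewrite -(@RintegralZl _ _ _ mu)//.
    by apply: eq_Rintegral => x _; rewrite mulrA.
  by apply: integ_cont => x; apply: cvgM; [exact: csin|exact: cX].
rewrite h2 sT mulr0 sin0 !mul0r subrr sub0r.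
have -> : \int[mu]_(x in `[0, T]) (w * cos (w * x) * U x y) = w * coef U y.
  rewrite /coef -(@RintegralZl _ _ _ mu)//; last exact/integ_cos/cU.
  by apply: eq_Rintegral => x _; ring.
by ring.
Qed.

Lemma coef_derZ y : 0 < y ->
  is_derive y 1 (coef Z) (w ^+ 2 * (y `^ a * coef U y)).
Proof.
move=> y0; have y2 : 0 < y / 2 by lra.
have -> : w ^+ 2 * (y `^ a * coef U y) = - y `^ a * \int[mu]_(x in `[0, T]) (A x y * cos (w * x)).
  by rewrite int_Uxx_cos//; ring.
rewrite -(@RintegralZl _ _ _ mu)//; last exact/integ_cos/(wh_Ax hwh).
apply: (@Int_derive R `[0, T]%classic (fun y x => Z x y * cos (w * x))
  (fun y x => - y `^ a * (A x y * cos (w * x))) (cst (K * (y / 2) `^ (a - 2))) y (y / 2)) => //.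
- move=> t x; rewrite ltr_distl => /andP[t0 _] _; have tp : 0 < t by lra.
  by apply: der_eq (der_mul (wh_Zy hwh x tp) (der_cst (cos (w * x)) t)) _; ring.
- by move=> t; rewrite ltr_distl => /andP[t0 _]; apply/integ_cos/cZ; lra.
- by apply: integ_cont; exact: cst_continuous.
- move=> t x; rewrite ltr_distl => /andP[t0 _] _; have tp : 0 < t by lra.
  rewrite mulrA; apply: le_trans (cos_le _ _) _.
  rewrite mulNr normrN normrM (ger0_norm (powR_ge0 _ _)).
  apply: le_trans (ler_wpM2l (powR_ge0 _ _) (sb_A hsb x tp)) _.
  rewrite mulrCA powRMD// ler_wpM2l//.
  by move: a1 => h; apply: powR_le_base; lra.
Qed.

Lemma coef_bound (V : R -> R -> R) y L : continuous (V ^~ y) ->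
  (forall x, `|V x y| <= L) -> `|coef V y| <= L * T.
Proof.
move=> cV VL.
have -> : L * T = \int[mu]_(x in `[0, T]) L.
  rewrite (@Rintegral_cst _ _ _ mu)//; congr (L * _).
  have := @lebesgue_measure_itv R `[0, T]; rewrite /= lte_fin T0 sube0 => muE.
  by rewrite -[mu _]/(mu `[0, T]%classic) muE.
apply: normInt => //.
- apply: measurable_funTS; apply: continuous_measurable_fun => x.
  by apply: cvgM; [exact: cV|exact: continuous_cosM].
- by apply: integ_cont; exact: cst_continuous.
- by move=> x _; apply: le_trans (cos_le _ _) _.
Qed.

Lemma coefU_bound y : 0 < y -> `|coef U y| <= K * T.
Proof. by move=> y0; apply: coef_bound => [|x]; [exact: cU|exact: (sb_U hsb)]. Qed.

Lemma coefZ_bound y : 1 <= y -> `|coef Z y| <= K * T.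
Proof.
move=> y1; have y0 : 0 < y by lra.
apply: coef_bound => [|x]; first exact: cZ.
apply: le_trans (sb_Z hsb x y0) _; rewrite -[leRHS]mulr1 ler_wpM2l//.
have e : 1 `^ (a - 1) = 1 :> R by rewrite powR1.
by rewrite -[leRHS]e; move: a1 => h; apply: powR_le_base => //; lra.
Qed.

Hypothesis cg : continuous g.
Hypothesis Ug : forall x, U x y @[y --> 0^'+] --> g x.

(** By dominated convergence, since U is bounded. *)
Lemma coef_cvg : coef U y @[y --> 0^'+] -->
  \int[mu]_(x in `[0, T]) (g x * cos (w * x)).
Proof.
apply/cvg_at_rightP => u [u0 u_cvg].
have ic c : integ `[0, T] (cst c) by apply: integ_cont; exact: cst_continuous.
have := @dominated_cvg _ _ _ mu `[0, T]%classic (measurable_itv _)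
  (fun n x => (U x (u n) * cos (w * x))%:E) (fun x => (g x * cos (w * x))%:E) (cst K%:E).
move=> h; apply: (@fine_cvg _ _ _ _ (fun n => \int[mu]_(x in `[0%R, T]) (U x (u n) * cos (w * x))%:E)%E).
rewrite /Rintegral fineK; last first.
  by apply: (@integrable_fin_num _ _ _ mu) => //; exact: integ_cos.
apply: h.
- move=> n; apply/measurable_EFinP; apply: measurable_funTS.
  apply: continuous_measurable_fun => x.
  by apply: cvgM; [exact: (cU (u0 n))|exact: continuous_cosM].
- move=> x _; apply: cvg_EFin; first exact: nearW.
  have Ugx : U x y @[y --> 0^'+] --> g x := @Ug x.
  by apply: cvgMl; move/cvg_at_rightP : Ugx; apply; split.
- by [].
- exact: ic.
- move=> n x _ /=; rewrite lee_fin; apply: le_trans (cos_le _ _) _.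
  exact: (sb_U hsb).
Qed.

End coefficients.

(** * The conjugate of the extension is an extension *)

Section profiles.
Variable R : realType.
Local Notation mu := (@lebesgue_measure R).
Implicit Types (a s p K M l lam w T x y t : R) (u f g phi chi psi theta : R -> R).

(** A bounded solution (phi, chi) of the system of ode_unique at frequency 1: chi
    is the conjugate of phi. *)
Record profile a p K phi chi : Prop := Profile {
  pr_phi : forall y : R, 0 < y -> is_derive y 1 phi (y `^ (- a) * chi y);
  pr_chi : forall y : R, 0 < y -> is_derive y 1 chi (y `^ a * phi y);
  pr_bphi : forall y : R, 0 < y -> `|phi y| <= K;
  pr_bchi : forall y : R, 1 <= y -> `|chi y| <= K;
  pr_lim : phi y @[y --> 0^'+] --> p }.

(** The value at 0 of the profiles built below, which come from the datum cos with
    period 2 pi. *)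
Definition cos_energy : R := \int[mu]_(x in `[0, 2 * pi]) (cos x * cos (1 * x)).

Lemma cos_energy_gt0 : 0 < cos_energy.
Proof.
have c : continuous (fun x : R => cos x * cos (1 * x)).
  by move=> x; apply: cvgM; [exact: continuous_cos|exact: continuous_cosM].
have ge (x : R) : 0 <= cos x * cos (1 * x) by rewrite mul1r -expr2 sqr_ge0.
rewrite lt_neqAle; apply/andP; split; last by apply: Rintegral_ge0 => x _.
apply/eqP => /esym e.
have pi0 := pi_gt0 R.
have := @Int_eq0 R `[0, 2 * pi]%classic _ pi (measurable_itv _) _ (@integ_cont R 0 (2 * pi) _ c)
  (fun x _ => ge x) (c pi) e.
rewrite mul1r cospi => h.
suff : (-1 : R) * -1 = 0 by move=> ?; lra.
apply: h; exists pi => // z; rewrite /ball_/= ltr_distlC => /andP[h1 h2].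
by rewrite in_itv/=; apply/andP; split; lra.
Qed.

(** The system of the Fourier coefficients of U and Z at frequency w, in the form
    required by ode_unique. *)
Lemma ext_coef s g M T w : 0 < s < 1 -> continuous g -> (forall x, `|g x| <= M) ->
  (forall x, g (- x) = g x) -> (forall x, g (x + T) = g x) -> 0 < T ->
  cos (w * T) = 1 -> sin (w * T) = 0 ->
  let P := coef T w (Uext s g) in let Q := coef T w (Zext s g) in
  exists K, [/\ forall y : R, 0 < y -> is_derive y 1 P (y `^ (- (1 - 2 * s)) * Q y),
     forall y : R, 0 < y -> is_derive y 1 Q (w ^+ 2 * (y `^ (1 - 2 * s) * P y)),
     forall y : R, 0 < y -> `|P y| <= K,
     forall y : R, 1 <= y -> `|Q y| <= K &
     P y @[y --> 0^'+] --> \int[mu]_(x in `[0, T]) (g x * cos (w * x))].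
Proof.
move=> hs cg gM ge gT T0 cT sT P Q.
have wh := ext_weighted_harmonic hs cg gM.
have [K K0 sb] := ext_scale_bounds hs cg gM.
have [UT ZT Ue Ze XT] := ext_symmetries hs cg gM ge gT.
have a1 : 1 - 2 * s < 1 by case/andP: hs => *; lra.
have XT' (x y : R) : 0 < y -> Xext s g (x + T) y = Xext s g x y by move=> y0; case: (XT x y y0).
exists (K * T); split.
- by move=> y y0; exact: (@coef_der _ _ _ T w _ _ _ _ _ wh sb).
- by move=> y y0; exact: (coef_derZ wh sb a1 T0 cT sT XT').
- by move=> y y0; exact: (@coefU_bound _ _ _ T w _ _ _ _ _ wh sb T0).
- by move=> y y0; exact: (@coefZ_bound _ _ _ T w _ _ _ _ _ wh sb a1 T0).
- by apply: (@coef_cvg _ _ _ T w _ _ _ _ _ _ wh sb cg) => x; exact: (@Uext_cvg _ _ _ _ hs cg gM).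
Qed.

(** The extension of cos is cos times a function of y, which is the profile. *)
Lemma profile_exists s : 0 < s < 1 ->
  exists K phi chi, profile (1 - 2 * s) cos_energy K phi chi.
Proof.
move=> hs; have T0 : 0 < 2 * pi :> R by rewrite mulr_gt0// pi_gt0.
have cT : cos (1 * (2 * pi)) = 1 :> R by rewrite mul1r mulr_natl cos2pi.
have sT : sin (1 * (2 * pi)) = 0 :> R by rewrite mul1r mulr_natl sin2pi.
have per (x : R) : cos (x + 2 * pi) = cos x by rewrite mulr_natl cosD2pi.
have [K [h1 h2 h3 h4 h5]] := ext_coef hs (@continuous_cos R) (@cos_max R) (@cosN R) per T0 cT sT.
exists K, (coef (2 * pi) 1 (Uext s cos)), (coef (2 * pi) 1 (Zext s cos)); split=> //.
by move=> y y0; apply: der_eq (h2 y y0) _; rewrite expr1n mul1r.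
Qed.

(** Near 0 phi is positive, so chi increases there, and it is bounded below since
    chi - K y^(a+1) / (a+1) decreases. *)
Lemma profile_chi_cvg a p K phi chi : -1 < a < 1 -> 0 < p ->
  profile a p K phi chi -> exists l, chi y @[y --> 0^'+] --> l.
Proof.
move=> /andP[a1 a2] p0 [h1 h2 h3 _ h5].
have [r /= r0 hr] : \forall y \near 0^'+, 0 < phi y by exact: (cvgr_gt _ h5 _ p0).
have pos y : 0 < y -> y < r -> 0 < phi y.
  by move=> y0 yr; apply: hr => //=; rewrite sub0r normrN ger0_norm// ltW.
pose d := r / 2; have [d0 dr] : 0 < d /\ d < r by rewrite /d; split; lra.
have K0 : 0 <= K by apply: le_trans (h3 1 _).
have a10 : 0 < a + 1 by lra.
have mono x y : 0 < x -> x <= y -> y < r -> chi x <= chi y.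
  move=> x0 xy yr; rewrite -subr_ge0.
  have [z /andP[xz _]|z /andP[xz zy] ->] := @MVT_le R chi (fun y => y `^ a * phi y) x y xy.
    by apply: h2; exact: lt_le_trans xz.
  rewrite mulr_ge0 ?subr_ge0// mulr_ge0 ?powR_ge0// ltW// pos//.
    exact: lt_le_trans xz.
  exact: le_lt_trans yr.
have low x : 0 < x -> x <= d -> chi d - K * ((a + 1)^-1 * d `^ (a + 1)) <= chi x.
  move=> x0 xd.
  have : chi d - K * ((a + 1)^-1 * d `^ (a + 1)) <= chi x - K * ((a + 1)^-1 * x `^ (a + 1)).
    apply: (@derive_le0_ge R (fun y => chi y - K * ((a + 1)^-1 * y `^ (a + 1)))
      (fun y => y `^ a * phi y - K * y `^ a) 0) => //.
      move=> y y0; apply: der_sub; first exact: h2.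
      by apply: der_scal; apply: der_powR_prim => //; rewrite gt_eqF.
    move=> y y0; rewrite mulrC -mulrBl mulr_le0_ge0 ?powR_ge0// subr_le0.
    by apply: le_trans (h3 _ y0); exact: ler_norm.
  have : 0 <= K * ((a + 1)^-1 * x `^ (a + 1)).
    by rewrite mulr_ge0// mulr_ge0 ?powR_ge0// invr_ge0 ltW.
  lra.
exists (inf [set chi x | x in `]0, d[]).
apply: nondecreasing_at_right_cvgr; first by rewrite bnd_simp.
- move=> x y; rewrite !in_itv/= => /andP[x0 xd] /andP[y0 yd] xy.
  by apply: mono => //; exact: lt_trans dr.
- exists (chi d - K * ((a + 1)^-1 * d `^ (a + 1))) => z [x].
  by rewrite /= in_itv/= => /andP[x0 xd] <-; apply: low => //; exact: ltW.
Qed.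

(** The conjugate of the profile for s solves the equation of the profile for
    1 - s. *)
Lemma profile_conjugate a p K L phi chi psi theta : -1 < a < 1 -> 0 < p ->
  profile a p K phi chi -> profile (- a) p L psi theta ->
  exists lam, forall y, 0 < y -> chi y = lam * psi y.
Proof.
move=> ha p0 pr1 pr2; have [l hl] := profile_chi_cvg ha p0 pr1.
exists (l / p) => y y0.
have ha' : -1 < - a < 1 by case/andP: ha => *; apply/andP; split; lra.
case: pr1 pr2 => h1 h2 _ h3 h4 [k1 k2 k3 _ k5].
have [] := @ode_unique R (- a) 1 (fun y => chi y - l / p * psi y)
  (fun y => phi y - l / p * theta y) (K + `|l / p| * L) ha' _ _ _ _ y y0.
- move=> t t0; apply: der_eq (der_sub (h2 t t0) (der_scal _ (k1 t t0))) _.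
  by rewrite opprK; ring.
- move=> t t0; apply: der_eq (der_sub (h1 t t0) (der_scal _ (k2 t t0))) _.
  by ring.
- move=> t t1; apply: le_trans (ler_normB _ _) _; apply: lerD; first exact: h3.
  by rewrite normrM ler_wpM2l// k3//; lra.
- rewrite [X in _ --> X](_ : _ = l - l / p * p); last by rewrite divfK ?subrr// gt_eqF.
  by apply: cvgB; [exact: hl|apply: cvgMr; exact: k5].
- by move=> h _; lra.
Qed.

(** Rescaling the profile by w solves the system at frequency w; the factor
    w^(2s) comes from the powers of y in it and is the symbol of (-d_xx)^s. *)
Lemma coef_profile s g M T w K phi chi : 0 < s < 1 -> continuous g ->
  (forall x, `|g x| <= M) ->
  (forall x, g (- x) = g x) -> (forall x, g (x + T) = g x) -> 0 < T ->
  cos (w * T) = 1 -> sin (w * T) = 0 -> 0 < w ->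
  profile (1 - 2 * s) cos_energy K phi chi ->
  let c := \int[mu]_(x in `[0, T]) (g x * cos (w * x)) in
  forall y, 0 < y -> coef T w (Uext s g) y = c / cos_energy * phi (w * y) /\
    coef T w (Zext s g) y = c / cos_energy * w `^ (2 * s) * chi (w * y).
Proof.
move=> hs cg gM ge gT T0 cT sT w0 [k1 k2 k3 k4 k5] c y y0.
have p0 := cos_energy_gt0; set p := cos_energy in p0 k5 *.
have [L [h1 h2 h3 h4 h5]] := ext_coef hs cg gM ge gT T0 cT sT.
set a := 1 - 2 * s in k1 k2 h1 h2.
have ha : -1 < a < 1 by rewrite /a; case/andP: hs => *; apply/andP; split; lra.
have ws : w `^ (2 * s) = w * w `^ (- a).
  by rewrite /a opprB -mulr_powRB1 ?(ltW w0)//; case/andP: hs => *; lra.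
have wsa : w `^ (2 * s) * w `^ a = w.
  by rewrite powRMD// /a subrKC powRr1// ltW.
have [] := @ode_unique R a w
  (fun y => coef T w (Uext s g) y - c / p * phi (w * y))
  (fun y => coef T w (Zext s g) y - c / p * w `^ (2 * s) * chi (w * y))
  (L + `|c / p| * K) ha _ _ _ _ y y0.
- move=> t t0; have wt : 0 < w * t by rewrite mulr_gt0.
  apply: der_eq (der_sub (h1 t t0) (der_scal (c / p)
    (der_comp (der_scal w (der_id t)) (k1 _ wt)))) _.
  by rewrite powRM ?(ltW w0) ?(ltW t0)// ws; ring.
- move=> t t0; have wt : 0 < w * t by rewrite mulr_gt0.
  apply: der_eq (der_sub (h2 t t0) (der_scal (c / p * w `^ (2 * s))
    (der_comp (der_scal w (der_id t)) (k2 _ wt)))) _.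
  rewrite powRM ?(ltW w0) ?(ltW t0)//.
  transitivity (w ^+ 2 * (t `^ a * coef T w (Uext s g) t) -
    c / p * (w `^ (2 * s) * w `^ a) * w * t `^ a * phi (w * t)); first by ring.
  by rewrite wsa; ring.
- move=> t t1; apply: le_trans (ler_normB _ _) _; apply: lerD.
    by apply: h3; lra.
  by rewrite normrM ler_wpM2l// k3// mulr_gt0//; lra.
- rewrite [X in _ --> X](_ : _ = c - c / p * p); last by rewrite divfK ?subrr// gt_eqF.
  apply: cvgB; first exact: h5.
  apply: cvgMr.
  apply/cvg_at_rightP => v [v0 v_cvg]; move/cvg_at_rightP : k5; apply; split.
    by move=> n; rewrite mulr_gt0.
  by rewrite -(mulr0 w); apply: cvgMr; exact: v_cvg.
- by move=> e1 e2; split; lra.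
Qed.

(** At frequency 0 the coefficient of Z is constant, and boundedness of the
    coefficient of U forces it to vanish. *)
Lemma coef_zero s g M T : 0 < s < 1 -> continuous g ->
  (forall x, `|g x| <= M) ->
  (forall x, g (- x) = g x) -> (forall x, g (x + T) = g x) -> 0 < T ->
  let c := \int[mu]_(x in `[0, T]) (g x * cos (0 * x)) in
  forall y, 0 < y -> coef T 0 (Uext s g) y = c /\ coef T 0 (Zext s g) y = 0.
Proof.
move=> hs cg gM ge gT T0 c y y0.
have cT : cos (0 * T) = 1 by rewrite mul0r cos0.
have sT : sin (0 * T) = 0 by rewrite mul0r sin0.
have [L [h1 h2 h3 h4 h5]] := ext_coef hs cg gM ge gT T0 cT sT.
set a := 1 - 2 * s in h1 h2.
have ha : -1 < a < 1 by rewrite /a; case/andP: hs => *; apply/andP; split; lra.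
have [] := @ode_unique R a 0 (fun y => coef T 0 (Uext s g) y - c)
  (coef T 0 (Zext s g)) (L + `|c|) ha _ _ _ _ y y0.
- by move=> t t0; apply: der_eq (der_sub (h1 t t0) (der_cst c t)) _; rewrite subr0.
- by move=> t t0; apply: der_eq (h2 t t0) _; rewrite expr0n/= !mul0r.
- move=> t t1; apply: le_trans (ler_normB _ _) _; rewrite lerD2r.
  by apply: h3; lra.
- by rewrite -[X in _ --> X](subrr c); apply: cvgB; [exact: h5|exact: cvg_cst].
- by move=> e1 e2; split=> //; lra.
Qed.

(** The conjugate of the extension of u is, up to a factor, the extension of
    (-d_xx)^s u for the exponent 1 - s: both have the same Fourier coefficients
    on every horizontal line. *)
Lemma conjugate_extension s T u f M (N : R) : 0 < s < 1 -> 0 < T ->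
  continuous u -> continuous f ->
  (forall x, `|u x| <= M) -> (forall x, `|f x| <= N) ->
  (forall x, u (- x) = u x) -> (forall x, f (- x) = f x) ->
  (forall x, u (x + T) = u x) -> (forall x, f (x + T) = f x) ->
  is_fracLap s T u f ->
  exists lam, forall x y : R, 0 < y -> Zext s u x y = lam * Uext (1 - s) f x y.
Proof.
move=> hs T0 cu cf uM fN ue fe uT fT hlap.
have hs' : 0 < 1 - s < 1 by case/andP: hs => *; apply/andP; split; lra.
have [K [phi [chi pr1]]] := profile_exists hs.
have [L [psi [theta pr2]]] := profile_exists hs'.
have ha : -1 < 1 - 2 * s < 1 by case/andP: hs => *; apply/andP; split; lra.
have aE : 1 - 2 * (1 - s) = - (1 - 2 * s) by ring.
have pr3 : profile (- (1 - 2 * s)) cos_energy L psi theta by rewrite -aE.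
have [lam hlam] := profile_conjugate ha cos_energy_gt0 pr1 pr3.
exists lam => x y y0; apply/eqP; rewrite -subr_eq0; apply/eqP; move: x.
have wh1 := ext_weighted_harmonic hs cu uM; have wh2 := ext_weighted_harmonic hs' cf fN.
have [_ ZT _ Ze _] := ext_symmetries hs cu uM ue uT.
have [VT _ Ve _ _] := ext_symmetries hs' cf fN fe fT.
have cZ : continuous (Zext s u ^~ y).
  by move=> x; exact: (der_cont (wh_Zx wh1 x y0)).
have cV : continuous (Uext (1 - s) f ^~ y).
  by move=> x; exact: (der_cont (wh_Ux wh2 x y0)).
apply: (@fourier_even_zero R T (fun x => Zext s u x y - lam * Uext (1 - s) f x y) T0).
- by move=> x; apply: cvgB; [exact: cZ|apply: cvgMr; exact: cV].
- by move=> x; rewrite (Ze x y y0) (Ve x y y0).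
- by move=> x; rewrite (ZT x y y0) (VT x y y0).
move=> k; set w := frequency T k.
have i1 : integ `[0, T] (fun x => Zext s u x y * cos (w * x)) by exact: integ_cos.
have i2 : integ `[0, T] (fun x => Uext (1 - s) f x y * cos (w * x)) by exact: integ_cos.
transitivity (coef T w (Zext s u) y - lam * coef T w (Uext (1 - s) f) y).
  rewrite /coef -(@RintegralZl _ _ _ mu)// -(@RintegralB _ _ _ mu)//; last exact: integZ.
  by apply: eq_Rintegral => x _; ring.
have [cE _] := hlap k; rewrite /cos_coef -/w in cE.
have [k0|k0] := posnP k.
  have w0 : w = 0 by rewrite /w k0 /frequency mulr0 mul0r.
  have s2 : 2 * s != 0 by rewrite gt_eqF// mulr_gt0//; case/andP: hs.
  rewrite w0 in cE *; rewrite powR0// mul0r in cE.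
  have [_ ->] := coef_zero hs cu uM ue uT T0 y0.
  by have [-> _] := coef_zero hs' cf fN fe fT T0 y0; rewrite cE mulr0 subr0.
have w0 : 0 < w.
  by rewrite /w /frequency divr_gt0// mulr_gt0 ?ltr0n// mulr_gt0// pi_gt0.
have wT : w * T = (pi *+ 2) *+ k.
  by rewrite /w /frequency divfK ?gt_eqF// mulr_natr mulr_natl.
have cT : cos (w * T) = 1.
  by have := periodicn (@cosD2pi R) k 0; rewrite add0r cos0 wT.
have sT : sin (w * T) = 0.
  by have := periodicn (@sinD2pi R) k 0; rewrite add0r sin0 wT.
have [_ ->] := coef_profile hs cu uM ue uT T0 cT sT w0 pr1 y0.
have [-> _] := coef_profile hs' cf fN fe fT T0 cT sT w0 pr2 y0.
have wy : 0 < w * y by exact: mulr_gt0.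
by rewrite cE (hlam _ wy); ring.
Qed.

End profiles.

(** * The tail of the energy *)

Section first_integral.
Variable R : realType.
Local Notation mu := (@lebesgue_measure R).
Variables (a K : R) (U X Z S A : R -> R -> R).
Hypothesis (hwh : weighted_harmonic a U X Z S A) (hsb : scale_bounds a K U X Z S A).
Hypothesis (ha : -1 < a < 1).
Implicit Types (x y z t p : R).

(** (U_x^2 - U_y^2) y^a in terms of X and Z = y^a U_y. *)
Definition energy_density x y := y `^ a * X x y ^+ 2 - y `^ (- a) * Z x y ^+ 2.
Definition tail_energy x y := \int[mu]_(t in `[y, +oo[) energy_density x t.

Let a1 : a < 1. Proof. by case/andP: ha. Qed.
Let K0 : 0 <= K.
Proof. by apply: le_trans (sb_U hsb 0 (@ltr01 R)). Qed.

Lemma norm_prod_le p q b c : `|p| <= b -> `|q| <= c -> `|p * q| <= b * c.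
Proof. by move=> h1 h2; rewrite normrM ler_pM. Qed.

Lemma cont_X x y : 0 < y -> {for y, continuous (X x)}.
Proof. by move=> y0; exact: (der_cont (wh_Xy hwh x y0)). Qed.
Lemma cont_Z x y : 0 < y -> {for y, continuous (Z x)}.
Proof. by move=> y0; exact: (der_cont (wh_Zy hwh x y0)). Qed.

Lemma der_Q_y x y : 0 < y -> is_derive y 1 (energy_density x)
  (a / y * (y `^ a * X x y ^+ 2 + y `^ (- a) * Z x y ^+ 2)
   + 2 * (X x y * S x y + Z x y * A x y)).
Proof.
move=> y0; rewrite /energy_density.
have dX2 := der_mul (wh_Xy hwh x y0) (wh_Xy hwh x y0).
have dZ2 := der_mul (wh_Zy hwh x y0) (wh_Zy hwh x y0).
apply: der_eq (der_sub (der_mul (der_powR a y0) dX2) (der_mul (der_powR (- a) y0) dZ2)) _.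
have e1 : y `^ (a - 1) = y `^ a / y.
  by rewrite -powRMD// powR_inv1// ltW.
have e2 : y `^ (- a - 1) = y `^ (- a) / y.
  by rewrite -powRMD// powR_inv1// ltW.
have e3 : y `^ (- a) * y `^ a = 1 by rewrite powRMD// addNr powRr0.
rewrite e1 e2.
transitivity (a / y * (y `^ a * X x y ^+ 2 + y `^ (- a) * Z x y ^+ 2)
   + (y `^ (- a) * y `^ a) * (2 * (X x y * S x y + Z x y * A x y))); first by ring.
by rewrite e3 mul1r.
Qed.

Lemma cont_Q x y : 0 < y -> {for y, continuous (energy_density x)}.
Proof. by move=> y0; exact: (der_cont (der_Q_y x y0)). Qed.

Lemma der_Q_x x y : 0 < y -> is_derive x 1 (energy_density ^~ y)
  (2 * (y `^ a * (X x y * A x y) - y `^ (- a) * (Z x y * S x y))).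
Proof.
move=> y0; rewrite /energy_density.
have dX2 := der_mul (wh_Xx hwh x y0) (wh_Xx hwh x y0).
have dZ2 := der_mul (wh_Zx hwh x y0) (wh_Zx hwh x y0).
by apply: der_eq (der_sub (der_scal (y `^ a) dX2) (der_scal (y `^ (- a)) dZ2)) _; ring.
Qed.

Lemma Q_bound x y : 0 < y -> `|energy_density x y| <= 2 * K ^+ 2 * y `^ (a - 2).
Proof.
move=> y0; rewrite /energy_density; apply: le_trans (ler_normB _ _) _.
have -> : 2 * K ^+ 2 * y `^ (a - 2) =
    y `^ a * ((K * y `^ (-1)) * (K * y `^ (-1))) +
    y `^ (- a) * ((K * y `^ (a - 1)) * (K * y `^ (a - 1))).
  have -> : y `^ (a - 2) = y `^ a * (y `^ (-1) * y `^ (-1)).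
    by rewrite !powRMD//; congr (_ `^ _); ring.
  have e : y `^ (- a) * (y `^ (a - 1) * y `^ (a - 1)) = y `^ a * (y `^ (-1) * y `^ (-1)).
    by rewrite !powRMD//; congr (_ `^ _); ring.
  transitivity (K ^+ 2 * (y `^ a * (y `^ (-1) * y `^ (-1))) +
    K ^+ 2 * (y `^ (- a) * (y `^ (a - 1) * y `^ (a - 1)))); last by ring.
  by rewrite e; ring.
rewrite !expr2; apply: lerD.
  rewrite normrM (ger0_norm (powR_ge0 _ _)) ler_wpM2l ?powR_ge0//.
  by apply: norm_prod_le; exact: (sb_X hsb).
rewrite normrM (ger0_norm (powR_ge0 _ _)) ler_wpM2l ?powR_ge0//.
by apply: norm_prod_le; exact: (sb_Z hsb).
Qed.

Lemma integ_Q_y x y : 0 < y -> integ `[y, +oo[ (energy_density x).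
Proof.
move=> y0; have [ip _] := @int_pow_y R (a - 2) y y0 ltac:(by move: a1 => h; lra).
apply: (@integ_le _ _ _ (fun t => 2 * K ^+ 2 * t `^ (a - 2))) => //.
- apply: (@measurable_pos _ _ _ 0) => //; last by move=> t; exact: cont_Q.
  by move=> t /=; rewrite !in_itv/= !andbT; exact: lt_le_trans.
- by move=> t /=; rewrite in_itv/= andbT => yt; apply: Q_bound; exact: lt_le_trans yt.
- exact: integZ.
Qed.

Lemma W_bound x y : 0 < y -> `|tail_energy x y| <= 2 * K ^+ 2 / (1 - a) * y `^ (a - 1).
Proof.
move=> y0; have a21 : a - 2 < -1 by move: a1 => h; lra.
have [ip e] := @int_pow_y R (a - 2) y y0 a21.
have -> : 2 * K ^+ 2 / (1 - a) * y `^ (a - 1) =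
    \int[mu]_(t in `[y, +oo[) (2 * K ^+ 2 * t `^ (a - 2)).
  rewrite (@RintegralZl _ _ _ mu)// e (_ : a - 2 + 1 = a - 1); last by ring.
  have h : a - 1 != 0 by rewrite subr_eq0 lt_eqF.
  have h' : 1 - a != 0 by rewrite subr_eq0 eq_sym lt_eqF.
  by field; rewrite h h'.
apply: normInt => //; last 1 first.
- by move=> t /=; rewrite in_itv/= andbT => yt; apply: Q_bound; exact: lt_le_trans yt.
- apply: (@measurable_pos _ _ _ 0) => //; last by move=> t; exact: cont_Q.
  by move=> t /=; rewrite !in_itv/= !andbT; exact: lt_le_trans.
- exact: integZ.
Qed.

Lemma der_W_y x y : 0 < y -> is_derive y 1 (tail_energy x) (- energy_density x y).
Proof.
move=> y0; pose c := y / 2; have [c0 cy] : 0 < c /\ c < y by rewrite /c; split; lra.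
have ic : integ `[c, +oo[ (energy_density x) by exact: integ_Q_y.
have ic' : integ `]c, +oo[ (energy_density x).
  by apply: integW ic => // z /=; rewrite !in_itv/= !andbT; exact: ltW.
have icy : integ `]c, (y + 1)] (energy_density x).
  by apply: integW ic' => // z /=; rewrite !in_itv/= andbT => /andP[].
have bcy : (BRight c < BRight y)%O by rewrite bnd_simp.
have yy1 : y < y + 1 by rewrite ltrDl.
have [d1 d2] := @continuous_FTC1 R (energy_density x) (BRight c) y (y + 1) yy1 icy bcy (@cont_Q x y y0).
have dG : is_derive y 1 (fun t => \int[mu]_(z in `]c, t]) energy_density x z) (energy_density x y).
  by apply: DeriveDef; [exact: d1|rewrite -derive1E; exact: d2].
have dH := der_sub (der_cst (\int[mu]_(z in `]c, +oo[) energy_density x z) y) dG.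
rewrite -[- energy_density x y]sub0r; apply: near_der dH; near=> t.
have ct : c < t by near: t; exact: lt_nbhsr.
rewrite (@Rintegral_itvB _ _ (BRight c) +oo%O t)// ?bnd_simp//; last exact: ltW.
rewrite /tail_energy Rintegral_itv_obnd_cbnd//.
by apply: integW ic' => // z /=; rewrite !in_itv/= !andbT; exact: lt_trans.
Unshelve. all: by end_near. Qed.

(** By the equation of U, the derivative of the density in x is that of - 2 X Z
    in y. *)
Lemma der_W_x x y : 0 < y -> is_derive x 1 (tail_energy ^~ y) (2 * (X x y * Z x y)).
Proof.
move=> y0; have a31 : a - 3 < -1 by move: a1 => h; lra.
have [ip e] := @int_pow_y R (a - 3) y y0 a31.
pose dq x t := 2 * (t `^ a * (X x t * A x t) - t `^ (- a) * (Z x t * S x t)).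
have dqb z t : 0 < t -> `|dq z t| <= 4 * K ^+ 2 * t `^ (a - 3).
  move=> t0; rewrite /dq normrM (@ger0_norm _ 2)//.
  rewrite (_ : 4 * K ^+ 2 * t `^ (a - 3) =
    2 * (t `^ a * ((K * t `^ (-1)) * (K * t `^ (-2))) +
         t `^ (- a) * ((K * t `^ (a - 1)) * (K * t `^ (a - 2))))); last first.
    have e1 : t `^ a * (t `^ (-1) * t `^ (-2)) = t `^ (a - 3).
      by rewrite !powRMD//; congr (_ `^ _); ring.
    have e2 : t `^ (- a) * (t `^ (a - 1) * t `^ (a - 2)) = t `^ (a - 3).
      by rewrite !powRMD//; congr (_ `^ _); ring.
    transitivity (2 * K ^+ 2 * (t `^ a * (t `^ (-1) * t `^ (-2)))
      + 2 * K ^+ 2 * (t `^ (- a) * (t `^ (a - 1) * t `^ (a - 2)))); last by ring.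
    by rewrite e1 e2; ring.
  rewrite ler_wpM2l//; apply: le_trans (ler_normB _ _) _; apply: lerD.
    rewrite normrM (ger0_norm (powR_ge0 _ _)) ler_wpM2l ?powR_ge0//.
    by apply: norm_prod_le; [exact: (sb_X hsb)|exact: (sb_A hsb)].
  rewrite normrM (ger0_norm (powR_ge0 _ _)) ler_wpM2l ?powR_ge0//.
  by apply: norm_prod_le; [exact: (sb_Z hsb)|exact: (sb_S hsb)].
have lim0 p c : p < 0 -> (c * t `^ p) @[t --> +oo] --> (0 : R).
  move=> p0; rewrite -[X in _ --> X](mulr0 c); apply: cvgMr.
  by have := @powR_cvgy R (- p); rewrite opprK; apply; rewrite oppr_gt0.
have XZ0 : (- (2 * (X x t * Z x t))) @[t --> +oo] --> (0 : R).
  apply/cvgr0Pnorm_le => eps eps0.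
  have a2 : a - 2 < 0 by move: a1 => h; lra.
  have := lim0 (a - 2) (2 * K ^+ 2) a2; move/cvgr0Pnorm_le => /(_ _ eps0) h.
  near=> t; have t0 : 0 < t by [].
  apply: (@le_trans _ _ `|2 * K ^+ 2 * t `^ (a - 2)|); last by near: t; exact: h.
  rewrite normrN normrM (@ger0_norm _ 2)// [leRHS]ger0_norm; last first.
    by rewrite mulr_ge0 ?powR_ge0// mulr_ge0// sqr_ge0.
  rewrite -mulrA ler_wpM2l//.
  rewrite (_ : K ^+ 2 * t `^ (a - 2) = (K * t `^ (-1)) * (K * t `^ (a - 1))).
    by apply: norm_prod_le; [exact: (sb_X hsb)|exact: (sb_Z hsb)].
  by rewrite mulrACA powRMD// expr2; congr (_ * _ `^ _); ring.
have a30 : a - 3 + 1 != 0 by rewrite lt_eqF//; move: a1 => h; lra.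
have [|||||||_ I] := @FTC_y_dom R (dq x) (fun t => - (2 * (X x t * Z x t)))
    (fun t => 4 * K ^+ 2 * t `^ (a - 3))
    (fun t => 4 * K ^+ 2 * ((a - 3 + 1)^-1 * t `^ (a - 3 + 1))) 0 y 0 0 y0.
- move=> t t0; apply: cvgMr; apply: cvgB.
    apply: cvgM; first exact: powR_cont.
    by apply: cvgM; [exact: cont_X|exact: (wh_Ay hwh)].
  apply: cvgM; first exact: powR_cont.
  by apply: cvgM; [exact: cont_Z|exact: (wh_Sy hwh)].
- move=> t t0; apply: der_eq (der_opp (der_scal 2 (der_mul (wh_Xy hwh x t0) (wh_Zy hwh x t0)))) _.
  by rewrite /dq; ring.
- by move=> t t0; apply: cvgMr; exact: powR_cont.
- by move=> t t0; apply: der_scal; exact: der_powR_prim.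
- by move=> t yt; apply: dqb; exact: lt_le_trans yt.
- exact: XZ0.
- by under eq_fun do rewrite mulrA; apply: lim0; move: a1 => h; lra.
have -> : 2 * (X x y * Z x y) = \int[mu]_(t in `[y, +oo[) dq x t.
  by rewrite I sub0r opprK.
apply: (@Int_derive R `[y, +oo[%classic energy_density dq (fun t => 4 * K ^+ 2 * t `^ (a - 3)) x 1) => //.
- move=> z t _ /=; rewrite in_itv/= andbT => yt.
  by apply: der_Q_x; exact: lt_le_trans yt.
- by move=> z _; exact: integ_Q_y.
- exact: integZ.
- by move=> z t _ /=; rewrite in_itv/= andbT => yt; apply: dqb; exact: lt_le_trans yt.
Unshelve. all: by end_near. Qed.

End first_integral.

(** * The maximum principle *)

Section maximum_principle.
Variable R : realType.
Variables (a K T : R) (U X Z S A : R -> R -> R).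
Hypothesis (hwh : weighted_harmonic a U X Z S A) (hsb : scale_bounds a K U X Z S A).
Hypothesis (ha : -1 < a < 1) (T0 : 0 < T).
Hypothesis (XT : forall x y : R, 0 < y -> X (x + T) y = X x y).
Hypothesis (ZT : forall x y : R, 0 < y -> Z (x + T) y = Z x y).
Implicit Types (x y z t c d e : R).

Local Notation W := (tail_energy a X Z).
Local Notation Q := (energy_density a X Z).

Lemma W_periodic y : 0 < y -> forall x, W (x + T) y = W x y.
Proof.
move=> y0 x; apply: eq_Rintegral => t; rewrite inE/= in_itv/= andbT => yt.
by rewrite /energy_density XT ?ZT//; exact: lt_le_trans yt.
Qed.

(** Gives the joint continuity of W, needed for the existence of a maximum. *)
Lemma W_lipschitz e x y x' y' : 0 < e -> e <= y -> e <= y' ->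
  `|W x y - W x' y'| <= 2 * K ^+ 2 * e `^ (a - 2) * (`|x - x'| + `|y - y'|).
Proof.
move=> e0.
have a2 : a - 2 <= 0 by case/andP: ha => *; lra.
have K0 : 0 <= K by apply: le_trans (sb_U hsb 0 (@ltr01 R)).
have L0 : 0 <= 2 * K ^+ 2 by rewrite mulr_ge0// sqr_ge0.
have step1 x1 x2 y1 : e <= y1 -> x1 <= x2 ->
    `|W x2 y1 - W x1 y1| <= 2 * K ^+ 2 * e `^ (a - 2) * (x2 - x1).
  move=> ey1 x12; have y10 : 0 < y1 by exact: lt_le_trans ey1.
  apply: (@derive_bound_lip R (fun x => W x y1) (fun x => 2 * (X x y1 * Z x y1))) => //.
    by move=> z _; exact: (der_W_x hwh hsb ha).
  move=> z _; rewrite normrM (@ger0_norm _ 2)// -mulrA ler_wpM2l//.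
  apply: (@le_trans _ _ (K ^+ 2 * y1 `^ (a - 2))); last first.
    by rewrite ler_wpM2l ?sqr_ge0//; apply: powR_le_base.
  rewrite (_ : K ^+ 2 * y1 `^ (a - 2) = (K * y1 `^ (-1)) * (K * y1 `^ (a - 1))).
    by apply: norm_prod_le; [exact: (sb_X hsb)|exact: (sb_Z hsb)].
  by rewrite mulrACA powRMD// expr2; congr (_ * _ `^ _); ring.
have step2 x1 y1 y2 : e <= y1 -> y1 <= y2 ->
    `|W x1 y2 - W x1 y1| <= 2 * K ^+ 2 * e `^ (a - 2) * (y2 - y1).
  move=> ey1 y12; have y10 : 0 < y1 by exact: lt_le_trans ey1.
  apply: (@derive_bound_lip R (W x1) (fun y => - Q x1 y)) => //.
    by move=> z /andP[yz _]; apply: (der_W_y hwh hsb ha); exact: lt_le_trans yz.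
  move=> z /andP[yz _]; rewrite normrN.
  have z0 : 0 < z by exact: lt_le_trans yz.
  apply: le_trans (Q_bound hsb x1 z0) _; rewrite ler_wpM2l//.
  by apply: powR_le_base => //; exact: le_trans yz.
move=> ey ey'.
have -> : W x y - W x' y' = (W x y - W x' y) + (W x' y - W x' y') by ring.
apply: le_trans (ler_normD _ _) _; rewrite mulrDr; apply: lerD.
  have [xx|xx] := leP x x'.
    by rewrite distrC (distrC x) (@ger0_norm _ (x' - x)) ?subr_ge0//; exact: step1.
  by rewrite (@ger0_norm _ (x - x')) ?subr_ge0 ?(ltW xx)//; apply: step1 => //; exact: ltW.
have [yy|yy] := leP y y'.
  by rewrite distrC (distrC y) (@ger0_norm _ (y' - y)) ?subr_ge0//; exact: step2.
by rewrite (@ger0_norm _ (y - y')) ?subr_ge0 ?(ltW yy)//; apply: step2 => //; exact: ltW.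
Qed.

(** At an interior maximum of d y^2 - W both second derivatives are
    nonpositive, whereas by the equation their sum is 2 d (1 + a) > 0: there
    X Z = 0 and Q = - 2 d y < 0, which forces X = 0 and so fixes the only term
    of the sum without a sign. *)
Lemma no_interior_max d x1 y1 r : 0 < d -> 0 < r -> r <= y1 ->
  ~ (forall x y, `|y - y1| < r -> d * y ^+ 2 - W x y <= d * y1 ^+ 2 - W x1 y1).
Proof.
move=> d0 r0 ry1 hmax; have y10 : 0 < y1 by exact: lt_le_trans ry1.
have [XZ0 hxx] : - (2 * (X x1 y1 * Z x1 y1)) = 0 /\
    - (2 * (A x1 y1 * Z x1 y1 + X x1 y1 * S x1 y1)) <= 0.
  apply: (@max_second_derivative R (fun x => d * y1 ^+ 2 - W x y1)
    (fun x => - (2 * (X x y1 * Z x y1))) x1 _ r r0).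
  - move=> x _; rewrite -[- _]sub0r.
    exact: der_sub (der_cst _ x) (der_W_x hwh hsb ha x y10).
  - exact: der_opp (der_scal 2 (der_mul (wh_Xx hwh x1 y10) (wh_Zx hwh x1 y10))).
  - by move=> x _; apply: hmax; rewrite subrr normr0.
have [Q0 hyy] : d * (2 * y1) + Q x1 y1 = 0 /\
    d * 2 + (a / y1 * (y1 `^ a * X x1 y1 ^+ 2 + y1 `^ (- a) * Z x1 y1 ^+ 2)
   + 2 * (X x1 y1 * S x1 y1 + Z x1 y1 * A x1 y1)) <= 0.
  apply: (@max_second_derivative R (fun y => d * y ^+ 2 - W x1 y)
    (fun y => d * (2 * y) + Q x1 y) y1 _ r r0).
  - move=> y; rewrite ltr_distl => /andP[hy _].
    have y0 : 0 < y by lra.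
    by apply: der_eq (der_sub (der_scal d (der_sqr y)) (der_W_y hwh hsb ha x1 y0)) _; rewrite opprK.
  - apply: der_eq (der_add (der_scal d (der_scal 2 (der_id y1))) (der_Q_y hwh x1 y10)) _.
    by rewrite mulr1.
  - by move=> y hy; apply: hmax.
set p := y1 `^ a * X x1 y1 ^+ 2 in hyy.
set q := y1 `^ (- a) * Z x1 y1 ^+ 2 in hyy.
have QE : Q x1 y1 = p - q by [].
have p0 : 0 <= p by rewrite mulr_ge0 ?powR_ge0// sqr_ge0.
have q0 : 0 <= q by rewrite mulr_ge0 ?powR_ge0// sqr_ge0.
have XZ : X x1 y1 * Z x1 y1 = 0 by lra.
have dy : 0 < d * y1 by exact: mulr_gt0.
(* Z = 0 would make Q nonnegative, against Q = - 2 d y *)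
have X0 : X x1 y1 = 0.
  move/eqP: XZ; rewrite mulf_eq0 => /orP[/eqP //|/eqP Z0].
  have q00 : q = 0 by rewrite /q Z0 expr0n/= mulr0.
  by exfalso; rewrite QE q00 in Q0; lra.
have p00 : p = 0 by rewrite /p X0 expr0n/= mulr0.
have qE : q = 2 * d * y1 by rewrite QE p00 in Q0; lra.
have aq : a / y1 * (p + q) = 2 * d * a.
  by rewrite p00 qE; field; rewrite gt_eqF.
rewrite aq in hyy.
have : 0 < d * (1 + a) by rewrite mulr_gt0//; case/andP: ha => *; lra.
by rewrite X0 in hxx hyy; lra.
Qed.

(** W tends to 0 at infinity, so if - W exceeded c somewhere, then for small d the
    function d y^2 - W would have an interior maximum in a rectangle made of one
    period in x and a segment in y. *)
Lemma max_principle c : 0 <= c ->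
  (forall e, 0 < e -> exists2 r, 0 < r & forall x y, 0 < y -> y < r -> - W x y <= c + e) ->
  forall x y, 0 < y -> - W x y <= c.
Proof.
move=> c0 hb x0 y0 y00; rewrite leNgt; apply/negP => hlt.
pose h := - W x0 y0 - c; have h0 : 0 < h by rewrite subr_gt0.
have [h3 h6] : 0 < h / 3 /\ 0 < h / 6 by split; lra.
have [r r0 hr] := hb _ h3.
pose B := 2 * K ^+ 2 / (1 - a).
have /cvgr0Pnorm_le /(_ _ h3) limY : (B * t `^ (a - 1)) @[t --> +oo] --> (0 : R).
  rewrite -[X in _ --> X](mulr0 B); apply: cvgMr.
  by have := @powR_cvgy R (1 - a); rewrite opprB; apply; case/andP: ha => *; lra.
have [Y yY hY] : exists2 Y, y0 < Y & forall x, - W x Y <= c + h / 3.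
  near (pinfty_nbhs R) => Y; have y0Y : y0 < Y.
    by near: Y; apply: nbhs_pinfty_gt; exact: num_real.
  exists Y => // x; have Y0 : 0 < Y by exact: lt_trans y0Y.
  have h1 := W_bound hwh hsb ha x Y0.
  have h2 : `|B * Y `^ (a - 1)| <= h / 3 by near: Y; exact: limY.
  have := le_trans h1 (le_trans (ler_norm _) h2).
  by rewrite ler_norml => /andP[? _]; lra.
pose e := Num.min (r / 2) (y0 / 2).
have e0 : 0 < e by rewrite lt_min !divr_gt0.
have er : e < r by rewrite /e; have : Num.min (r / 2) (y0 / 2) <= r / 2; [rewrite ge_min lexx//|lra].
have ey : e < y0 by rewrite /e; have : Num.min (r / 2) (y0 / 2) <= y0 / 2; [rewrite ge_min lexx orbT//|lra].
clearbody e.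
have Y2 : 0 < Y ^+ 2 + 1 by rewrite ltr_wpDl ?sqr_ge0.
pose d := h / 3 / (Y ^+ 2 + 1).
have d0 : 0 < d by rewrite divr_gt0.
have dY y : e <= y -> y <= Y -> d * y ^+ 2 < h / 3.
  move=> ey' yY'; apply: (@lt_le_trans _ _ (d * (Y ^+ 2 + 1))).
    rewrite ltr_pM2l//; apply: (@le_lt_trans _ _ (Y ^+ 2)); last by rewrite ltrDl.
    by rewrite lerXn2r// nnegrE; lra.
  by rewrite /d divfK// gt_eqF.
pose g (p : R * R) : R := d * p.2 ^+ 2 - W p.1 p.2.
pose D : set (R * R) := `[0, T]%classic `*` `[e, Y]%classic.
have D0 : D !=set0.
  by exists (0, y0); split; rewrite /= in_itv/= ?lexx !ltW.
have cD : compact D by apply: compact_setX; exact: segment_compact.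
pose L := 2 * K ^+ 2 * e `^ (a - 2).
have L0 : 0 <= L by rewrite mulr_ge0 ?powR_ge0// mulr_ge0// sqr_ge0.
have cg : {within D, continuous g}.
  apply/subspace_continuousP => p [_ /=]; rewrite in_itv/= => /andP[pe _].
  apply: cvgB.
    apply: cvg_within_filter; apply: cvgMr.
    apply: (@cvg_comp _ _ _ snd (fun t => t ^+ 2)); first exact: cvg_snd.
    exact: exprn_continuous.
  apply/cvgrPdist_le => eps eps0.
  have e1 : 0 < eps / (2 * (L + 1)) by rewrite divr_gt0// mulr_gt0// ltr_wpDl.
  have c1 : q.1 @[q --> p] --> p.1 by exact: cvg_fst.
  have c2 : q.2 @[q --> p] --> p.2 by exact: cvg_snd.
  near=> q.
  have Dq : D q by near: q; exact: withinT.
  have eq2 : e <= q.2 by case: Dq => _ /=; rewrite in_itv/= => /andP[].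
  apply: le_trans (W_lipschitz p.1 q.1 e0 pe eq2) _.
  have q1 : `|p.1 - q.1| <= eps / (2 * (L + 1)).
    by near: q; apply: cvg_within; move/cvgrPdist_le : c1; apply.
  have q2 : `|p.2 - q.2| <= eps / (2 * (L + 1)).
    by near: q; apply: cvg_within; move/cvgrPdist_le : c2; apply.
  have hL : L * (`|p.1 - q.1| + `|p.2 - q.2|) <= (L + 1) * (eps / (2 * (L + 1)) + eps / (2 * (L + 1))).
    by apply: ler_pM; [exact: L0|exact: addr_ge0|rewrite lerDl|exact: lerD].
  apply: le_trans hL _; apply: eqW; field.
  by rewrite gt_eqF// ltr_wpDl.
have [[x1 y1] /set_mem[/= x1T y1Y] hmax] := compact_EVT_max D0 cD cg.
have gmax x y : e <= y -> y <= Y -> d * y ^+ 2 - W x y <= d * y1 ^+ 2 - W x1 y1.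
  move=> ey' yY'; have y'0 : 0 < y by exact: lt_le_trans ey'.
  have [z /andP[z0 zT] hz] := periodic_reduce x T0.
  rewrite (hz (fun x => W x y) (W_periodic y'0)).
  apply: (hmax (z, y)); rewrite inE; split; rewrite /= in_itv/=.
    by rewrite z0 ltW.
  by rewrite ey'.
have big : c + h < d * y1 ^+ 2 - W x1 y1.
  apply: lt_le_trans (gmax x0 y0 (ltW ey) (ltW yY)).
  have : 0 < d * y0 ^+ 2 by rewrite mulr_gt0// exprn_gt0.
  by rewrite /h; lra.
move: y1Y; rewrite in_itv/= => /andP[ey1 y1Y].
have ey1' : e < y1.
  rewrite lt_neqAle ey1 andbT; apply/eqP => E.
  have h1 := hr x1 y1 (lt_le_trans e0 ey1); rewrite -E in h1.
  have h2 := dY _ (lexx e) (ltW (lt_trans ey yY)).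
  by have := h1 er; rewrite -E in big; lra.
have y1Y' : y1 < Y.
  rewrite lt_neqAle y1Y andbT; apply/eqP => E.
  have h2 := dY _ ey1 y1Y; have := hY x1.
  by rewrite E in h2 big; lra.
pose rr := Num.min (y1 - e) (Y - y1).
have rr0 : 0 < rr by rewrite lt_min !subr_gt0 ey1'.
have rr1 : rr <= y1 - e by rewrite ge_min lexx.
have rr2 : rr <= Y - y1 by rewrite ge_min lexx orbT.
clearbody rr.
apply: (@no_interior_max d x1 y1 rr d0 rr0); first by lra.
move=> x y; rewrite ltr_distl => /andP[? ?]; apply: gmax; lra.
Unshelve. all: by end_near. Qed.

End maximum_principle.

(** * Estimates at the boundary *)

Section near_boundary.
Variable R : realType.
Local Notation mu := (@lebesgue_measure R).
Variables (s K N1 N2 : R) (U X Z S A : R -> R -> R).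
Hypothesis (hs : 0 < s < 1).
Let a := 1 - 2 * s.
Hypothesis (hwh : weighted_harmonic a U X Z S A) (hsb : scale_bounds a K U X Z S A).
Hypothesis ZN : forall x y : R, 0 < y -> `|Z x y| <= N1.
Hypothesis SN : forall x y : R, 0 < y -> `|S x y| <= N2 * y `^ (-1).
Implicit Types (x y z t c d e : R).

Let s0 : 0 < s. Proof. by case/andP: hs. Qed.
Let s1 : s < 1. Proof. by case/andP: hs. Qed.
Let be := s * (2 - s).
Let be1 : be < 1.
Proof. by rewrite /be; move: s0 s1 => *; nra. Qed.
Let be2s : be <= 2 * s.
Proof. by rewrite /be; move: s0 s1 => *; nra. Qed.
Let K0 : 0 <= K.
Proof. by apply: le_trans (sb_U hsb 0 (@ltr01 R)). Qed.
Let N10 : 0 <= N1.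
Proof. by apply: le_trans (ZN 0 (@ltr01 R)). Qed.
Let N20 : 0 <= N2.
Proof. by have := le_trans (normr_ge0 _) (SN 0 (@ltr01 R)); rewrite powR1 mulr1. Qed.

Lemma powR_le_exp y p q : 0 < y -> y <= 1 -> q <= p -> y `^ p <= y `^ q.
Proof. by move=> y0 y1 pq; apply: ger_powR => //; rewrite y0. Qed.

(** U_x has the derivative y^(-a) S in y, of size at most y^(2s-2); integrating
    it from y to 1 costs one power. The exponent be - 1 with s < be < 1 and
    be <= 2s avoids the logarithm of the case s = 1/2. *)
Lemma X_near0 x y : 0 < y -> y <= 1 ->
  `|X x y| <= (K + N2 / (1 - be)) * y `^ (be - 1).
Proof.
move=> y0 y1; have b1 : 0 < 1 - be by rewrite subr_gt0.
have b1' : be - 2 + 1 != 0 by rewrite lt_eqF//; move: b1 => *; lra.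
have Xyb t : 0 < t -> t <= 1 -> `|t `^ (- a) * S x t| <= N2 * t `^ (be - 2).
  move=> t0 t1; rewrite normrM (ger0_norm (powR_ge0 _ _)).
  apply: (@le_trans _ _ (t `^ (- a) * (N2 * t `^ (-1)))).
    by rewrite ler_wpM2l ?powR_ge0// SN.
  rewrite mulrCA powRMD// ler_wpM2l// powR_le_exp//.
  by move: be2s; rewrite /a => *; lra.
pose P t := (be - 2 + 1)^-1 * t `^ (be - 2 + 1).
have dP t : 0 < t -> is_derive t 1 P (t `^ (be - 2)) by move=> t0; exact: der_powR_prim.
have PE t : P t = - (1 - be)^-1 * t `^ (be - 1).
  rewrite /P (_ : be - 2 + 1 = be - 1); last by ring.
  by rewrite -(opprB 1 be) invrN.
have up : X x y + N2 * P y <= X x 1 + N2 * P 1.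
  have [z /andP[yz _]|z /andP[yz z1] h] := @MVT_le R (fun t => X x t + N2 * P t)
    (fun t => t `^ (- a) * S x t + N2 * t `^ (be - 2)) y 1 y1.
    have z0 : 0 < z by exact: lt_le_trans yz.
    exact: der_add (wh_Xy hwh x z0) (der_scal N2 (dP z z0)).
  rewrite -subr_ge0 h mulr_ge0 ?subr_ge0//.
  have z0 : 0 < z by exact: lt_le_trans yz.
  by have := Xyb z z0 z1; rewrite ler_norml => /andP[? _]; lra.
have lo : X x 1 - N2 * P 1 <= X x y - N2 * P y.
  have [z /andP[yz _]|z /andP[yz z1] h] := @MVT_le R (fun t => X x t - N2 * P t)
    (fun t => t `^ (- a) * S x t - N2 * t `^ (be - 2)) y 1 y1.
    have z0 : 0 < z by exact: lt_le_trans yz.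
    exact: der_sub (wh_Xy hwh x z0) (der_scal N2 (dP z z0)).
  rewrite -subr_le0 h mulr_le0_ge0 ?subr_ge0//.
  have z0 : 0 < z by exact: lt_le_trans yz.
  by have := Xyb z z0 z1; rewrite ler_norml => /andP[_ ?]; lra.
have X1 := sb_X hsb x (@ltr01 R); rewrite powR1 mulr1 in X1.
have y1b : 1 <= y `^ (be - 1).
  rewrite -[leLHS](powRr0 y) powR_le_exp//; first by move: be1 => *; lra.
have P1 : N2 * P 1 <= 0.
  by rewrite PE powR1 mulr1 mulrN oppr_le0 mulr_ge0// invr_ge0 ltW.
have PyE : N2 * P y = - (N2 / (1 - be) * y `^ (be - 1)) by rewrite PE; ring.
have Ky : K <= K * y `^ (be - 1) by rewrite ler_peMr.
move: X1; rewrite !ler_norml => /andP[? ?]; apply/andP; split.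
  rewrite mulrDl; lra.
rewrite mulrDl; lra.
Qed.

Let ga := s * (1 - s).
Let ga0 : 0 < ga.
Proof. by rewrite /ga mulr_gt0// subr_gt0. Qed.
Let C1 := (K + N2 / (1 - be)) ^+ 2 + N1 ^+ 2.

(** The exponent 2 s (1 - s) - 1 exceeds - 1: the energy is integrable up to the
    boundary, uniformly in x. *)
Lemma Q_near0 x y : 0 < y -> y <= 1 -> `|energy_density a X Z x y| <= C1 * y `^ (2 * ga - 1).
Proof.
move=> y0 y1; rewrite /energy_density; apply: le_trans (ler_normB _ _) _.
rewrite mulrDl; apply: lerD.
  rewrite normrM (ger0_norm (powR_ge0 _ _)) expr2.
  set c := K + N2 / (1 - be).
  have -> : c ^+ 2 * y `^ (2 * ga - 1) = y `^ a * ((c * y `^ (be - 1)) * (c * y `^ (be - 1))).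
    transitivity (c ^+ 2 * (y `^ a * (y `^ (be - 1) * y `^ (be - 1)))); last by ring.
    by rewrite !powRMD//; congr (_ * _ `^ _); rewrite /a /be /ga; ring.
  by rewrite ler_wpM2l ?powR_ge0//; apply: norm_prod_le; exact: X_near0.
rewrite normrM (ger0_norm (powR_ge0 _ _)) mulrC expr2.
apply: ler_pM => //; first exact: powR_ge0.
  by rewrite expr2; apply: norm_prod_le; exact: ZN.
apply: powR_le_exp => //; move: be2s s0; rewrite /a /ga => *; nra.
Qed.

Lemma meas_Q (D : set R) x : measurable D -> D `<=` `]0, +oo[ -> measurable_fun D (energy_density a X Z x).
Proof.
move=> mD D0; apply: (@measurable_pos _ _ _ 0) => // t t0.
exact: (cont_Q hwh).
Qed.

Let ga1 : -1 < 2 * ga - 1.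
Proof. by move: ga0 => h; lra. Qed.

Lemma integ_Q_0 x b : 0 < b -> b <= 1 -> integ `]0, b] (energy_density a X Z x).
Proof.
move=> b0 b1; have [ip _] := int_pow_0 b0 ga1.
apply: (@integ_le _ _ _ (fun y => C1 * y `^ (2 * ga - 1))) => //.
- by apply: meas_Q => // t /=; rewrite !in_itv/= andbT => /andP[].
- by move=> y /=; rewrite in_itv/= => /andP[y0 yb]; apply: Q_near0 => //; exact: le_trans b1.
- exact: integZ.
Qed.

Lemma int_Q_near0 x b : 0 < b -> b <= 1 ->
  `|\int[mu]_(y in `]0, b]) energy_density a X Z x y| <= C1 / (2 * ga) * b `^ (2 * ga).
Proof.
move=> b0 b1; have [ip e] := int_pow_0 b0 ga1.
have -> : C1 / (2 * ga) * b `^ (2 * ga) = \int[mu]_(y in `]0, b]) (C1 * y `^ (2 * ga - 1)).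
  by rewrite (@RintegralZl _ _ _ mu)// e !subrK -[LHS]mulrA.
apply: normInt => //.
- by apply: meas_Q => // t /=; rewrite !in_itv/= andbT => /andP[].
- exact: integZ.
- by move=> y /=; rewrite in_itv/= => /andP[y0 yb]; apply: Q_near0 => //; exact: le_trans b1.
Qed.

Lemma integ_setU (D E : set R) (f : R -> R) : measurable D -> measurable E -> [disjoint D & E] ->
  measurable_fun (D `|` E) f -> integ D f -> integ E f -> integ (D `|` E) f.
Proof.
move=> mD mE DE mf /integrableP[_ fD] /integrableP[_ fE].
apply/integrableP; split; first exact/measurable_EFinP.
rewrite (@ge0_integral_setU _ _ _ mu)//; last 1 first.
- by apply: measurableT_comp => //; exact/measurable_EFinP.
by apply: lte_add_pinfty.
Qed.

Hypothesis ha : -1 < a < 1.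

Lemma integ_Q x : integ `]0, +oo[ (energy_density a X Z x).
Proof.
have U01 : `]0, +oo[%classic = `]0, 1]%classic `|` `]1, +oo[%classic :> set R.
  apply/seteqP; split=> r /=; rewrite !in_itv/= !andbT.
    by move=> r0; have [r1|r1] := leP r 1; [left|right] => //; rewrite r0.
  by case=> [/andP[]|] // r1; exact: lt_trans r1.
rewrite U01; apply: integ_setU => //.
- apply/disj_setPS => r [] /=; rewrite !in_itv/= andbT => /andP[_ r1].
  by rewrite ltNge r1.
- by rewrite -U01; exact: meas_Q.
- exact: integ_Q_0.
- have := integ_Q_y hwh hsb ha x (@ltr01 R).
  by apply: integW => // t /=; rewrite !in_itv/= !andbT; exact: ltW.
Qed.

(** All integrals converge, so the integral over ]0, +oo[ may be cut at y. *)
Lemma int_Q_split x y : 0 < y -> \int[mu]_(t in `]0, +oo[) energy_density a X Z x t =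
  \int[mu]_(t in `]0, y[) energy_density a X Z x t + tail_energy a X Z x y.
Proof.
move=> y0.
have i1 : integ `]0, y[ (energy_density a X Z x).
  by apply: integW (integ_Q x) => // t /=; rewrite !in_itv/= andbT => /andP[].
have := @Rintegral_itvB R (energy_density a X Z x) (BRight 0) +oo%O y (integ_Q x).
rewrite bnd_simp => /(_ (ltW y0) isT) h.
rewrite Rintegral_itv_bndo_bndc// /tail_energy -Rintegral_itv_obnd_cbnd.
  by rewrite -h; ring.
by apply: integW (integ_Q x) => // t /=; rewrite !in_itv/= !andbT; exact: lt_trans.
Qed.

End near_boundary.

(** * Even data whose extension is constant on the axis *)

Section stieltjes.
Variable R : realType.
Local Notation mu := (@lebesgue_measure R).
Implicit Types (h : R -> R) (b M x z r : R).

(** The integrals are the moments of h with respect to t = 1 / (1 + z^2), and t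
    determines z up to its sign. *)
Lemma stieltjes_zero b h M : 2^-1 < b -> continuous h -> (forall x, `|h x| <= M) ->
  (forall x, h (- x) = h x) ->
  (forall n : nat, \int[mu]_z (radial (b + n%:R) z 1 * h z) = 0) -> forall x, h x = 0.
Proof.
move=> b1 ch hM he mom.
pose t z : R := (z ^+ 2 + 1 ^+ 2)^-1.
have tp z : 0 < z ^+ 2 + 1 ^+ 2 :> R by exact: sqD_gt0.
have ct : continuous t.
  move=> z; apply: cvgV; first by rewrite gt_eqF.
  by apply: cvgD; [exact: exprn_continuous|exact: cvg_cst].
have radialn n z : radial (b + n%:R) z 1 = radial b z 1 * t z ^+ n.
  rewrite /radial opprD -powRMD// powR_invn ?(ltW (tp z))//.
  by rewrite /t exprVn.
have tlt z1 z2 : 0 <= z1 -> z1 < z2 -> t z2 < t z1.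
  by move=> z10 z12; rewrite /t ltf_pV2 ?posrE ?tp// ltrD2r ltrXn2r// ?nnegrE; lra.
have tabs z : t `|z| = t z by rewrite /t real_normK ?num_real.
have key g x0 : continuous g -> (forall x, `|g x| <= M) -> (forall x, g (- x) = g x) ->
    (forall n : nat, \int[mu]_z (radial (b + n%:R) z 1 * g z) = 0) -> g x0 <= 0.
  move=> cg gM ge gmom.
  have gabs z : g `|z| = g z by case: (leP 0 z) => z0; [rewrite ger0_norm|rewrite ltr0_norm// ge].
  apply: (@moment_le0 R setT g (fun z => radial b z 1) t x0) => //.
  - exact: filterT.
  - exact: continuous_measurable_fun.
  - exact: continuous_measurable_fun.
  - by apply: continuous_measurable_fun; exact: radial_cont.
  - move=> z _; rewrite /t ger0_norm ?invr_ge0 ?(ltW (tp z))//.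
    by rewrite invf_le1// expr1n lerDr sqr_ge0.
  - exact: integ_radial1.
  - have := integ_rconv0 cg gM 0 b1 (@ltr01 R).
    by apply: eq_integrable => // z _; rewrite /= sub0r radialN mulrC.
  - by move=> z _; exact: radial_ge0.
  - exact: radial_gt0.
  - exact: ct.
  - exact: radial_cont.
  - move=> gx0.
    have hlt : g x0 / 2 < g `|x0| by rewrite gabs; lra.
    have cgx : g z @[z --> `|x0|] --> g `|x0| by exact: cg.
    have [d /= d0 hd] : \forall z \near `|x0|, g x0 / 2 < g z by exact: (cvgr_gt _ cgx _ hlt).
    pose r1 := t x0 - t (`|x0| + d).
    pose r2 := if d <= `|x0| then t (`|x0| - d) - t x0 else 1.
    have r10 : 0 < r1 by rewrite subr_gt0 -(tabs x0) tlt// ltrDl.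
    have r20 : 0 < r2.
      by rewrite /r2; case: ifP => // dx; rewrite subr_gt0 -(tabs x0) tlt ?subr_ge0// ltrBlDr ltrDl.
    exists (Num.min r1 r2); first by rewrite lt_min r10.
    move=> z _; rewrite lt_min => /andP[h1 h2]; rewrite -(gabs z); apply: ltW; apply: hd.
    rewrite /ball_/= ltNge; apply/negP; rewrite distrC.
    have [zx|zx] := leP `|z| `|x0|.
      rewrite ler0_norm ?subr_le0// opprB => dz.
      have dx : d <= `|x0| by have := normr_ge0 z; lra.
      move: h2; rewrite /r2 dx => /(le_lt_trans (ler_norm _)).
      rewrite ltrD2r ltNge => /negP; apply; rewrite -(tabs z).
      have : `|z| <= `|x0| - d by lra.
      by rewrite le_eqVlt => /predU1P[->//|zl]; apply: ltW; exact: tlt.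
    rewrite ger0_norm ?subr_ge0 ?(ltW zx)// => dz.
    have : t x0 - t z < r1 by apply: le_lt_trans h1; rewrite distrC ler_norm.
    rewrite ltrD2l ltrN2 ltNge => /negP; apply; rewrite -(tabs z).
    have : `|x0| + d <= `|z| by lra.
    by rewrite le_eqVlt => /predU1P[->//|zl]; apply: ltW; apply: tlt => //; rewrite addr_ge0// ltW.
  - move=> n; rewrite -[RHS](gmom n); apply: eq_Rintegral => z _.
    by rewrite radialn; ring.
move=> x; apply/eqP; rewrite eq_le key//= -oppr_le0.
apply: (key (fun z => - h z)) => //.
- by move=> z; apply: cvgN; exact: ch.
- by move=> z; rewrite normrN.
- by move=> z; rewrite he.
- move=> n; rewrite -[RHS]oppr0 -(mom n) -[RHS]mulN1r -(@RintegralZl _ _ _ mu)//.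
    by apply: eq_Rintegral => z _; ring.
  have b2 : 2^-1 < b + n%:R by rewrite ltr_wpDr.
  have := integ_rconv0 ch hM 0 b2 (@ltr01 R).
  by apply: eq_integrable => // z _; rewrite /= sub0r radialN.
Qed.

End stieltjes.

Section axis.
Variable R : realType.
Local Notation mu := (@lebesgue_measure R).
Implicit Types (s M x y z : R) (u : R -> R).

(** If U is constant on the axis, the integrals of (z^2 + y^2)^(-b) (u(z) - u(0))
    vanish for all y > 0; differentiating in y raises b by 1 each time, and y = 1
    gives all the moments of stieltjes_zero. *)
Lemma constant_axis s M u : 0 < s < 1 -> continuous u -> (forall x, `|u x| <= M) ->
  (forall x, u (- x) = u x) -> (forall y, 0 < y -> Zext s u 0 y = 0) ->
  forall x, u x = u 0.
Proof.
move=> hs cu uM ue Z0.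
have [s0 s1] : 0 < s /\ s < 1 by case/andP: hs.
have wh := ext_weighted_harmonic hs cu uM.
have dU y : 0 < y -> is_derive y 1 (Uext s u 0) 0.
  by move=> y0; apply: der_eq (wh_Uy wh 0 y0) _; rewrite Z0// mulr0.
have U0 y : 0 < y -> Uext s u 0 y = u 0.
  move=> y0; have lim := @Uext_cvg R s u M hs cu uM 0.
  have lim2 : Uext s u 0 t @[t --> 0^'+] --> Uext s u 0 y.
    apply: cvg_trans (@cvg_cst _ _ _ (at_right 0) _); apply: near_eq_cvg.
    near=> t.
    have t0 : 0 < t by near: t; exact: nbhs_right_gt.
    have ty : t <= y by near: t; exact: nbhs_right_le.
    apply: le_anti; apply/andP; split.
      by apply: (derive_le0_ge dU) => // z _; exact: lexx.
    by apply: (derive_ge0_le dU) => // z _; exact: lexx.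
  exact: cvg_unique lim2 lim.
pose h z := u z - u 0.
have ch : continuous h by move=> z; apply: cvgB; [exact: cu|exact: cvg_cst].
have hM z : `|h z| <= M + M by apply: le_trans (ler_normB _ _) _; exact: lerD.
pose b := s + 2^-1.
have b1 : 2^-1 < b by rewrite /b; lra.
have N0 := radial_mass_gt0 b1.
have J00 y : 0 < y -> rconv0 b h 0 y = 0.
  move=> y0; have i1 := integ_rconv0 cu uM 0 b1 y0; have i2 := integ_radial 0 b1 y0.
  have -> : rconv0 b h 0 y = rconv0 b u 0 y - u 0 * \int[mu]_z radial b (0 - z) y.
    rewrite /rconv0 -(@RintegralZl _ _ _ mu)// -(@RintegralB _ _ _ mu)//; last exact: integZ.
    by apply: eq_Rintegral => z _; rewrite /h; ring.
  rewrite (int_radial_sub 0 b1 y0) -{1}(U0 y y0) /Uext -/b.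
  have e : y `^ (2 * s) * y `^ (1 - 2 * b) = 1.
    by rewrite powRMD// -[RHS](powRr0 y); congr (_ `^ _); rewrite /b; field.
  transitivity (rconv0 b u 0 y - (y `^ (2 * s) * y `^ (1 - 2 * b)) * rconv0 b u 0 y).
    by field; rewrite gt_eqF.
  by rewrite e mul1r subrr.
have Jn n : forall y, 0 < y -> rconv0 (b + n%:R) h 0 y = 0.
  elim: n => [|n IH] y y0; first by rewrite addr0; exact: J00.
  have b2 : 2^-1 < b + n%:R by rewrite ltr_wpDr.
  have d1 := der_rconv0_y ch hM 0 b2 y0.
  have d2 : is_derive y 1 (rconv0 (b + n%:R) h 0) 0.
    apply: near_der (der_cst 0 y); near=> t; apply/esym/IH.
    by near: t; exact: lt_nbhsr.
  have := der_val d1; rewrite (der_val d2).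
  rewrite (_ : b + n%:R + 1 = b + n.+1%:R); last by rewrite -natr1 addrA.
  move=> /esym/eqP.
  rewrite mulf_eq0 => /orP[|/eqP//].
  have bn : 0 < 2 * (b + n%:R) by rewrite mulr_gt0//; lra.
  by rewrite mulNr oppr_eq0 gt_eqF// mulr_gt0.
have he z : h (- z) = h z by rewrite /h ue.
have hz := @stieltjes_zero R b h (M + M) b1 ch hM he.
move=> x; apply/eqP; rewrite -subr_eq0; apply/eqP; apply: hz => n.
rewrite -[RHS](Jn n 1 ltr01); apply: eq_Rintegral => z _.
by rewrite sub0r radialN.
Unshelve. all: by end_near. Qed.

End axis.

(** * The estimate of the Hamiltonian *)

Theorem theorem4p2 (R : realType) (s a T C kappa CT : R)
    (F u : R -> R) (U : R -> R -> R)
    (hs : 0 < s < 1) (ha : a = 1 - 2 * s) (hT : 0 < T)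
    (hF : double_well F)
    (u_cont : continuous u)
    (u_even : forall x, u (- x) = u x)
    (u_periodic : forall x, u (x + T) = u x)
    (u_sol : is_fracLap s T u (fun x => - derive1 F (u x)))
    (hC : poisson_normalized C s)
    (hU : is_s_harmonic_extension C s u U)
    (hkappa : 0 < kappa)
    (hCT : forall x, hamiltonian kappa a F U x `]0, +oo[ = CT) :
  let Chat := sup (range (fun x => - F (u x) - CT)) in
  ((exists x z, u x <> u z) -> 0 < Chat) /\
  (forall x y, 0 <= y -> hamiltonian kappa a F U x `]0, y[ - CT <= Chat).
Proof.
move=> Chat.
have [s0 s1] : 0 < s /\ s < 1 by case/andP: hs.
have ha' : -1 < 1 - 2 * s < 1 by apply/andP; split; lra.
have hs' : 0 < 1 - s < 1 by apply/andP; split; lra.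
case: hF => smF _ _ _ _.
have cF : continuous F.
  by move=> x; apply: differentiable_continuous; apply/derivable1_diffP; exact: (smF 0%N).
have cF' : continuous (derive1 F).
  by move=> x; apply: differentiable_continuous; apply/derivable1_diffP; exact: (smF 1%N).
have [M M0 uM] := periodic_bounded hT u_cont u_periodic.
(* f = (-d_xx)^s u, whose (1 - s)-extension is the conjugate of U *)
pose f x := - derive1 F (u x).
have cf : continuous f.
  move=> x; apply: cvgN; apply: (@continuous_comp _ _ _ u (derive1 F)); first exact: u_cont.
  exact: cF'.
have fe x : f (- x) = f x by rewrite /f u_even.
have fT x : f (x + T) = f x by rewrite /f u_periodic.
have [N N0 fN] := periodic_bounded hT cf fT.
have [lam hlam] := conjugate_extension hs hT u_cont cf uM fN u_even fe u_periodic fT u_sol.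
have wh := ext_weighted_harmonic hs u_cont uM.
have wh' := ext_weighted_harmonic hs' cf fN.
have [K K0 sb] := ext_scale_bounds hs u_cont uM.
have [K' K'0 sb'] := ext_scale_bounds hs' cf fN.
have [_ ZT _ _ XT] := ext_symmetries hs u_cont uM u_even u_periodic.
have XT' (x y : R) : 0 < y -> Xext s u (x + T) y = Xext s u x y by move=> y0; case: (XT x y y0).
have X00 y : 0 < y -> Xext s u 0 y = 0 by move=> y0; case: (XT 0 y y0).
have ZN (x y : R) : 0 < y -> `|Zext s u x y| <= `|lam| * N.
  by move=> y0; rewrite hlam// normrM ler_wpM2l// (Uext_bound hs' cf fN).
have SN (x y : R) : 0 < y -> `|Sext s u x y| <= `|lam| * K' * y `^ (-1).
  move=> y0; have -> : Sext s u x y = lam * Xext (1 - s) f x y.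
    rewrite -(der_val (wh_Zx wh x y0)) -(der_val (der_scal lam (wh_Ux wh' x y0))).
    by congr (derive1 _ x); apply/funext => z; exact: hlam.
  by rewrite normrM -mulrA ler_wpM2l// (sb_X sb').
have UE := poisson_Uext hs u_cont uM hC hU.
have U0 x : U x 0 = u x by case: hU.
pose Q := energy_density (1 - 2 * s) (Xext s u) (Zext s u).
pose W := tail_energy (1 - 2 * s) (Xext s u) (Zext s u).
have enE x (D : set R) : D `<=` `]0, +oo[ ->
    weighted_energy a U x D = \int[lebesgue_measure]_(t in D) Q x t.
  move=> D0; apply: eq_Rintegral => t; rewrite inE => /D0 /=; rewrite in_itv/= andbT => t0.
  have -> : derive1 (fun x' => U x' t) x = Xext s u x t.
    rewrite -(der_val (wh_Ux wh x t0)); congr (derive1 _ x).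
    by apply/funext => z; exact: UE.
  have -> : derive1 (fun y' => U x y') t = t `^ (- a) * Zext s u x t.
    rewrite ha; apply: der_val; apply: near_der (wh_Uy wh x t0).
    by near=> z; apply/esym/UE; near: z; exact: lt_nbhsr.
  have e : t `^ (- a) * t `^ a = 1 by rewrite powRMD// addNr powRr0.
  rewrite /Q /energy_density -ha.
  transitivity (t `^ a * Xext s u x t ^+ 2 -
     (t `^ (- a) * t `^ a) * (t `^ (- a) * Zext s u x t ^+ 2)); first by ring.
  by rewrite e mul1r.
have CTE x : kappa / 2 * \int[lebesgue_measure]_(t in `]0, +oo[) Q x t - F (u x) = CT.
  by rewrite -(hCT x) /hamiltonian enE// U0.
have vE x y : 0 < y -> hamiltonian kappa a F U x `]0, y[ - CT = - (kappa / 2 * W x y).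
  move=> y0; rewrite -(CTE x) /hamiltonian enE; last first.
    by move=> t /=; rewrite !in_itv/= andbT => /andP[].
  rewrite U0 (int_Q_split hs wh sb ZN SN ha' x y0) -/Q -/W.
  by ring.
have supC : has_sup (range (fun x => - F (u x) - CT)).
  split; first by exists (- F (u 0) - CT); exists 0.
  have [B B0 FB] : exists2 B, 0 < B & forall x, `|F (u x)| <= B.
    apply: (@periodic_bounded R T (fun x => F (u x))) => //; last by move=> x; rewrite u_periodic.
    move=> x; apply: (@continuous_comp _ _ _ u F); [exact: u_cont|exact: cF].
  exists (B - CT) => _ [x _ <-]; rewrite lerD2r.
  by have := FB x; rewrite ler_norml => /andP[? _]; lra.
have leC x : - F (u x) - CT <= Chat.
  by apply: sup_upper_bound => //; exists x.
(* on the axis x = 0 the density is - y^(-a) Z^2, because X is odd in x *)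
have v0 : - F (u 0) - CT =
    kappa / 2 * \int[lebesgue_measure]_(t in `]0, +oo[) (t `^ (- a) * Zext s u 0 t ^+ 2).
  rewrite -(CTE 0).
  have -> : \int[lebesgue_measure]_(t in `]0, +oo[) (t `^ (- a) * Zext s u 0 t ^+ 2) =
    \int[lebesgue_measure]_(t in `]0, +oo[) (-1 * Q 0 t).
    apply: eq_Rintegral => t; rewrite inE/= in_itv/= andbT => t0.
    by rewrite /Q /energy_density X00// ha; ring.
  rewrite (@RintegralZl _ _ _ lebesgue_measure)//; first by ring.
  exact: (integ_Q hs wh sb ZN SN ha').
have Zge0 t : `]0, +oo[%classic t -> 0 <= t `^ (- a) * Zext s u 0 t ^+ 2.
  by move=> _; rewrite mulr_ge0 ?powR_ge0// sqr_ge0.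
have k2 : 0 < kappa / 2 by rewrite divr_gt0.
have C0 : 0 <= Chat.
  apply: le_trans (leC 0); rewrite v0 mulr_ge0 ?(ltW k2)//.
  by apply: Rintegral_ge0.
split.
- move=> [x [z xz]]; rewrite lt_neqAle C0 andbT; apply/eqP => Ceq; apply: xz.
  have I0 : \int[lebesgue_measure]_(t in `]0, +oo[) (t `^ (- a) * Zext s u 0 t ^+ 2) = 0.
    have := leC 0; rewrite v0 -Ceq pmulr_rle0// => h.
    by apply/eqP; rewrite eq_le h Rintegral_ge0.
  have Z0 y : 0 < y -> Zext s u 0 y = 0.
    move=> y0; have yD : nbhs y `]0, +oo[%classic.
      exists y => // t; rewrite /ball_/= in_itv/= andbT ltr_distlC => /andP[+ _].
      by rewrite subrr.
    have iZ : integ `]0, +oo[ (fun t => t `^ (- a) * Zext s u 0 t ^+ 2).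
      have := integZ (-1) (measurable_itv _) (integ_Q hs wh sb ZN SN ha' 0).
      apply: eq_integrable => // t; rewrite inE/= in_itv/= andbT => t0.
      by congr EFin; rewrite /energy_density X00// ha; ring.
    have cZ : {for y, continuous (fun t => t `^ (- a) * Zext s u 0 t ^+ 2)}.
      apply: cvgM; first exact: powR_cont.
      by apply: continuous_exp; exact: (cont_Z wh).
    have /eqP := Int_eq0 (measurable_itv _) yD iZ Zge0 cZ I0.
    by rewrite mulf_eq0 gt_eqF ?powR_gt0//= sqrf_eq0 => /eqP.
  have uc := constant_axis hs u_cont uM u_even Z0.
  by rewrite (uc x) (uc z).
move=> x y; rewrite le_eqVlt => /predU1P[<-|y0].
  by rewrite /hamiltonian /weighted_energy set_itvoo0 Rintegral_set0 mulr0 sub0r U0.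
rewrite vE//; pose c := Chat / (kappa / 2).
have c0 : 0 <= c by rewrite divr_ge0// ltW.
have cE : kappa / 2 * c = Chat by rewrite /c mulrC divfK// gt_eqF.
have ga0 : 0 < 2 * (s * (1 - s)) by rewrite mulr_gt0// mulr_gt0// subr_gt0.
have hb e : 0 < e -> exists2 r, 0 < r & forall x y : R, 0 < y -> y < r -> - W x y <= c + e.
  move=> e0; pose B := ((K + (`|lam| * K') / (1 - s * (2 - s))) ^+ 2 + (`|lam| * N) ^+ 2) / (2 * (s * (1 - s))).
  have /cvgr0Pnorm_le /(_ _ e0) [r /= r0 hr] : (B * t `^ (2 * (s * (1 - s)))) @[t --> 0^'+] --> (0 : R).
    by rewrite -[X in _ --> X](mulr0 B); apply: cvgMr; exact: powR_cvg0.
  exists (Num.min r 1); first by rewrite lt_min r0 ltr01.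
  move=> x1 y1 y10; rewrite lt_min => /andP[y1r y11].
  have WE : - (kappa / 2 * W x1 y1) = kappa / 2 * \int[lebesgue_measure]_(t in `]0, y1[) Q x1 t
      + (- F (u x1) - CT).
    rewrite -(vE x1 y1 y10) /hamiltonian enE ?U0; first by ring.
    by move=> t /=; rewrite !in_itv/= andbT => /andP[].
  have Qle : \int[lebesgue_measure]_(t in `]0, y1[) Q x1 t <= e.
    rewrite Rintegral_itv_bndo_bndc; last first.
      apply: integW (integ_Q hs wh sb ZN SN ha' x1) => // t /=.
      by rewrite !in_itv/= andbT => /andP[].
    apply: le_trans (ler_norm _) _.
    apply: le_trans (int_Q_near0 hs wh sb ZN SN x1 y10 (ltW y11)) _.
    apply: le_trans (ler_norm _) _; apply: hr => //.
    by rewrite /ball_/= sub0r normrN gtr0_norm.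
  rewrite -(ler_pM2l k2) mulrN WE mulrDr cE addrC.
  by apply: lerD; [exact: leC|rewrite ler_pM2l].
have := max_principle wh sb ha' hT XT' ZT c0 hb x y0.
by rewrite -/W -(ler_pM2l k2) mulrN cE.
Unshelve. all: by end_near. Qed.
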